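(* Let $d\ge2$ be an integer. If $-d<\delta<1$ and $\delta\ne0$, then $$I_{d,\delta}(\sigma)-\frac{2}{N^2}\mathcal{E}_{d,\delta}(N)\sim N^{-1-\frac{\delta}{d}}.$$ In the logarithmic case $\delta=0$, $$I_{d,0}(\sigma)-\frac{2}{N^2}\mathcal{E}_{d,0}(N)\sim N^{-1}\log N.$$
   Context: $\mathbb{S}^d\subset\mathbb{R}^{d+1}$ is the unit sphere, $\sigma$ is the surface Lebesgue measure normalized by $\sigma(\mathbb{S}^d)=1$, and $\rho(x,y)=\arccos(x\cdot y)$ is the geodesic distance. Put $F_\delta(t)=(\arccos t)^\delta$ for $\delta\ne0$ and $F_0(t)=\log\left(\frac{\pi}{\arccos t}\right)$. Define $$I_{d,\delta}(\sigma)=\int_{\mathbb{S}^d}\int_{\mathbb{S}^d}F_\delta(x\cdot y)\,d\sigma(x)\,d\sigma(y).$$ For a set $Z_N=\{z_1,\dots,z_N\}$ of $N$ distinct points of $\mathbb{S}^d$, let $$E_{d,\delta}(Z_N)=\sum_{1\le i<j\le N}F_\delta(z_i\cdot z_j),$$ so that $E_{d,\delta}(Z_N)=\sum_{i<j}\rho(z_i,z_j)^\delta$ for $\delta\neq0$. The optimal discrete energy $\mathcal{E}_{d,\delta}(N)$ is $\inf_{Z_N}E_{d,\delta}(Z_N)$ if $\delta\le0$ and $\sup_{Z_N}E_{d,\delta}(Z_N)$ if $\delta>0$, taken over all $N$-point subsets $Z_N\subset\mathbb{S}^d$. The notation $A_N\sim B_N$ means that there are constants $c,C>0$, depending only on $d$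 and $\delta$, such that $c\,B_N\le A_N\le C\,B_N$ for all integers $N\ge2$. *)

(* Defs.v *)
From HB Require Import structures.
From mathcomp Require Import all_boot all_order all_algebra.
From mathcomp Require Import all_classical all_reals all_analysis.
From mathcomp Require Import measurable_realfun.
From mathcomp Require Import lra.

Set Implicit Arguments.
Unset Strict Implicit.
Unset Printing Implicit Defensive.

Import Order.TTheory GRing.Theory Num.Theory.
Import numFieldNormedType.Exports.

Local Open Scope classical_set_scope.
Local Open Scope ring_scope.

(* R^n is the type n.-tuple R, with the sigma-algebra generated by the
   coordinates, i.e. the Borel sets of R^n. *)

Section euclidean_space.
Context {R : realType}.

Definition dotp n (x y : n.-tuple R) : R := \sum_(i < n) tnth x i * tnth y i.

Definition enorm n (x : n.-tuple R) : R := Num.sqrt (dotp x x).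

Definition normalize n (x : n.-tuple R) : n.-tuple R :=
  [tuple tnth x i / enorm x | i < n].

Definition cons_pair n (p : measurableTypeR R * n.-tuple R) : n.+1.-tuple R :=
  [tuple of (p.1 : R) :: p.2].

Fixpoint lebesgue_tuple n : set (n.-tuple R) -> \bar R :=
  match n with
  | 0 => dirac [tuple]
  | m.+1 =>
      pushforward (product_measure1 lebesgue_measure (lebesgue_tuple (n := m)))
                  (@cons_pair m)
  end.

End euclidean_space.
Arguments lebesgue_tuple {R} n _.

Section lebesgue_tuple_measure.
Context {R : realType}.
Local Open Scope ereal_scope.

Lemma measurable_cons_pair n : measurable_fun setT (@cons_pair R n).
Proof.
apply: (@measurable_cons _ _ (measurableTypeR R * n.-tuple R)%type R
  (fun p => p.1 : R) n snd) => //.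
exact: (@measurable_fst _ _ (measurableTypeR R) (n.-tuple R)).
Qed.

Let is_sigma_finite_measure d (T : measurableType d) (m : set T -> \bar R) :=
  [/\ m set0 = 0, forall A, 0 <= m A, semi_sigma_additive m
    & sigma_finite setT m].

Let lebesgue_tuple_axioms n :
  is_sigma_finite_measure (@lebesgue_tuple R n).
Proof.
elim: n => [|n [m0 mge0 msA msf]].
  split; [exact: measure0 (dirac ([tuple] : 0.-tuple R))| | |].
  - by move=> A; exact: measure_ge0.
  - exact: (@measure_semi_sigma_additive _ _ _ (dirac ([tuple] : 0.-tuple R))).
  - exact: (@sigma_finiteT _ _ _ (dirac ([tuple] : 0.-tuple R))).
pose H := isMeasure.Build _ _ _ (@lebesgue_tuple R n) m0 mge0 msA.
pose mu0 : {measure set (n.-tuple R) -> \bar R} := HB.pack (@lebesgue_tuple R n) H.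
pose H2 := @Measure_isSigmaFinite.Build _ _ _ mu0 msf.
pose mu : {sigma_finite_measure set (n.-tuple R) -> \bar R} :=
  HB.pack (Measure.sort mu0) H2.
pose f := @cons_pair R n.
pose nu := product_measure1 (@lebesgue_measure R) mu.
pose m : {measure set (n.+1.-tuple R) -> \bar R} :=
  measure_function_pushforward__canonical__measure_function_Measure nu
    (@measurable_cons_pair n).
have mE : m = lebesgue_tuple n.+1 :> (set _ -> _) by [].
rewrite -mE; split; [exact: measure0 | exact: measure_ge0
  | exact: measure_semi_sigma_additive |].
pose g (x : n.+1.-tuple R) : measurableTypeR R * n.-tuple R :=
  (thead x, [tuple of behead x]).
have mg : measurable_fun setT g.
  apply/measurable_fun_pair => /=.
    exact: (@measurable_tnth _ R n.+1 ord0).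
  exact: measurable_behead.
have fgK : cancel f g.
  move=> [a t]; rewrite /f /g /cons_pair /= theadE; congr pair.
  by apply/val_inj.
have /sigma_finiteP[F [TF ndF Foo]] := sigma_finiteT (@lebesgue_measure R).
have /sigma_finiteP[G [TG ndG Goo]] := sigma_finiteT mu.
exists (fun i => g @^-1` (F i `*` G i)).
  rewrite -preimage_bigcup (_ : \bigcup_i _ = setT) ?preimage_setT//.
  rewrite predeqE => -[x y]; split => // _.
  have : [set: measurableTypeR R] x by []. rewrite TF => -[i _ Fix].
  have : [set: n.-tuple R] y by []. rewrite TG => -[j _ Gjy].
  exists (maxn i j) => //; split.
  - by move: x Fix; exact/subsetPset/ndF/leq_maxl.
  - by move: y Gjy; exact/subsetPset/ndG/leq_maxr.
move=> i; have [mF Fioo] := Foo i; have [mG Gioo] := Goo i.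
have mFG : measurable (F i `*` G i) by exact: measurableX.
split; first by rewrite -[X in measurable X]setTI; exact: mg.
rewrite mE /= /pushforward.
rewrite [X in product_measure1 _ _ X](_ : _ = F i `*` G i); last first.
  apply/funext => p; change ((F i `*` G i) (g (f p)) = (F i `*` G i) p).
  by rewrite fgK.
rewrite (@product_measure1E _ _ _ _ _ (@lebesgue_measure R) mu)//.
by rewrite lte_mul_pinfty// ge0_fin_numE.
Qed.

HB.instance Definition _ n := isMeasure.Build _ _ _ (@lebesgue_tuple R n)
  (let: And4 h _ _ _ := lebesgue_tuple_axioms n in h)
  (let: And4 _ h _ _ := lebesgue_tuple_axioms n in h)
  (let: And4 _ _ h _ := lebesgue_tuple_axioms n in h).

HB.instance Definition _ n :=
  Measure_isSigmaFinite.Build _ _ _ (@lebesgue_tuple R n)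
  (let: And4 _ _ _ h := lebesgue_tuple_axioms n in h).

Lemma measurable_box n (A : set R) : measurable A ->
  measurable [set x : n.-tuple R | forall i, A (tnth x i)].
Proof.
move=> mA.
rewrite (_ : mkset _ = \bigcap_(i in [set: 'I_n]) ((@tnth n R)^~ i @^-1` A)).
  apply: fin_bigcap_measurable => // i _; rewrite -[X in measurable X]setTI.
  exact: measurable_tnth.
by apply/seteqP; split => x /= h i; [move=> _|]; exact: h.
Qed.

Lemma lebesgue_tuple_box n (A : set R) : measurable A ->
  lebesgue_tuple n [set x | forall i, A (tnth x i)] = lebesgue_measure A ^+ n.
Proof.
move=> mA; elim: n => [|n IHn].
  rewrite expe0 [LHS]diracE mem_set//= => -[]//.
have mB := @measurable_box n A mA.
rewrite expeS -IHn /= /pushforward -[RHS]product_measure1E//.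
congr (_ \x _) => //.
apply/seteqP; split => -[a t] /=.
  move=> h; split; first exact: (h ord0).
  by move=> i; have := h (lift ord0 i); rewrite tnthS.
move=> [Aa At] i; have [j ->|->//] := unliftP ord0 i.
by rewrite tnthS; exact: At.
Qed.

End lebesgue_tuple_measure.

Section sphere.
Context {R : realType} (d : nat).
Local Open Scope ereal_scope.

Definition sphere : set (d.+1.-tuple R) := [set x | enorm x = 1%R].

Definition sector (A : set (d.+1.-tuple R)) : set (d.+1.-tuple R) :=
  [set x | (0 < enorm x < 1)%R /\ A (normalize x)].

(* Polar coordinates: the surface measure of A `<=` sphere is (d + 1) times the
   volume of the sector over A, and the factor d + 1 drops out when the total
   mass is normalized to 1. It is stated as a Borel measure on R^{d+1} that is
   carried by the sphere. *)
Definition surface_measure (A : set (d.+1.-tuple R)) : \bar R :=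
  ((fine (lebesgue_tuple d.+1 (sector setT)))^-1)%:E *
  lebesgue_tuple d.+1 (sector A).

Lemma measurable_enorm n : measurable_fun setT (@enorm R n).
Proof.
rewrite (_ : @enorm R n = fun x => powR (dotp x x) (2^-1)); last first.
  apply/funext => x; rewrite powR12_sqrt//.
  by apply: sumr_ge0 => i _; rewrite -expr2 sqr_ge0.
apply: measurableT_comp (measurable_powR _) _.
by apply: measurable_sum => i; apply: measurable_funM; exact: measurable_tnth.
Qed.

Lemma measurable_normalize n : measurable_fun setT (@normalize R n).
Proof.
apply/measurable_fun_tnthP => i.
rewrite (_ : _ \o _ = fun x : n.-tuple R => (tnth x i * powR (enorm x) (-1))%R).
  apply: measurable_funM; first exact: measurable_tnth.
  by apply: measurableT_comp (measurable_powR _) _; exact: measurable_enorm.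
by apply/funext => x /=; rewrite tnth_mktuple powR_inv1// sqrtr_ge0.
Qed.

Lemma measurable_sector A : measurable A -> measurable (sector A).
Proof.
move=> mA; rewrite (_ : sector A =
  (@enorm R d.+1) @^-1` `]0%R, 1%R[ `&` (@normalize R d.+1) @^-1` A).
  apply: measurableI; rewrite -[X in measurable X]setTI.
    exact: measurable_enorm.
  exact: measurable_normalize.
by apply/seteqP; split => x /=; rewrite in_itv.
Qed.

Let ler_tnth_enorm (x : d.+1.-tuple R) i : (`|tnth x i| <= enorm x)%R.
Proof.
rewrite -sqrtr_sqr ler_wsqrtr// /dotp (bigD1 i)//= -expr2 lerDl.
by apply: sumr_ge0 => j _; rewrite -expr2 sqr_ge0.
Qed.

Lemma sectorT_fin_num : lebesgue_tuple d.+1 (sector setT) \is a fin_num.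
Proof.
rewrite ge0_fin_numE ?measure_ge0//.
pose B := [set x : d.+1.-tuple R | forall i, `](-1)%R, 1%R[%classic (tnth x i)].
apply: (@le_lt_trans _ _ (lebesgue_tuple d.+1 B)); last first.
  rewrite lebesgue_tuple_box// (_ : lebesgue_measure _ = 2%:E).
    by rewrite -EFin_expe ltry.
  by rewrite lebesgue_measure_itv /= lte_fin ifT -?EFinB ?opprK//; lra.
apply: le_measure; rewrite ?inE.
- exact: measurable_sector.
- exact: measurable_box.
move=> x [/andP[_ x1] _] i /=; rewrite in_itv /= -ltr_norml.
exact: le_lt_trans (ler_tnth_enorm x i) x1.
Qed.

Lemma sectorT_gt0 : 0 < lebesgue_tuple d.+1 (sector setT).
Proof.
pose B := [set x : d.+1.-tuple R |
  forall i, `]0%R, (d.+1%:R^-1)%R[%classic (tnth x i)].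
apply: (@lt_le_trans _ _ (lebesgue_tuple d.+1 B)).
  rewrite lebesgue_tuple_box// (_ : lebesgue_measure _ = (d.+1%:R^-1)%:E).
    by rewrite -EFin_expe lte_fin exprn_gt0// invr_gt0 ltr0Sn.
  by rewrite lebesgue_measure_itv /= lte_fin invr_gt0 ltr0Sn sube0.
apply: le_measure; rewrite ?inE.
- exact: measurable_box.
- exact: measurable_sector.
move=> x Bx; split=> //; apply/andP; split.
  apply: lt_le_trans (ler_tnth_enorm x ord0).
  by have := Bx ord0; rewrite /= in_itv /= => /andP[x0 _]; rewrite normr_gt0 gt_eqF.
rewrite -sqrtr1 ltr_sqrt//.
apply: (@lt_le_trans _ _ (\sum_(i < d.+1) (d.+1%:R^-1 : R))%R).
  apply: ltr_sum => [|i _]; first by apply/hasP; exists ord0; rewrite ?mem_index_enum.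
  have := Bx i; rewrite /= in_itv /= => /andP[x0 x1].
  rewrite -[ltRHS]mulr1; apply: ltr_pM => //; rewrite ?ltW//.
  by apply: lt_le_trans x1 _; rewrite invf_le1 ?ltr0Sn// ler1n.
by rewrite sumr_const card_ord -[leLHS]mulr_natl divff.
Qed.

Let surface_measure0 : surface_measure set0 = 0.
Proof.
rewrite /surface_measure (_ : sector set0 = set0) ?measure0 ?mule0//.
by apply/seteqP; split => // x [].
Qed.

Let surface_measure_ge0 A : 0 <= surface_measure A.
Proof. by rewrite mule_ge0// lee_fin invr_ge0 fine_ge0. Qed.

Let surface_measure_sigma_additive : semi_sigma_additive surface_measure.
Proof.
move=> F mF tF mUF; rewrite /surface_measure.
under eq_fun do rewrite -ge0_sume_distrr//.
apply: cvgeZl => //.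
rewrite (_ : sector _ = \bigcup_k sector (F k)); last first.
  apply/seteqP; split => x.
    by move=> [x01 [k _ Fkx]]; exists k.
  by move=> [k _ [x01 Fkx]]; split=> //; exists k.
apply: measure_semi_sigma_additive.
- by move=> k; exact: measurable_sector.
- apply/trivIsetP => i j _ _ ij; apply/seteqP; split => // x [[_ Fi] [_ Fj]].
  have : (F i `&` F j) (normalize x) by [].
  by move/trivIsetP : tF => /(_ i j I I ij) ->.
- by apply: bigcup_measurable => k _; exact: measurable_sector.
Qed.

HB.instance Definition _ := isMeasure.Build _ _ _ surface_measure
  surface_measure0 surface_measure_ge0 surface_measure_sigma_additive.

Let surface_measure_setT : surface_measure setT = 1.
Proof.
rewrite /surface_measure -[X in _ * X]fineK ?sectorT_fin_num// -EFinM mulVf//.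
by rewrite gt_eqF// fine_gt0// sectorT_gt0/= ltey_eq sectorT_fin_num.
Qed.

HB.instance Definition _ :=
  Measure_isProbability.Build _ _ _ surface_measure surface_measure_setT.

Lemma surface_measure_sphere : surface_measure sphere = 1.
Proof.
rewrite -surface_measure_setT /surface_measure; congr (_ * lebesgue_tuple _ _).
apply/seteqP; split => x [x01 _]; split=> //=.
have x0 : (0 < enorm x)%R by case/andP: x01.
rewrite /sphere /= /enorm /dotp.
under eq_bigr do rewrite tnth_mktuple mulrACA -invfM -expr2.
rewrite -big_distrl/= -/(dotp x x) -[dotp x x]sqr_sqrtr ?divff ?sqrtr1//.
  by rewrite -/(enorm x) expf_neq0// gt_eqF.
by apply: sumr_ge0 => i _; rewrite -expr2 sqr_ge0.
Qed.

End sphere.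
Arguments sphere {R} d _.
Arguments sector {R} d A _.
Arguments surface_measure {R} d A.

Section energy.
Context {R : realType}.

(* The value at t = 1 is irrelevant: in the integrals it is reached on a null
   set, and in the energies it is excluded because the points are distinct. *)
Definition potential (delta t : R) : R :=
  if delta == 0 then ln (pi / acos t) else acos t `^ delta.

Definition energy_integral d (delta : R) : \bar R :=
  (\int[surface_measure d]_(x in sphere d)
    \int[surface_measure d]_(y in sphere d)
      (potential delta (dotp x y))%:E)%E.

Definition configuration d N : set ('I_N -> d.+1.-tuple R) :=
  [set z | injective z /\ forall i, sphere d (z i)].
Arguments configuration : clear implicits.

Definition discrete_energy n N (delta : R) (z : 'I_N -> n.-tuple R) : R :=
  \sum_(i < N) \sum_(j < N | (i < j)%N) potential delta (dotp (z i) (z j)).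

Definition optimal_energy d (delta : R) N : \bar R :=
  let energies :=
    [set (discrete_energy delta z)%:E | z in configuration d N] in
  if delta <= 0 then ereal_inf energies else ereal_sup energies.

Definition energy_gap d (delta : R) N : \bar R :=
  (energy_integral d delta
   - (2 / N%:R ^+ 2)%:E * optimal_energy d delta N)%E.

Definition same_order (A : nat -> \bar R) (B : nat -> R) : Prop :=
  exists c C : R, [/\ 0 < c, 0 < C &
    forall N, (2 <= N)%N -> ((c * B N)%:E <= A N <= (C * B N)%:E)%E].

End energy.
Arguments configuration {R} d N _.

(* Main.v *)
Require Import Defs.
From mathcomp Require Import all_boot all_order all_algebra.
From mathcomp Require Import all_classical all_reals all_analysis.
From mathcomp Require Import measurable_realfun lra ssrAC.

Set Implicit Arguments.
Unset Strict Implicit.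
Unset Printing Implicit Defensive.

Import Order.TTheory GRing.Theory Num.Theory.
Import numFieldNormedType.Exports.

Local Open Scope classical_set_scope.
Local Open Scope ring_scope.

(** The optimal energy is compared with [(N ^ 2 / 2) * I], where [I] is the energy
    of the uniform measure, by one inequality that holds for every configuration
    and by one configuration that is nearly as good. Write [rho] for the geodesic
    distance.

    Every configuration. The kernels [exp (- t rho)] are positive definite: with
    [u = cos rho] one has [exp (t (pi / 2 - rho)) = exp (t asin u)], a power series
    in [u] with nonnegative coefficients ([expasin_coef_ge0], [expasin_cvg]), and the
    powers of the inner product are positive definite ([moment_le]). Hence the sum
    of [exp (- t rho)] over all ordered pairs of points, the [N] diagonal ones
    included, is at least [N ^ 2] times its mean ([decay_energy]): the mean exceeds
    the normalized off-diagonal sum by at most [1 / N]. It also exceeds it by at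
    most the mean itself, which is of order [t ^ (- d)] because caps of radius [r]
    have measure of order [r ^ d] ([zonal_decay_le]). The potentials are mixtures of
    these exponentials ([mixture_neg], [mixture_zero], [mixture_pos]), and
    integrating the smaller of the two errors, which cross at [t = N ^ (1 / d)],
    gives the rates ([energy_ge_neg], [energy_ge_zero]). For [delta] in [(0, 1)]
    the mixture is one of [1 - exp (- t rho)], inequalities are reversed, and what
    is integrated is the gain [1 / N - C t ^ (- d)] for large [t] ([energy_le_pos]).

    Good configurations. Let [N] times the uniform measure dominate a sum of [N]
    probability densities [g_i], and draw the [i]-th point from [g_i],
    independently. The expected energy of a kernel [k >= 0] over ordered pairs is at
    most [N ^ 2 I] minus the sum of the self-energies of the [g_i], so some
    configuration is that good ([random_configuration]). To bound self-energies
    from below, replace the kernel, a convex function of [rho], by its tangent line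
    at [rho = C N ^ (- 1 / d)]: it suffices that the mean distance of two points
    drawn from the same [g_i] is on average at most [C N ^ (- 1 / d)]
    ([tangent_configuration]). Such densities come from covering the sphere by at
    most [N / 2] sets of diameter of order [N ^ (- 1 / d)] and cutting the mass in
    each of them into units; less than one unit per set is left over, that is at
    most half of the mass, and it is cut up in the same way ([low_energy_partition]).
    Here [d >= 2] makes the resulting geometric series converge.

    Rotation invariance of the surface measure enters throughout, through the fact
    that means of [k (x . y)] in [y] do not depend on [x]. It is derived from the
    translation invariance of Lebesgue measure ([translation_invariant_reflect]). *)

(** * Integrals of real functions *)

Section real_integrals.
Context d (T : measurableType d) (R : realType).

Lemma measurable_lt_set (f : T -> R) (a : R) : measurable_fun setT f ->
  measurable [set x | f x < a].
Proof.
move=> mf; rewrite (_ : mkset _ = f @^-1` `]-oo, a[).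
  by rewrite -[X in measurable X]setTI; exact: mf.
by apply/seteqP; split => x /=; rewrite in_itv.
Qed.

Lemma measurable_le_set (f : T -> R) (a : R) : measurable_fun setT f ->
  measurable [set x | f x <= a].
Proof.
move=> mf; rewrite (_ : mkset _ = f @^-1` `]-oo, a]).
  by rewrite -[X in measurable X]setTI; exact: mf.
by apply/seteqP; split => x /=; rewrite in_itv.
Qed.

Lemma measurable_ge_set (f : T -> R) (a : R) : measurable_fun setT f ->
  measurable [set x | a <= f x].
Proof.
move=> mf; rewrite (_ : mkset _ = f @^-1` `[a, +oo[).
  by rewrite -[X in measurable X]setTI; exact: mf.
by apply/seteqP; split => x /=; rewrite in_itv/= andbT.
Qed.

Variable mu : {measure set T -> \bar R}.

Lemma integral_EFinZ (f : T -> R) (k : R) : measurable_fun setT f ->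
  (forall x, 0 <= f x) -> 0 <= k ->
  (\int[mu]_x (k * f x)%:E = k%:E * \int[mu]_x (f x)%:E)%E.
Proof.
move=> mf f0 k0; have mf' : measurable_fun setT (EFin \o f) by exact/measurable_EFinP.
rewrite -(@ge0_integralZl _ _ _ mu setT measurableT _ mf' k%:E) ?lee_fin//.
by move=> x _; rewrite lee_fin.
Qed.

Lemma integral_EFinD (f g : T -> R) : measurable_fun setT f -> measurable_fun setT g ->
  (forall x, 0 <= f x) -> (forall x, 0 <= g x) ->
  (\int[mu]_x (f x + g x)%:E = \int[mu]_x (f x)%:E + \int[mu]_x (g x)%:E)%E.
Proof.
move=> mf mg f0 g0.
have mf' : measurable_fun setT (EFin \o f) by exact/measurable_EFinP.
have mg' : measurable_fun setT (EFin \o g) by exact/measurable_EFinP.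
by rewrite -(@ge0_integralD _ _ _ mu setT measurableT _ _ _ mf' _ mg')//;
  move=> x _; rewrite lee_fin.
Qed.

Lemma le_integral_EFin (f g : T -> R) : measurable_fun setT f -> measurable_fun setT g ->
  (forall x, 0 <= f x) -> (forall x, f x <= g x) ->
  (\int[mu]_x (f x)%:E <= \int[mu]_x (g x)%:E)%E.
Proof.
move=> mf mg f0 fg.
have mf' : measurable_fun setT (EFin \o f) by exact/measurable_EFinP.
have mg' : measurable_fun setT (EFin \o g) by exact/measurable_EFinP.
by apply: (@ge0_le_integral _ _ _ mu setT measurableT _ _ _ mf' mg') => x _; rewrite lee_fin.
Qed.

End real_integrals.

(** * Translation invariance of Lebesgue measure *)

Section translation_invariance.
Context {R : realType}.
Local Open Scope ereal_scope.

Lemma lebesgue_measure_translate (v : R) (A : set R) : measurable A ->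
  lebesgue_measure ((fun x : R => (x + v)%R) @^-1` A) = lebesgue_measure A.
Proof.
move=> mA; pose f : R -> measurableTypeR R := fun x => (x + v)%R.
have mf : measurable_fun setT f by exact: measurable_funD.
change (pushforward (@lebesgue_measure R) f A = lebesgue_measure A).
apply/esym.
apply: (@lebesgue_measure_unique R
  (measure_function_pushforward__canonical__measure_function_Measure (@lebesgue_measure R) mf)) => //= _ [[a b]] _ <-.
rewrite /pushforward.
have -> : f @^-1` `]a, b] = `](a - v)%R, (b - v)%R]%classic.
  by apply/seteqP; split => x; rewrite /f /= !in_itv/= lerBrDr ltrBlDr.
by rewrite !lebesgue_measure_itv/= !lte_fin ltrD2r -!EFinD opprD addrACA subrr addr0.
Qed.

Lemma ge0_integral_translate (v : R) (f : R -> \bar R) :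
  measurable_fun setT f -> (forall x, 0 <= f x) ->
  \int[lebesgue_measure]_x f (x + v)%R = \int[lebesgue_measure]_x f x.
Proof.
move=> mf f0; pose g : measurableTypeR R -> measurableTypeR R := fun x => (x + v)%R.
have mg : measurable_fun setT g by exact: measurable_funD.
transitivity (\int[pushforward (@lebesgue_measure R) g]_x f x).
  by rewrite ge0_integral_pushforward//.
by apply: eq_measure_integral => A mA _; exact: lebesgue_measure_translate.
Qed.

Definition addt n (x y : n.-tuple R) : n.-tuple R :=
  [tuple (tnth x i + tnth y i)%R | i < n].

Lemma measurable_addtr n (v : n.-tuple R) : measurable_fun setT (fun x => addt x v).
Proof.
apply/measurable_fun_tnthP => i.
rewrite (_ : _ \o _ = fun x : n.-tuple R => (tnth x i + tnth v i)%R); last first.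
  by apply/funext => x /=; rewrite tnth_mktuple.
by apply: measurable_funD => //; exact: measurable_tnth.
Qed.

Lemma addt_cons n (a b : R) (x y : n.-tuple R) :
  addt [tuple of a :: x] [tuple of b :: y] = [tuple of (a + b)%R :: addt x y].
Proof.
apply: eq_from_tnth => i; rewrite tnth_mktuple.
by have [j ->|->] := unliftP ord0 i; rewrite ?tnth0// !tnthS tnth_mktuple.
Qed.

Lemma lebesgue_tuple_translate n (v : n.-tuple R) A : measurable A ->
  lebesgue_tuple n ((fun x => addt x v) @^-1` A) = lebesgue_tuple n A.
Proof.
elim: n v A => [|n IHn] v A mA.
  congr (_ _); apply/seteqP; split => x; rewrite /preimage /=;
    by rewrite (tuple0 (addt x v)) (tuple0 x).
have mc := @measurable_cons_pair R n.
have mcA : measurable (@cons_pair R n @^-1` A).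
  by rewrite -[X in measurable X]setTI; exact: mc.
pose phi x := lebesgue_tuple n (xsection (@cons_pair R n @^-1` A) x).
have mphi : measurable_fun setT phi by exact: measurable_fun_xsection.
rewrite /= /pushforward.
change (\int[lebesgue_measure]_x (lebesgue_tuple n (xsection (@cons_pair R n @^-1` ((fun x => addt x v) @^-1` A)) x))
  = \int[lebesgue_measure]_x (phi x)).
rewrite -(@ge0_integral_translate (thead v) phi)//.
apply: eq_integral => x _; rewrite /phi -[RHS](IHn [tuple of behead v]); last first.
  exact: measurable_xsection.
congr (lebesgue_tuple n _).
have E y : addt (cons_pair (x, y)) v =
    cons_pair ((x + thead v)%R, addt y [tuple of behead v]).
  by rewrite {1}(tuple_eta v) /cons_pair addt_cons.
by apply/seteqP; split => y /xsectionP; rewrite /preimage /= => Ay;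
  apply/xsectionP; move: Ay; rewrite /preimage /= E.
Qed.

Lemma ge0_integral_translate_tuple n
    (lam : {measure set (n.-tuple R) -> \bar R})
    (lamD : forall v A, measurable A -> lam ((fun x => addt x v) @^-1` A) = lam A)
    (v : n.-tuple R) (f : n.-tuple R -> \bar R) :
  measurable_fun setT f -> (forall x, 0 <= f x) ->
  \int[lam]_x f (addt x v) = \int[lam]_x f x.
Proof.
move=> mf f0.
transitivity (\int[pushforward lam (fun x => addt x v)]_x f x).
  by rewrite (ge0_integral_pushforward (measurable_addtr v)).
apply: eq_measure_integral => [|mphi A mA _]; first exact: measurable_addtr.
exact: lamD.
Qed.

End translation_invariance.

(** * Reflections *)

Section reflection.
Context {R : realType} (n : nat).
Implicit Types x y w : n.-tuple R.

Definition oppt x : n.-tuple R := [tuple - tnth x i | i < n].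

Definition reflect w x : n.-tuple R :=
  [tuple tnth x i - 2 * dotp x w / dotp w w * tnth w i | i < n].

Lemma dotpC x y : dotp x y = dotp y x.
Proof. by apply: eq_bigr => i _; rewrite mulrC. Qed.

Lemma dotp_ge0 x : 0 <= dotp x x.
Proof. by apply: sumr_ge0 => i _; rewrite -expr2 sqr_ge0. Qed.

Lemma dotp_eq0 x : dotp x x = 0 -> forall i, tnth x i = 0.
Proof.
move=> /eqP; rewrite psumr_eq0; last by move=> i _; rewrite -expr2 sqr_ge0.
by move=> /allP h i; apply/eqP; have := h i (mem_index_enum _); rewrite /= mulf_eq0 orbb.
Qed.

Lemma dotpDl x y w : dotp (addt x y) w = dotp x w + dotp y w.
Proof.
by rewrite /dotp -big_split/=; apply: eq_bigr => i _; rewrite tnth_mktuple mulrDl.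
Qed.

Lemma dotpNl x w : dotp (oppt x) w = - dotp x w.
Proof.
by rewrite /dotp -sumrN; apply: eq_bigr => i _; rewrite tnth_mktuple mulNr.
Qed.

Lemma dotpDr x y w : dotp w (addt x y) = dotp w x + dotp w y.
Proof. by rewrite dotpC dotpDl !(dotpC w). Qed.

Lemma dotpNr x w : dotp w (oppt x) = - dotp w x.
Proof. by rewrite dotpC dotpNl (dotpC w). Qed.

Lemma dotpBB x y : dotp (addt x (oppt y)) (addt x (oppt y)) =
  dotp x x - 2 * dotp x y + dotp y y.
Proof.
rewrite dotpDl !dotpDr !dotpNl !dotpNr (dotpC y x); lra.
Qed.

Lemma dotp_reflectl w x y :
  dotp (reflect w x) y = dotp x y - 2 * dotp x w / dotp w w * dotp w y.
Proof.
rewrite /dotp mulr_sumr -sumrB; apply: eq_bigr => i _.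
by rewrite tnth_mktuple mulrBl mulrA.
Qed.

Lemma dotp_reflect w x y : dotp (reflect w x) (reflect w y) = dotp x y.
Proof.
rewrite dotp_reflectl (dotpC x (reflect _ _)) (dotpC w (reflect _ _)) !dotp_reflectl.
rewrite (dotpC y x).
have [->|w0] := eqVneq (dotp w w) 0; first by rewrite invr0 !(mulr0, mul0r) !subr0.
have -> : dotp y w - 2 * dotp y w / dotp w w * dotp w w = - dotp y w.
  by rewrite divfK//; lra.
by rewrite (dotpC w x); lra.
Qed.

Lemma enorm_reflect w x : enorm (reflect w x) = enorm x.
Proof. by rewrite /enorm dotp_reflect. Qed.

Lemma reflectK w : involutive (reflect w).
Proof.
move=> x; apply: eq_from_tnth => i; rewrite !tnth_mktuple dotp_reflectl.
have [->|w0] := eqVneq (dotp w w) 0; first by rewrite invr0 !(mulr0, mul0r) !subr0.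
by rewrite divfK//; lra.
Qed.

Lemma reflectD w x y : reflect w (addt x y) = addt (reflect w x) (reflect w y).
Proof.
apply: eq_from_tnth => i; rewrite !tnth_mktuple dotpDl.
by rewrite mulrDr !mulrDl; lra.
Qed.

Lemma reflectN w x : reflect w (oppt x) = oppt (reflect w x).
Proof. by apply: eq_from_tnth => i; rewrite !tnth_mktuple dotpNl; lra. Qed.

Lemma enormN x : enorm (oppt x) = enorm x.
Proof. by rewrite /enorm dotpNl dotpNr opprK. Qed.

Lemma addtC x y : addt x y = addt y x.
Proof. by apply: eq_from_tnth => i; rewrite !tnth_mktuple addrC. Qed.

Lemma opptK : involutive oppt.
Proof. by move=> x; apply: eq_from_tnth => i; rewrite !tnth_mktuple opprK. Qed.

Lemma opptD x y : oppt (addt x y) = addt (oppt x) (oppt y).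
Proof. by apply: eq_from_tnth => i; rewrite !tnth_mktuple opprD. Qed.

(** The hyperplane orthogonal to [x - y] bisects two vectors of equal length. *)
Lemma reflect_swap x y : dotp x x = dotp y y ->
  reflect (addt x (oppt y)) x = y.
Proof.
move=> xy; apply: eq_from_tnth => i; rewrite tnth_mktuple.
have E : dotp (addt x (oppt y)) (addt x (oppt y)) =
    2 * dotp x (addt x (oppt y)).
  by rewrite dotpBB -xy dotpDr dotpNr; lra.
have [w0|w0] := eqVneq (dotp (addt x (oppt y)) (addt x (oppt y))) 0.
  have := dotp_eq0 w0 i; rewrite !tnth_mktuple w0 => h.
  by rewrite invr0 mulr0 mul0r; lra.
by rewrite -E divff// mul1r !tnth_mktuple; lra.
Qed.

End reflection.

(** * Rotation invariance of the surface measure *)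

Section reflection_invariance.
Context {R : realType}.
Local Open Scope ereal_scope.

Lemma measurable_dotp d (T : measurableType d) n (f g : T -> n.-tuple R) :
  measurable_fun setT f -> measurable_fun setT g ->
  measurable_fun setT (fun x => dotp (f x) (g x)).
Proof.
move=> mf mg; apply: measurable_sum => i.
by apply: measurable_funM; apply: (measurableT_comp (measurable_tnth i)).
Qed.

Lemma measurable_addt d (T : measurableType d) n (f g : T -> n.-tuple R) :
  measurable_fun setT f -> measurable_fun setT g ->
  measurable_fun setT (fun x => addt (f x) (g x)).
Proof.
move=> mf mg; apply/measurable_fun_tnthP => i.
rewrite (_ : _ \o _ = fun x => (tnth (f x) i + tnth (g x) i)%R); last first.
  by apply/funext => x /=; rewrite tnth_mktuple.
by apply: measurable_funD; apply: (measurableT_comp (measurable_tnth i)).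
Qed.

Lemma measurable_reflect d (T : measurableType d) n w (f : T -> n.-tuple R) :
  measurable_fun setT f -> measurable_fun setT (fun x => reflect w (f x)).
Proof.
move=> mf; apply/measurable_fun_tnthP => i.
rewrite (_ : _ \o _ = fun x => (tnth (f x) i - 2 / dotp w w * tnth w i * dotp (f x) w)%R); last first.
  by apply/funext => x /=; rewrite tnth_mktuple; lra.
apply: measurable_funB; first exact: (measurableT_comp (measurable_tnth i)).
by apply: measurable_funM => //; exact: measurable_dotp.
Qed.

Lemma measurable_oppt d (T : measurableType d) n (f : T -> n.-tuple R) :
  measurable_fun setT f -> measurable_fun setT (fun x => oppt (f x)).
Proof.
move=> mf; apply/measurable_fun_tnthP => i.
rewrite (_ : _ \o _ = fun x => (- tnth (f x) i)%R); last first.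
  by apply/funext => x /=; rewrite tnth_mktuple.
by apply: measurableT_comp => //; apply: (measurableT_comp (measurable_tnth i)).
Qed.

Lemma mule_fin_inj (b x y : \bar R) : 0 < b -> b \is a fin_num ->
  b * x = b * y -> x = y.
Proof.
move: b => [b||]//; rewrite lte_fin => b0 _ /(congr1 (fun u => b^-1%:E * u)).
by rewrite !muleA -EFinM mulVf ?gt_eqF// !mul1e.
Qed.

(** A reflection [T] changes a translation invariant measure by a factor only,
    and a set [B] that it preserves shows that the factor is 1. Both facts come
    from evaluating the double integral of [B x] times [A (y + T x)] in the two
    possible orders. Integrating in [y] first gives [lam B * lam A]. The
    substitution [x := x - T y] turns [A (y + T x)] into [A (T x)] and [B x] into
    [B (x - T y)], which is [B (y - T x)] as [T] is an isometric involution and [B]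
    is radial and symmetric; integrating in [y] first now gives
    [lam B * lam (T @^-1` A)]. *)
Lemma translation_invariant_reflect n
    (lam : {sigma_finite_measure set (n.-tuple R) -> \bar R})
    (lamD : forall v A, measurable A -> lam ((fun x => addt x v) @^-1` A) = lam A)
    (b : set R) w (A : set (n.-tuple R)) :
  let B : set (n.-tuple R) := [set x | b (enorm x)] in
  measurable B -> 0 < lam B -> lam B \is a fin_num -> measurable A ->
  lam (reflect w @^-1` A) = lam A.
Proof.
move=> B mB B0 Bfin mA; set T := reflect w.
have mT : measurable_fun setT T by exact: measurable_reflect.
have mTA : measurable (T @^-1` A) by rewrite -[X in measurable X]setTI; exact: mT.
have indicB x y : \1_B (addt x (oppt (T y))) = \1_B (addt y (oppt (T x))) :> R.
  rewrite !indicE; congr (_ _)%:R; rewrite /B.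
  suff E : enorm (addt x (oppt (T y))) = enorm (addt y (oppt (T x))).
    by apply/idP/idP; rewrite !inE /= E.
  rewrite -(enorm_reflect w) reflectD reflectN reflectK -/T -enormN opptD.
  by rewrite opptK addtC.
have mf : measurable_fun setT (fun p : n.-tuple R * n.-tuple R =>
   (\1_B p.1 * \1_A (addt p.2 (T p.1)) : R)%R).
  apply: measurable_funM.
    exact: measurableT_comp.
  apply: (measurableT_comp (measurable_indic mA)).
  by apply: measurable_addt => //; exact: measurable_reflect.
have mA' x : measurable_fun setT (fun y => (\1_A (addt y x))%:E : \bar R).
  by apply/measurable_EFinP; apply: (measurableT_comp (measurable_indic mA)); exact: measurable_addtr.
have mB' x : measurable_fun setT (fun y => (\1_B (addt y x))%:E : \bar R).
  by apply/measurable_EFinP; apply: (measurableT_comp (measurable_indic mB)); exact: measurable_addtr.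
have tr (C : set (n.-tuple R)) v : measurable C -> \int[lam]_y (\1_C (addt y v))%:E = lam C.
  move=> mC; rewrite (@ge0_integral_translate_tuple R _ lam lamD v (fun y => (\1_C y)%:E)).
  - by rewrite integral_indic// setIT.
  - exact/measurable_EFinP.
  - by move=> x; rewrite lee_fin.
have step1 : lam B * lam A =
  \int[lam]_x \int[lam]_y (\1_B x * \1_A (addt y (T x)))%:E.
  transitivity (\int[lam]_x ((\1_B x)%:E * lam A)).
    rewrite ge0_integralZr//; last exact/measurable_EFinP.
    by rewrite integral_indic// setIT.
  apply: eq_integral => x _; rewrite -(tr A (T x) mA) -ge0_integralZl//.
have step2 :
  \int[lam]_x \int[lam]_y (\1_B x * \1_A (addt y (T x)))%:E =
  \int[lam]_y \int[lam]_x (\1_B x * \1_A (addt y (T x)))%:E.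
  apply: (@fubini_tonelli _ _ _ _ R lam lam (fun p => (\1_B p.1 * \1_A (addt p.2 (T p.1)))%:E)).
    exact/measurable_EFinP.
  by move=> p; rewrite lee_fin mulr_ge0.
have step3 y : \int[lam]_x (\1_B x * \1_A (addt y (T x)))%:E =
   \int[lam]_x (\1_B (addt y (oppt (T x))) * \1_A (T x))%:E.
  rewrite -(@ge0_integral_translate_tuple R _ lam lamD (oppt (T y)) (fun x => (\1_B x * \1_A (addt y (T x)))%:E)).
  - apply: eq_integral => x _; rewrite indicB.
    suff -> : addt y (T (addt x (oppt (T y)))) = T x by [].
    rewrite /T reflectD reflectN reflectK; apply: eq_from_tnth => i.
    by rewrite !tnth_mktuple; lra.
  - apply/measurable_EFinP.
    apply: measurable_funM; first exact: measurable_indic.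
    apply: (measurableT_comp (measurable_indic mA)).
    by apply: (measurable_addt (f := fun=> y)).
  - by move=> x; rewrite lee_fin mulr_ge0.
have step4 : \int[lam]_y \int[lam]_x (\1_B (addt y (oppt (T x))) * \1_A (T x))%:E =
  \int[lam]_x \int[lam]_y (\1_B (addt y (oppt (T x))) * \1_A (T x))%:E.
  apply: (@fubini_tonelli _ _ _ _ R lam lam (fun p => (\1_B (addt p.1 (oppt (T p.2))) * \1_A (T p.2))%:E)).
    apply/measurable_EFinP/measurable_funM.
      apply: (measurableT_comp (measurable_indic mB)).
      apply: measurable_addt; first exact: measurable_fst.
      by apply: measurable_oppt; apply: measurable_reflect; exact: measurable_snd.
    apply: (measurableT_comp (measurable_indic mA)).
    by apply: measurable_reflect; exact: measurable_snd.
  by move=> p; rewrite lee_fin mulr_ge0.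
have step5 : \int[lam]_x \int[lam]_y (\1_B (addt y (oppt (T x))) * \1_A (T x))%:E =
  lam B * lam (T @^-1` A).
  transitivity (\int[lam]_x (lam B * (\1_(T @^-1` A) x)%:E)).
    apply: eq_integral => x _; rewrite -(tr B (oppt (T x)) mB) -ge0_integralZr//.
  have mi : measurable_fun setT (EFin \o (\1_(T @^-1` A) : _ -> R)).
    exact/measurable_EFinP/measurable_indic.
  rewrite (ge0_integralZl lam measurableT mi (fun x _ => _) (measure_ge0 _ _)); last first.
    by move=> x _; rewrite lee_fin.
  by have := integral_indic lam measurableT mTA; rewrite setIT => <-.
apply/esym; apply: (mule_fin_inj B0 Bfin).
rewrite step1 step2 -step5 -step4; apply: eq_integral => y _; exact: step3.
Qed.

Lemma lebesgue_tuple_reflect d w (A : set (d.+1.-tuple R)) : measurable A ->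
  lebesgue_tuple d.+1 (reflect w @^-1` A) = lebesgue_tuple d.+1 A.
Proof.
pose b : set R := [set r | (0 < r < 1)%R].
have sE : [set x : d.+1.-tuple R | b (enorm x)] = sector d setT.
  by apply/seteqP; split => [x bx|x []].
apply: (@translation_invariant_reflect _
  (Defs_lebesgue_tuple__canonical__measure_function_SigmaFiniteMeasure d.+1) _ b); rewrite ?sE.
- exact: lebesgue_tuple_translate.
- exact: measurable_sector.
- exact: sectorT_gt0.
- exact: sectorT_fin_num.
Qed.

Lemma surface_measure_reflect d w (A : set (d.+1.-tuple R)) : measurable A ->
  surface_measure d (reflect w @^-1` A) = surface_measure d A.
Proof.
move=> mA; rewrite /surface_measure; congr (_ * _).
rewrite -(lebesgue_tuple_reflect w (measurable_sector mA)); congr (lebesgue_tuple _ _).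
suff E (x : d.+1.-tuple R) : normalize (reflect w x) = reflect w (normalize x).
  by apply/seteqP; split => x [x01 xA]; split; move: x01 xA; rewrite /preimage /= ?enorm_reflect ?E.
apply: eq_from_tnth => i; rewrite !tnth_mktuple enorm_reflect mulrBl; congr (_ - _)%R.
suff -> : dotp (normalize x) w = (dotp x w / enorm x)%R by lra.
by rewrite /dotp mulr_suml; apply: eq_bigr => j _; rewrite tnth_mktuple mulrAC.
Qed.

(** A reflection takes [x] to [x'] and preserves the surface measure. *)
Lemma ge0_integral_sphere_dotp d (k : R -> \bar R) (x x' : d.+1.-tuple R) :
  measurable_fun setT k -> (forall t, 0 <= k t) -> sphere d x -> sphere d x' ->
  \int[surface_measure d]_y k (dotp x y) = \int[surface_measure d]_y k (dotp x' y).
Proof.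
move=> mk k0 Sx Sx'.
have mT w : measurable_fun setT (fun x : d.+1.-tuple R => reflect w x).
  by apply: measurable_reflect; exact: measurable_id.
have xx' : dotp x x = dotp x' x'.
  rewrite -[LHS]sqr_sqrtr ?dotp_ge0// -[RHS]sqr_sqrtr ?dotp_ge0//.
  by move: Sx Sx'; rewrite /sphere /enorm /= => -> ->.
have mkx : measurable_fun setT (fun y : d.+1.-tuple R => k (dotp x y)).
  by apply: measurableT_comp => //; exact: measurable_dotp.
set w := addt x (oppt x').
transitivity (\int[pushforward (surface_measure d) (fun y => reflect w y)]_y k (dotp x y)).
  apply: eq_measure_integral => A mA _.
  by rewrite /= /pushforward surface_measure_reflect.
rewrite (ge0_integral_pushforward (mT w))//.
apply: eq_integral => y _ /=; congr k.
by rewrite -(dotp_reflect w x) /w reflect_swap// reflectK.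
Qed.

End reflection_invariance.

(** * The geodesic distance *)

Section geodesic_distance.
Context {R : realType}.

Lemma sin_lex (x : R) : 0 <= x -> sin x <= x.
Proof.
move=> x0.
have sc : {within `[0, x], continuous (@sin R)}.
  by apply: continuous_subspaceT => y; exact: continuous_sin.
have [c _] := @MVT_segment R sin cos 0 x x0 (fun y _ => is_derive_sin y) sc.
rewrite sin0 !subr0 => ->.
by rewrite -[leRHS]mul1r ler_wpM2r// cos_le1.
Qed.

Lemma cos_half (x : R) : cos x = 1 - 2 * sin (x / 2) ^+ 2.
Proof.
have -> : cos x = cos ((x / 2) *+ 2) by rewrite -mulr_natr divfK.
by rewrite cos_mulr2n cos2sin2; lra.
Qed.

Lemma sin_ge_quarter (x : R) : 0 <= x <= pi / 2 -> x / 4 <= sin x.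
Proof.
have small (y : R) : 0 <= y <= 1 -> y / 2 <= sin y.
  move=> /andP[y0 y1].
  have sc : {within `[0, y], continuous (@sin R)}.
    by apply: continuous_subspaceT => z; exact: continuous_sin.
  have [c] := @MVT_segment R sin cos 0 y y0 (fun y _ => is_derive_sin y) sc.
  rewrite in_itv/= sin0 !subr0 => /andP[c0 cy] ->.
  suff : 2^-1 <= cos c by move=> h; have := ler_wpM2r y0 h; lra.
  rewrite cos_half.
  have s1 : sin (c / 2) <= c / 2 by apply: sin_lex; lra.
  have s0 : 0 <= sin (c / 2) by apply: sin_ge0_pi; have := @pi_ge2 R; lra.
  have : sin (c / 2) ^+ 2 <= (c / 2) ^+ 2 by rewrite ler_sqr ?nnegrE//; lra.
  nra.
move=> /andP[x0 xp]; have [/andP[_ pi4] _] := @pihalf_02_cos_pihalf R; have pi2 := @pi_ge2 R.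
have [x1|x1] := leP x 1; first by have := small x; rewrite x0 x1 => /(_ isT); lra.
have h1 : 1 / 2 <= sin (1 : R) by apply: small; rewrite ler01 lexx.
have : sin (1 : R) < sin x by rewrite ltr_sin// in_itv/=; apply/andP; split; lra.
lra.
Qed.

(** Clamping the argument makes the arc cosine monotone, hence measurable, on the
    whole line; inner products of unit vectors are not affected. *)
Definition arc (t : R) : R := acos (Num.max (-1) (Num.min 1 t)).

Lemma clampP (t : R) : -1 <= Num.max (-1) (Num.min 1 t) <= 1.
Proof. by rewrite le_max lexx/= ge_max ge_min lexx/= andbT; lra. Qed.

Lemma arc_ge0 t : 0 <= arc t. Proof. exact: acos_ge0 (clampP t). Qed.
Lemma arc_lepi t : arc t <= pi. Proof. exact: acos_lepi (clampP t). Qed.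

Lemma clamp_id (t : R) : -1 <= t <= 1 -> Num.max (-1) (Num.min 1 t) = t.
Proof. by move=> /andP[t0 t1]; rewrite min_r// max_r. Qed.

Lemma arcE t : -1 <= t <= 1 -> arc t = acos t.
Proof. by move=> t1; rewrite /arc clamp_id. Qed.

Lemma cos_arc t : -1 <= t <= 1 -> cos (arc t) = t.
Proof. by move=> t1; rewrite arcE// acosK// in_itv. Qed.

Lemma nonincreasing_arc : {homo arc : x y /~ x <= y}.
Proof.
move=> x y xy; rewrite /arc.
set u := Num.max _ _; set v := Num.max (-1) (Num.min 1 y).
have uv : v <= u.
  by rewrite /u /v; case: (ltP 1 x); case: (ltP 1 y) => y1 x1;
    rewrite ?lexx// ge_max le_max lexx/= le_max; apply/orP; right; lra.
have Hu := clampP x; have Hv := clampP y.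
rewrite leNgt; apply/negP => h.
have : cos (acos u) < cos (acos v).
  by rewrite ltr_cos ?in_itv/= ?acos_ge0 ?acos_lepi.
by rewrite !acosK ?in_itv// ltNge uv.
Qed.

Lemma measurable_arc : measurable_fun setT arc.
Proof. by apply: nonincreasing_measurable => // x y; exact: nonincreasing_arc. Qed.

Lemma arc1 : arc 1 = 0.
Proof. by rewrite arcE ?acos1//; lra. Qed.

End geodesic_distance.

(** * Spherical caps *)

Section caps.
Context {R : realType}.

Definition pole d : d.+1.-tuple R := [tuple (i == ord0)%:R | i < d.+1].

Lemma dotp_pole d (y : d.+1.-tuple R) : dotp (pole d) y = tnth y ord0.
Proof.
rewrite /dotp (bigD1 ord0)//= big1 ?addr0; last first.
  by move=> i i0; rewrite tnth_mktuple (negbTE i0) mul0r.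
by rewrite tnth_mktuple eqxx mul1r.
Qed.

Lemma sphereP d (x : d.+1.-tuple R) : sphere d x <-> dotp x x = 1.
Proof.
rewrite /sphere /enorm /=; split => [h|->]; last exact: sqrtr1.
by rewrite -[LHS]sqr_sqrtr ?dotp_ge0// h expr1n.
Qed.

Lemma sphere_pole d : sphere d (pole d).
Proof. by apply/sphereP; rewrite dotp_pole tnth_mktuple eqxx. Qed.

Lemma dotp_sphere d (x y : d.+1.-tuple R) : sphere d x -> sphere d y ->
  -1 <= dotp x y <= 1.
Proof.
move=> /sphereP x1 /sphereP y1.
have := dotp_ge0 (addt x (oppt y)); have := dotp_ge0 (addt x (oppt (oppt y))).
by rewrite !dotpBB dotpNr !dotpNl !dotpNr x1 y1; lra.
Qed.

Lemma sqr_tnth_le_dotp n (x : n.-tuple R) i : tnth x i ^+ 2 <= dotp x x.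
Proof.
rewrite /dotp (bigD1 i)//= -expr2 lerDl.
by apply: sumr_ge0 => j _; rewrite -expr2; exact: sqr_ge0.
Qed.

Lemma tnth_sphere_le1 d (x : d.+1.-tuple R) i : sphere d x -> `|tnth x i| <= 1.
Proof.
move=> /sphereP x1; rewrite -ler_sqr ?nnegrE// real_normK ?num_real// expr1n -x1.
exact: sqr_tnth_le_dotp.
Qed.

Lemma dotp_split d (x : d.+1.-tuple R) i : i != ord0 ->
  tnth x i ^+ 2 + tnth x ord0 ^+ 2 <= dotp x x.
Proof.
move=> i0; rewrite /dotp (bigD1 ord0)//= (bigD1 i)//= -!expr2.
rewrite [leLHS]addrC lerD2l lerDl; apply: sumr_ge0 => j _; rewrite -expr2; exact: sqr_ge0.
Qed.

Lemma measurable_arc_dotp d (x : d.+1.-tuple R) :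
  measurable_fun setT (fun y : d.+1.-tuple R => arc (dotp x y)).
Proof. by apply: measurableT_comp; [exact: measurable_arc|exact: measurable_dotp]. Qed.

Local Open Scope ereal_scope.

Lemma integral_surface_cst d (r : R) : \int[surface_measure d]_x r%:E = r%:E.
Proof.
rewrite integral_cst//; have /= -> := @probability_setT _ _ R
  (Defs_surface_measure__canonical__probability_measure_Probability d).
by rewrite mule1.
Qed.

Lemma lebesgue_tuple_cylinder n (A B : set R) : measurable A -> measurable B ->
  lebesgue_tuple n.+1 [set x : n.+1.-tuple R | A (tnth x ord0) /\
     forall i, B (tnth x (lift ord0 i))] =
  lebesgue_measure A * lebesgue_measure B ^+ n.
Proof.
move=> mA mB; rewrite -lebesgue_tuple_box//= /pushforward.
rewrite -[RHS](@product_measure1E _ _ _ _ _ (@lebesgue_measure R)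
  (Defs_lebesgue_tuple__canonical__measure_function_SigmaFiniteMeasure n))//; last exact: measurable_box.
congr (_ \x _) => //.
apply/seteqP; split => -[a t] /= [Aa Bt]; split => //= i;
 by have := Bt i; rewrite tnthS.
Qed.

Lemma measurable_cylinder n (A B : set R) : measurable A -> measurable B ->
  measurable [set x : n.+1.-tuple R | A (tnth x ord0) /\
     forall i, B (tnth x (lift ord0 i))].
Proof.
move=> mA mB; rewrite (_ : mkset _ = ((fun x => tnth x ord0) @^-1` A) `&`
    \bigcap_(i in [set: 'I_n]) ((fun x => tnth x (lift ord0 i)) @^-1` B)).
  apply: measurableI; first by rewrite -[X in measurable X]setTI; exact: measurable_tnth.
  apply: fin_bigcap_measurable => // i _; rewrite -[X in measurable X]setTI.
  exact: measurable_tnth.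
by apply/seteqP; split => x /= [? h]; split => // i; [move=> _|]; exact: h.
Qed.

Lemma lebesgue_measure_symmetric_itv (r : R) : (0 < r)%R ->
  lebesgue_measure `](-r)%R, r[%classic = (2 * r)%:E.
Proof.
by move=> r0; rewrite lebesgue_measure_itv/= lte_fin ifT -?EFinB ?opprK; [congr (_%:E)|]; lra.
Qed.

Lemma measurable_cap d (x : d.+1.-tuple R) (r : R) :
  measurable [set y : d.+1.-tuple R | (arc (dotp x y) < r)%R].
Proof. exact: (measurable_lt_set _ (measurable_arc_dotp _)). Qed.

Let eq_lee (a b : \bar R) : a = b -> a <= b.
Proof. by move=> ->. Qed.

(** A unit vector at angle [a < r] from the pole has distance [sin a <= a < r] from
    the axis, and all its coordinates but the first one are at most that. *)
Lemma sector_pole_cap d (r : R) : (0 < r)%R ->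
  sector d [set y | (arc (dotp (pole d) y) < r)%R] `<=`
  [set x : d.+1.-tuple R | `](-1)%R, 1%R[%classic (tnth x ord0) /\
     forall i, `](-r)%R, r[%classic (tnth x (lift ord0 i))].
Proof.
move=> r0 z [/andP[z0 z1] /= zr].
have zz : dotp z z = (enorm z ^+ 2)%R by rewrite sqr_sqrtr// dotp_ge0.
move: zr; rewrite dotp_pole tnth_mktuple; set u := (_ / _)%R => ur.
have zu : tnth z ord0 = (enorm z * u)%R by rewrite /u mulrC divfK// gt_eqF.
have z02 : (tnth z ord0 ^+ 2 <= enorm z ^+ 2)%R.
  by rewrite -zz sqr_tnth_le_dotp.
have u2 : (u ^+ 2 <= 1)%R.
  move: z02; rewrite zu exprMn -ler_pdivlMl ?exprn_gt0// mulVf//.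
  by rewrite expf_neq0// gt_eqF.
have u1 : (-1 <= u <= 1)%R by apply/andP; split; nra.
have s2 : (1 - u ^+ 2 < r ^+ 2)%R.
  have := cos2Dsin2 (arc u); rewrite cos_arc// => E.
  have s0 : (0 <= sin (arc u))%R by apply: sin_ge0_pi; rewrite arc_ge0 arc_lepi.
  have s1 : (sin (arc u) <= arc u)%R by apply/sin_lex/arc_ge0.
  have : (sin (arc u) ^+ 2 < r ^+ 2)%R by rewrite ltr_sqr ?nnegrE; lra.
  by lra.
split=> [|i] /=; rewrite in_itv/=.
  by rewrite zu; nra.
have := dotp_split z (i := lift ord0 i) isT; rewrite zz zu => h.
have : (tnth z (lift ord0 i) ^+ 2 < r ^+ 2)%R.
  have : (enorm z ^+ 2 * (1 - u ^+ 2) <= 1 - u ^+ 2)%R.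
    by rewrite ler_piMl ?subr_ge0// expr_le1// ltW.
  by move=> ?; rewrite exprMn in h; lra.
rewrite -ltr_norml -[(`|_| < _)%R]ltr_sqr ?nnegrE ?(ltW r0)//.
by rewrite real_normK// num_real.
Qed.

(** The sector over a cap lies in a box with one side of length 2 and [d] sides of
    length [2 r]. *)
Lemma surface_measure_cap d : exists2 C : R, (0 < C)%R &
  forall (x : d.+1.-tuple R) (r : R), sphere d x -> (0 < r)%R ->
  surface_measure d [set y | (arc (dotp x y) < r)%R] <= (C * r ^+ d)%:E.
Proof.
pose v := fine (lebesgue_tuple d.+1 (sector d [set: d.+1.-tuple R])).
have v0 : (0 < v)%R.
  by rewrite fine_gt0// sectorT_gt0/= ltey_eq sectorT_fin_num.
exists (v^-1 * (2 * 2 ^+ d))%R; first by rewrite !mulr_gt0 ?invr_gt0// exprn_gt0.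
move=> x r Sx r0.
have mI : measurable_fun setT (fun t : R => (\1_[set t | (arc t < r)%R] t)%:E : \bar R).
  apply/measurable_EFinP; apply: measurable_indic; exact: (measurable_lt_set _ measurable_arc).
have E z : surface_measure d [set y | (arc (dotp z y) < r)%R] =
   \int[surface_measure d]_y (\1_[set t | (arc t < r)%R] (dotp z y))%:E.
  have := integral_indic (surface_measure d) measurableT (measurable_cap z r).
  by rewrite setIT => <-.
rewrite E (ge0_integral_sphere_dotp mI _ Sx (sphere_pole d)); last first.
  by move=> t; rewrite lee_fin.
rewrite -E /surface_measure -/v -mulrA EFinM lee_pmul2l ?lte_fin ?invr_gt0//.
apply: le_trans (le_measure _ _ _ (@sector_pole_cap d r r0)) _.
- by rewrite inE; apply: measurable_sector; exact: measurable_cap.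
- rewrite inE.
  exact: measurable_cylinder.
have cyl := @lebesgue_tuple_cylinder d _ _ (measurable_itv `](-1)%R, 1%R[)
  (measurable_itv `](-r)%R, r[).
apply: le_trans (eq_lee cyl) _; rewrite !lebesgue_measure_symmetric_itv//.
by rewrite -EFin_expe -EFinM lee_fin exprMn mulr1 mulrA.
Qed.

End caps.

(** * Averages of zonal kernels *)

Section zonal.
Context {R : realType}.
Local Open Scope ereal_scope.

Lemma integral_sphere_dotp d (k : R -> \bar R) (x x' : d.+1.-tuple R) :
  measurable_fun setT k -> sphere d x -> sphere d x' ->
  \int[surface_measure d]_y k (dotp x y) = \int[surface_measure d]_y k (dotp x' y).
Proof.
move=> mk Sx Sx'; rewrite [LHS]integralE [RHS]integralE.
have H f mf f0 := @ge0_integral_sphere_dotp R d f x x' mf f0 Sx Sx'.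
congr (_ - _).
  transitivity (\int[surface_measure d]_y (k^\+ (dotp x y))).
    by apply: eq_integral => y _; rewrite !funeposE.
  rewrite (H _ (measurable_funepos mk) (fun t => funepos_ge0 k t)).
  by apply: eq_integral => y _; rewrite !funeposE.
transitivity (\int[surface_measure d]_y (k^\- (dotp x y))).
  by apply: eq_integral => y _; rewrite !funenegE.
rewrite (H _ (measurable_funeneg mk) (fun t => funeneg_ge0 k t)).
by apply: eq_integral => y _; rewrite !funenegE.
Qed.

Lemma measurable_comp_dotp d (k : R -> R) (x : d.+1.-tuple R) : measurable_fun setT k ->
  measurable_fun setT (fun y : d.+1.-tuple R => k (dotp x y)).
Proof. by move=> mk; apply: (measurableT_comp mk); exact: measurable_dotp. Qed.

Lemma integral_sphere_pole d (k : R -> R) (x : d.+1.-tuple R) : measurable_fun setT k ->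
  sphere d x -> \int[surface_measure d]_y (k (dotp x y))%:E =
  \int[surface_measure d]_y (k (dotp (pole d) y))%:E.
Proof.
move=> mk Sx; apply: (integral_sphere_dotp (k := fun t => (k t)%:E)) => //.
  exact/measurable_EFinP.
exact: sphere_pole.
Qed.

Definition bounded_measurable (k : R -> R) :=
  measurable_fun setT k /\ exists B, forall t, (`|k t| <= B)%R.

Lemma integrable_dotp d (k : R -> R) (x : d.+1.-tuple R) : bounded_measurable k ->
  (surface_measure d).-integrable setT (fun y => (k (dotp x y))%:E).
Proof.
move=> [mk [B kB]]; apply: measurable_bounded_integrable => //.
- by rewrite -ge0_fin_numE//; exact: fin_num_measure.
- by apply: measurableT_comp => //; exact: measurable_dotp.
- exists B; split; first exact: num_real.
  by move=> M BM y _; exact: le_trans (kB _) (ltW BM).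
Qed.

(** By rotation invariance the pole stands for an arbitrary unit vector. *)
Definition zonal d (k : R -> R) : R :=
  (\int[surface_measure d]_y k (dotp (pole d) y))%R.

Lemma zonalE d (k : R -> R) x : bounded_measurable k -> sphere d x ->
  \int[surface_measure d]_y (k (dotp x y))%:E = (zonal d k)%:E.
Proof.
move=> bk Sx; rewrite /zonal /Rintegral fineK; last first.
  exact: integrable_fin_num (integrable_dotp _ bk).
by apply: integral_sphere_pole => //; case: bk.
Qed.

Lemma bounded_measurable_comp_arc (f : R -> R) : measurable_fun setT f ->
  (exists B, forall t, (0 <= t -> `|f t| <= B)%R) -> bounded_measurable (f \o arc).
Proof.
move=> mf [B fB]; split; first exact: measurableT_comp mf measurable_arc.
by exists B => t; exact: fB (arc_ge0 t).
Qed.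

Definition decay (t : R) : R -> R := fun u => expR (- t * arc u).

Lemma bounded_measurable_decay t : (0 <= t)%R -> bounded_measurable (decay t).
Proof.
move=> t0; apply: (@bounded_measurable_comp_arc (fun s => expR (- t * s))).
  by apply: measurableT_comp => //; exact: measurable_funM.
exists 1%R => s s0; rewrite ger0_norm ?expR_ge0// -expR0 ler_expR.
by rewrite mulNr oppr_le0 mulr_ge0.
Qed.

Lemma decay_le1 t u : (0 <= t)%R -> (decay t u <= 1)%R.
Proof. by move=> t0; rewrite /decay -expR0 ler_expR mulNr oppr_le0 mulr_ge0// arc_ge0. Qed.

Lemma le_zonal d (k1 k2 : R -> R) : bounded_measurable k1 -> bounded_measurable k2 ->
  (forall t, k1 t <= k2 t)%R -> (zonal d k1 <= zonal d k2)%R.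
Proof.
by move=> b1 b2 k12; apply: le_Rintegral => //; exact: integrable_dotp.
Qed.

Lemma zonal_ge0 d k : (forall t, 0 <= k t)%R -> (0 <= zonal d k)%R.
Proof. by move=> k0; apply: Rintegral_ge0. Qed.

Lemma zonal_cst d (r : R) : zonal d (cst r) = r.
Proof. by rewrite /zonal /Rintegral integral_surface_cst. Qed.

Lemma zonalD d k1 k2 : bounded_measurable k1 -> bounded_measurable k2 ->
  zonal d (fun t => k1 t + k2 t)%R = (zonal d k1 + zonal d k2)%R.
Proof. by move=> b1 b2; apply: RintegralD => //; exact: integrable_dotp. Qed.

Lemma zonalZ d r k : bounded_measurable k ->
  zonal d (fun t => r * k t)%R = (r * zonal d k)%R.
Proof. by move=> b1; apply: RintegralZl => //; exact: integrable_dotp. Qed.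

Lemma bounded_measurableD k1 k2 : bounded_measurable k1 -> bounded_measurable k2 ->
  bounded_measurable (fun t => k1 t + k2 t)%R.
Proof.
move=> [m1 [B1 h1]] [m2 [B2 h2]]; split; first exact: measurable_funD.
by exists (B1 + B2)%R => t; apply: le_trans (ler_normD _ _) _; exact: lerD.
Qed.

Lemma bounded_measurableZ r k : bounded_measurable k ->
  bounded_measurable (fun t => r * k t)%R.
Proof.
move=> [m1 [B1 h1]]; split; first exact: measurable_funM.
by exists (`|r| * B1)%R => t; rewrite normrM ler_wpM2l.
Qed.

Lemma bounded_measurable_cst r : bounded_measurable (cst r).
Proof. by split => //; exists `|r|%R. Qed.

Lemma zonal_decay_le1 d t : (0 <= t)%R -> (zonal d (decay t) <= 1)%R.
Proof.
move=> t0; rewrite -(zonal_cst d 1); apply: le_zonal.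
- exact: bounded_measurable_decay.
- exact: bounded_measurable_cst.
- by move=> u; exact: decay_le1.
Qed.

(** Inside the cap of radius [A / t] the kernel is at most 1, and outside of it
    [exp (- t rho)] is at most [exp (- A / 2) * exp (- (t / 2) rho)]; the constant [A]
    is so large that the first factor beats the loss of [2 ^ d] in the rescaling. *)
Lemma zonal_decay_halve d : exists2 C : R, (0 < C)%R & forall t : R, (0 < t)%R ->
  (zonal d (decay t) * t ^+ d <= C + (zonal d (decay (t / 2)) * (t / 2) ^+ d) / 2)%R.
Proof.
have [C C0 capC] := @surface_measure_cap R d.
pose A : R := (2 * d.+1%:R)%R.
have A0 : (0 < A)%R by rewrite /A mulr_gt0.
exists (C * A ^+ d)%R; first by rewrite mulr_gt0// exprn_gt0.
move=> t t0.
have mC := @measurable_cap R d (pole d) (A / t).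
have key : (zonal d (decay t) <= C * (A / t) ^+ d + 2^-1 ^+ d.+1 * zonal d (decay (t / 2)))%R.
  pose cap : R -> R := \1_[set u | (arc u < A / t)%R].
  have bcap : bounded_measurable cap.
    split; last by exists 1%R => u; rewrite /cap indicE; case: (_ \in _); rewrite ?normr1 ?normr0.
    apply: measurable_indic; exact: (measurable_lt_set _ measurable_arc).
  have zcap : (zonal d cap <= C * (A / t) ^+ d)%R.
    rewrite -lee_fin -(zonalE bcap (sphere_pole d)).
    apply: le_trans (capC (pole d) (A / t)%R (sphere_pole d) (divr_gt0 A0 t0)).
    have := integral_indic (surface_measure d) measurableT mC.
    by rewrite setIT => <-.
  have t20 : (0 <= t / 2)%R by lra.
  have bdec := bounded_measurable_decay t20.
  apply: (@le_trans _ _ (zonal d (fun u => cap u + 2^-1 ^+ d.+1 * decay (t / 2) u)%R)).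
    apply: le_zonal.
    - exact: bounded_measurable_decay (ltW t0).
    - exact/bounded_measurableD/bounded_measurableZ.
    move=> u; rewrite /cap indicE; have [ucap|] := ltP (arc u) (A / t)%R.
      rewrite mem_set//= -[leLHS]addr0 lerD ?decay_le1 ?(ltW t0)//.
      by rewrite mulr_ge0 ?expR_ge0// exprn_ge0.
    move=> uA; rewrite memNset ?add0r; last by rewrite /= ltNge uA.
    have -> : decay t u = (decay (t / 2) u * decay (t / 2) u)%R.
      by rewrite /decay -expRD; congr expR; lra.
    rewrite ler_wpM2r ?expR_ge0//.
    have e1 : (expR (- (1 : R)) <= 2^-1)%R.
      by rewrite expRN lef_pV2 ?posrE ?expR_gt0// (le_trans _ (expR_ge1Dx 1))//; lra.
    apply: (@le_trans _ _ (expR (- 1) ^+ d.+1)%R).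
      rewrite -expRM_natl /decay ler_expR mulrN1 mulNr lerN2.
      move: uA; rewrite ler_pdivrMr// /A; lra.
    by rewrite lerXn2r ?nnegrE ?expR_ge0.
  rewrite zonalD ?zonalZ//; last exact: bounded_measurableZ.
  by rewrite lerD2r.
have td : (0 < t ^+ d)%R by rewrite exprn_gt0.
apply: le_trans (ler_wpM2r (ltW td) key) _.
rewrite mulrDl; apply: lerD.
  by rewrite exprMn exprVn -mulrA divfK// gt_eqF.
by rewrite [((t / 2) ^+ d)%R]exprMn exprS; lra.
Qed.

(** The bound holds for [t <= 1] trivially and passes from [t / 2] to [t]. *)
Lemma zonal_decay_le d : exists2 C : R, (0 < C)%R & forall t : R, (0 < t)%R ->
  (zonal d (decay t) <= C / t ^+ d)%R.
Proof.
have [C C0 hC] := zonal_decay_halve d.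
pose K : R := Num.max 1%R (2 * C)%R.
have K1 : (1 <= K)%R by rewrite /K le_max lexx.
have K2 : (2 * C <= K)%R by rewrite /K le_max lexx orbT.
exists K; first by lra.
suff H n : forall t : R, (0 < t <= 2 ^+ n)%R -> (zonal d (decay t) * t ^+ d <= K)%R.
  move=> t t0; rewrite ler_pdivlMr ?exprn_gt0//; apply: (H (Num.bound t)).
  rewrite t0/= (le_trans (ltW (archi_boundP (ltW t0))))//.
  by rewrite -natrX ler_nat ltnW// ltn_expl.
elim: n => [|n IHn] t /andP[t0 tn].
  rewrite expr0 in tn; apply: le_trans K1.
  rewrite mulr_ile1 ?zonal_decay_le1 ?(ltW t0)// ?exprn_ile1 ?exprn_ge0 ?(ltW t0)//.
  by apply: zonal_ge0 => u; rewrite expR_ge0.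
apply: le_trans (hC t t0) _.
have := IHn (t / 2)%R; rewrite divr_gt0//= ler_pdivrMr// -exprSr tn => /(_ isT) h.
lra.
Qed.

End zonal.

(** * The power series of exp (t asin u) *)

Section exponential_angle_series.
Context {R : realType}.

Lemma cvg_pseries_bounded (a : R^nat) (M q : R) : (forall k, 0 <= a k <= M) ->
  0 <= q < 1 -> cvgn (pseries a q).
Proof.
move=> aM /andP[q0 q1]; apply: (@series_le_cvg R _ (geometric M q)) => [k|k|k|].
- by rewrite mulr_ge0 ?exprn_ge0//; case/andP: (aM k).
- by rewrite mulr_ge0 ?exprn_ge0//; case/andP: (aM k) => /le_trans/[apply].
- by rewrite ler_wpM2r ?exprn_ge0//; case/andP: (aM k).
- by apply: is_cvg_geometric_series; rewrite ger0_norm.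
Qed.

Lemma bernoulli_le (h : R) k : 0 <= h -> 1 + k%:R * h <= (1 + h) ^+ k.
Proof.
move=> h0; elim: k => [|k IH]; first by rewrite mul0r addr0.
rewrite exprS; apply: le_trans (ler_wpM2l _ IH); last by lra.
have : 0 <= k%:R * h * h by rewrite !mulr_ge0.
by rewrite -natr1; lra.
Qed.

(** A factor [k] in the coefficients is absorbed by shrinking the argument. *)
Lemma cvg_pseries_diffs (a : R^nat) (M x q : R) :
  0 < q < x -> (forall k, 0 <= a k) -> (forall k, a k * x ^+ k <= M) ->
  exists2 N : R, (forall k, pseries_diffs a k * q ^+ k <= N) &
  cvgn (pseries (pseries_diffs a) q).
Proof.
move=> /andP[q0 qx] a0 aM.
have x0 : 0 < x by exact: lt_trans qx.
pose s := (q + x) / 2.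
have qs : q < s by rewrite /s; lra.
have sx : s < x by rewrite /s; lra.
have s0 : 0 < s by lra.
pose h := s / q - 1.
have h0 : 0 < h by rewrite /h subr_gt0 ltr_pdivlMr// mul1r.
have M0 : 0 <= M by apply: le_trans (aM 0%N); rewrite expr0 mulr1.
have kB k : k.+1%:R * q ^+ k <= (1 + h^-1) * s ^+ k.
  have := @bernoulli_le h k (ltW h0).
  have -> : 1 + h = s / q by rewrite /h; lra.
  rewrite exprMn exprVn ler_pdivlMr ?exprn_gt0// => H.
  have qk : 0 < q ^+ k by rewrite exprn_gt0.
  have : k.+1%:R * q ^+ k <= (1 + h^-1) * ((1 + k%:R * h) * q ^+ k).
    rewrite mulrA ler_wpM2r ?(ltW qk)// -natr1.
    have E : h^-1 * (k%:R * h) = k%:R by rewrite mulrCA mulVf ?mulr1// gt_eqF.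
    have : 0 <= h^-1 by rewrite invr_ge0 ltW.
    have : 0 <= h * k%:R by rewrite mulr_ge0 ?ler0n ?(ltW h0).
    lra.
  move/le_trans; apply; rewrite ler_wpM2l// addr_ge0// invr_ge0 ltW//.
have dB k : pseries_diffs a k * q ^+ k <= (M / x * (1 + h^-1)) * (s / x) ^+ k.
  rewrite /pseries_diffs.
  have := aM k.+1; rewrite exprS mulrA -ler_pdivlMr ?exprn_gt0// => H1.
  have H2 : a k.+1 <= M / x / x ^+ k.
    by rewrite ler_pdivlMr ?exprn_gt0// ler_pdivlMr//; move: H1; rewrite ler_pdivlMr ?exprn_gt0//; lra.
  rewrite mulrAC; apply: le_trans (ler_wpM2l _ H2) _; first by rewrite mulr_ge0 ?exprn_ge0 ?(ltW q0).
  apply: le_trans (ler_wpM2r _ (kB k)) _.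
    by rewrite !divr_ge0 ?exprn_ge0 ?(ltW x0).
  rewrite [(s / x) ^+ k]exprMn exprVn le_eqVlt; apply/orP; left; apply/eqP.
  by move: (x ^- k) (s ^+ k) h^-1 x^-1 => B S H A; lra.
have P0 : 0 <= M / x * (1 + h^-1).
  by rewrite mulr_ge0 ?divr_ge0 ?(ltW x0)// addr_ge0// invr_ge0 ltW.
have sx1 : 0 <= s / x < 1 by rewrite divr_ge0 ?ltW//= ltr_pdivrMr// mul1r.
exists (M / x * (1 + h^-1)).
  move=> k; apply: le_trans (dB k) _; rewrite ler_piMr//.
  by case/andP: sx1 => ? ?; rewrite exprn_ile1// ltW.
apply: (@series_le_cvg R _ (geometric (M / x * (1 + h^-1)) (s / x))) => [k|k|k|].
- by rewrite mulr_ge0 ?exprn_ge0 ?(ltW q0)// /pseries_diffs mulr_ge0.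
- by rewrite /= mulr_ge0 ?exprn_ge0//; case/andP: sx1.
- exact: dB.
- by apply: is_cvg_geometric_series; rewrite ger0_norm; case/andP: sx1.
Qed.

Variable t : R.
Hypothesis t0 : 0 <= t.

(** The Taylor coefficients of [exp (t * asin u)]: the recursion expresses the
    differential equation [(1 - u ^ 2) y'' - u y' = t ^ 2 y]. *)
Fixpoint expasin_coef (n : nat) : R :=
  match n with
  | 0 => 1
  | 1 => t
  | m.+2 => (m%:R ^+ 2 + t ^+ 2) / (m.+1%:R * m.+2%:R) * expasin_coef m
  end.
Local Notation c := expasin_coef.

Lemma expasin_coef_ge0 n : 0 <= c n.
Proof.
suff : 0 <= c n /\ 0 <= c n.+1 by case.
elim: n => [|n [h1 h2]]; first by split => //=.
split => //; rewrite [c _]/=; apply: mulr_ge0 => //.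
by rewrite divr_ge0// addr_ge0// sqr_ge0.
Qed.

(** [c k.+2 <= c k] as soon as [t ^ 2 <= k]. *)
Lemma expasin_coef_bounded : exists M, forall k, 0 <= c k <= M.
Proof.
pose K := Num.bound (t ^+ 2).
pose M := \sum_(i < K.+2) c i.
have small i : (i < K.+2)%N -> c i <= M.
  move=> iK; rewrite /M (bigD1 (Ordinal iK))//= lerDl.
  by apply: sumr_ge0 => j _; exact: expasin_coef_ge0.
have K2 k : (K <= k)%N -> c k.+2 <= c k.
  move=> Kk; rewrite [c k.+2]/= ler_piMl ?expasin_coef_ge0//.
  rewrite ler_pdivrMr ?mulr_gt0// mul1r.
  have : t ^+ 2 < k%:R.
    by apply: lt_le_trans (archi_boundP (sqr_ge0 _)) _; rewrite ler_nat.
  have : (0 : R) <= k%:R by [].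
  rewrite -!natr1; set n : R := k%:R => n0 tn; nra.
exists M => k; rewrite expasin_coef_ge0/=.
suff : c k <= M /\ c k.+1 <= M by case.
elim: k => [|k [h1 h2]]; first by split; apply: small.
split=> //; have [kK|Kk] := ltnP k K; first by apply: small; rewrite ltnS.
exact: le_trans (K2 _ Kk) h1.
Qed.

Lemma expasin_diffs_cvg (u : R) : `|u| < 1 -> exists K, [/\ `|u| < K,
  cvgn (pseries c K), cvgn (pseries (pseries_diffs c) K),
  cvgn (pseries (pseries_diffs (pseries_diffs c)) K) &
  cvgn (pseries (pseries_diffs (pseries_diffs (pseries_diffs c))) K)].
Proof.
move=> u1; have u0 := normr_ge0 u.
have [M cM] := expasin_coef_bounded.
have c0 k : 0 <= c k by exact: expasin_coef_ge0.
have dge0 (a : R^nat) : (forall k, 0 <= a k) -> forall k, 0 <= pseries_diffs a k.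
  by move=> a0 k; rewrite /pseries_diffs mulr_ge0.
pose K3 := (3 * `|u| + 1) / 4; pose K2 := (2 * `|u| + 2) / 4; pose K1 := (`|u| + 3) / 4.
have H1 : 0 < K1 < 1 by rewrite /K1; lra.
have H2 : 0 < K2 < K1 by rewrite /K1 /K2; lra.
have H3 : 0 < K3 < K2 by rewrite /K3 /K2; lra.
have b0 k : c k * 1 ^+ k <= M by rewrite expr1n mulr1; case/andP: (cM k).
have [M1 b1 cv1] := cvg_pseries_diffs H1 c0 b0.
have [M2 b2 cv2] := cvg_pseries_diffs H2 (dge0 _ c0) b1.
have [M3 b3 cv3] := cvg_pseries_diffs H3 (dge0 _ (dge0 _ c0)) b2.
exists K3; split.
- by rewrite /K3; lra.
- by apply: (cvg_pseries_bounded cM); lra.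
- by apply: is_cvg_pseries_inside cv1 _; rewrite !ger0_norm; lra.
- by apply: is_cvg_pseries_inside cv2 _; rewrite !ger0_norm; lra.
- exact: cv3.
Qed.

Let phi u := limn (pseries c u).
Let phi1 u := limn (pseries (pseries_diffs c) u).
Let phi2 u := limn (pseries (pseries_diffs (pseries_diffs c)) u).

Lemma expasin_series_derive u : `|u| < 1 ->
  [/\ is_derive u (1 : R) phi (phi1 u), is_derive u (1 : R) phi1 (phi2 u) &
   (1 - u ^+ 2) * phi2 u - u * phi1 u = t ^+ 2 * phi u].
Proof.
move=> u1; have [K [uK cv0 cv1 cv2 cv3]] := expasin_diffs_cvg u1.
have K0 : 0 < K by apply: le_lt_trans uK.
have uK' : `|u| < `|K| by rewrite (ger0_norm (ltW K0)).
split; [exact: pseries_snd_diffs cv0 cv1 cv2 uK'|exact: pseries_snd_diffs cv1 cv2 cv3 uK'|].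
have l0 : pseries c u @ \oo --> phi u by exact: is_cvg_pseries_inside cv0 uK'.
have l1 : pseries (pseries_diffs c) u @ \oo --> phi1 u by exact: is_cvg_pseries_inside cv1 uK'.
have l2 : pseries (pseries_diffs (pseries_diffs c)) u @ \oo --> phi2 u.
  exact: is_cvg_pseries_inside cv2 uK'.
have s1 : u * series (fun i => i%:R * c i * u ^+ i.-1) n @[n --> \oo] --> u * phi1 u.
  by apply: cvgMr; apply: pseries_diffs_equiv; apply/cvg_ex; exists (phi1 u).
have s2 : u ^+ 2 * series (fun i => i%:R * pseries_diffs c i * u ^+ i.-1) n @[n --> \oo] --> u ^+ 2 * phi2 u.
  by apply: cvgMr; apply: pseries_diffs_equiv; apply/cvg_ex; exists (phi2 u).
have s1' : u * series (fun i => i%:R * c i * u ^+ i.-1) n.+1 @[n --> \oo] --> u * phi1 u.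
  by rewrite (cvg_shiftS (fun n => u * series (fun i => i%:R * c i * u ^+ i.-1) n)).
have l0' : t ^+ 2 * pseries c u n.+1 @[n --> \oo] --> t ^+ 2 * phi u.
  by apply: cvgMr; rewrite (cvg_shiftS (pseries c u)).
have l2' : pseries (pseries_diffs (pseries_diffs c)) u n.+1 @[n --> \oo] --> phi2 u.
  by rewrite (cvg_shiftS (pseries (pseries_diffs (pseries_diffs c)) u)).
have coef3 n : pseries_diffs (pseries_diffs c) n.+1 = (n.+1%:R ^+ 2 + t ^+ 2) * c n.+1.
  rewrite /pseries_diffs [c n.+3]/= mulrA mulrA; congr (_ * _).
  by rewrite mulrCA divff ?mulr1// mulf_neq0// pnatr_eq0.
have pow n X : u ^+ 2 * (n%:R * X * u ^+ n.-1) = n%:R * X * u ^+ n.+1.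
  by case: n => [|n]; rewrite ?mul0r ?mulr0// mulrCA -exprD.
have E n : pseries (pseries_diffs (pseries_diffs c)) u n.+1 =
   u ^+ 2 * series (fun i => i%:R * pseries_diffs c i * u ^+ i.-1) n
   + u * series (fun i => i%:R * c i * u ^+ i.-1) n.+1 + t ^+ 2 * pseries c u n.+1.
  elim: n => [|n IH].
    rewrite /pseries /series /= !big_nat1 big_geq// /pseries_diffs /=.
    by rewrite expr0n /=; lra.
  have {}IH := IH; rewrite /pseries /series /= in IH *.
  rewrite big_nat_recr// [in RHS]big_nat_recr//.
  rewrite [X in u * X]big_nat_recr// [X in t ^+ 2 * X]big_nat_recr// -[n.+1.-1]/n.
  rewrite IH ![in RHS]mulrDr pow coef3 /pseries_diffs.
  by rewrite -!natr1 (exprS u n); set cn := c n.+1; rewrite /=; lra.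
have : phi2 u = u ^+ 2 * phi2 u + u * phi1 u + t ^+ 2 * phi u.
  move: l2'; rewrite (eq_cvg _ _ E) => l2'.
  exact: cvg_unique l2' (cvgD (cvgD s2 s1') l0').
lra.
Qed.

(** With [u = cos a] the equation satisfied by [phi] becomes [h'' = t ^ 2 * h], and
    the values of [phi] and its derivative at [u = 0] select the decaying
    exponential. *)
Lemma expasin_series_cos (a : R) : 0 < a < pi ->
  limn (pseries c (cos a)) = expR (t * (pi / 2 - a)).
Proof.
move=> a_pi.
have cos1 (x : R) : 0 < x < pi -> `|cos x| < 1.
  move=> /andP[x0 xpi]; rewrite ltr_norml -cospi -cos0.
  by rewrite !ltr_cos ?in_itv/= ?lexx ?pi_ge0 ?ltW ?x0 ?xpi.
have cst0 (f : R -> R) x y : 0 < x < pi -> 0 < y < pi ->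
    (forall z : R, 0 < z < pi -> is_derive z (1 : R) f 0) -> f x = f y.
  wlog xy : x y / x <= y.
    move=> H x1 y1 df; case: (leP x y) => [xy|/ltW yx]; first exact: H.
    by apply/esym/H.
  move=> /andP[x0 xp] /andP[y0 yp] df.
  have dxy z : z \in `[x, y] -> is_derive z (1 : R) f 0.
    by rewrite in_itv/= => /andP[xz zy]; apply: df; lra.
  have cf : {within `[x, y], continuous f}.
    by apply: derivable_within_continuous => z /dxy[].
  have [z _] := @MVT_segment R f (fun=> 0) x y xy
    (fun z zxy => dxy z (subset_itv_oo_cc zxy)) cf.
  by rewrite mul0r => /eqP; rewrite subr_eq0 => /eqP ->.
pose h x := phi (cos x); pose g x := - sin x * phi1 (cos x) + t * h x.
have dh (x : R) : 0 < x < pi -> is_derive x (1 : R) h (- sin x * phi1 (cos x)).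
  move=> xpi; have [d1 d2 _] := expasin_series_derive (cos1 _ xpi).
  by apply: is_derive_eq; lra.
have dg (x : R) : 0 < x < pi -> is_derive x (1 : R) g (t * g x).
  move=> xpi; have [d1 d2 E] := expasin_series_derive (cos1 _ xpi).
  have dhx := dh _ xpi.
  apply: is_derive_eq.
  rewrite /GRing.scale /= /g /h.
  have S : sin x * sin x * phi2 (cos x) = t ^+ 2 * phi (cos x) + cos x * phi1 (cos x).
    by rewrite -expr2 sin2cos2; lra.
  lra.
have pi2 : 0 < (pi / 2 : R) < pi by have := @pi_gt0 R; lra.
have phi0 : phi 0 = 1.
  apply: lim_near_cst => //; near=> n.
  rewrite /pseries /series /= -(prednK (n := n)); last by near: n; exact: nbhs_infty_gt.
  rewrite big_nat_recl//= big1 ?addr0 ?expr0 ?mulr1// => i _.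
  by rewrite expr0n mulr0.
have phi10 : phi1 0 = t.
  apply: lim_near_cst => //; near=> n.
  rewrite /pseries /series /= -(prednK (n := n)); last by near: n; exact: nbhs_infty_gt.
  rewrite big_nat_recl//= big1 ?addr0 ?expr0 ?mulr1// => [|i _].
    by rewrite /pseries_diffs /= mul1r.
  by rewrite expr0n mulr0.
have h2 : h (pi / 2) = 1 by rewrite /h cos_pihalf.
have g2 : g (pi / 2) = 0 by rewrite /g h2 cos_pihalf sin_pihalf phi10; lra.
(* g = h' + t h is a multiple of exp (t a), and it vanishes at pi / 2 *)
have g0 x : 0 < x < pi -> g x = 0.
  move=> xpi; pose f y := g y * expR (- (t * y)).
  have : f x = f (pi / 2).
    apply: cst0 => // y ypi; have dgy := dg _ ypi.
    by apply: is_derive_eq; rewrite /GRing.scale /=; lra.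
  rewrite /f g2 mul0r => /eqP; rewrite mulf_eq0 (gt_eqF (expR_gt0 _)) orbF.
  by move/eqP.
pose f y := h y * expR (t * y).
have : f a = f (pi / 2).
  apply: cst0 => // y ypi; have dhy := dh _ ypi; have := g0 _ ypi; rewrite /g => gy.
  by apply: is_derive_eq; rewrite /GRing.scale /=; have := congr1 ( *%R (expR (t * y))) gy; lra.
rewrite /f h2 mul1r => E; rewrite mulrBr expRD expRN -E mulfK// gt_eqF// expR_gt0.
Unshelve. all: by end_near.
Qed.

End exponential_angle_series.

(** The endpoints [u = 1] and [u = -1] are needed too, the former for the diagonal
    terms of discrete energies; there the series is reached as a limit from the
    inside. *)
Section endpoints.
Context {R : realType}.
Variable t : R.
Hypothesis t0 : 0 <= t.
Local Notation c := (expasin_coef t).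
Let g (a : R) := expR (t * (pi / 2 - a)).

Lemma expasin_term_le (n : nat) (u v : R) : `|u| <= v -> `|pseries c u n| <= pseries c v n.
Proof.
move=> uv; rewrite /pseries /series /=; apply: le_trans (ler_norm_sum _ _ _) _.
apply: ler_sum => i _; rewrite normrM (ger0_norm (expasin_coef_ge0 t0 i)) normrX.
by rewrite ler_wpM2l ?expasin_coef_ge0// lerXn2r// nnegrE (le_trans _ uv).
Qed.

(** A partial sum is continuous, so that exceeding [g 0] at [u = 1] it would also
    exceed it at some [u < 1], where the series is already known. *)
Lemma expasin_partial_le n : pseries c 1 n <= g 0.
Proof.
have g00 : 0 < g 0 by exact: expR_gt0.
rewrite leNgt; apply/negP => h.
set S := pseries c 1 n in h.
pose L := ln (S / g 0).
have S0 : 0 < S by apply: lt_trans h.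
have L0 : 0 < L by rewrite ln_gt0// ltr_pdivlMr// mul1r.
pose u := expR (- (L / n.+1%:R)).
have u1 : u < 1.
  by rewrite /u -[ltRHS]expR0 ltr_expR oppr_lt0 divr_gt0.
have u0 : 0 < u := expR_gt0 _.
have un : S * u ^+ n <= pseries c u n.
  rewrite /S /pseries /series /= mulr_suml; apply: ler_sum_nat => i /andP[_ ilt].
  rewrite expr1n mulr1 ler_wpM2l ?expasin_coef_ge0//.
  by rewrite ler_wiXn2l ?(ltW u0) ?(ltW u1)// ltnW.
have up : pseries c u n <= g 0.
  have acu : 0 < acos u < pi by rewrite acos_gt0 ?acos_ltpi//; lra.
  have E := expasin_series_cos t0 acu.
  rewrite acosK in E; last by rewrite in_itv/=; lra.
  apply: (@le_trans _ _ (expR (t * (pi / 2 - acos u)))).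
    rewrite -E; apply: nondecreasing_cvgn_le.
      apply: nondecreasing_series => i _ _.
      by rewrite mulr_ge0 ?expasin_coef_ge0// exprn_ge0// ltW.
    have [M cM] := expasin_coef_bounded t0.
    by apply: (cvg_pseries_bounded cM); rewrite (ltW u0) u1.
  rewrite ler_expR ler_wpM2l// lerD2l lerN2; case/andP: acu => /ltW //.
have gS : g 0 < S * u ^+ n.
  rewrite /u -expRM_natl.
  have -> : S = g 0 * expR L by rewrite /L lnK ?posrE ?divr_gt0// mulrCA divff ?mulr1// gt_eqF.
  rewrite -mulrA ltr_pMr// -expRD expR_gt1.
  have -> : L + n%:R * - (L / n.+1%:R) = L / n.+1%:R.
    rewrite mulrN mulrCA -{1}(mulr1 L) -mulrBr; congr (_ * _).
    apply: (@mulIf _ n.+1%:R); first by rewrite pnatr_eq0.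
    by rewrite mulrBl mul1r mulVf ?pnatr_eq0// divfK ?pnatr_eq0// -natr1; lra.
  by rewrite divr_gt0.
by have := lt_le_trans gS (le_trans un up); rewrite ltxx.
Qed.

Lemma expasin_is_cvg (u : R) : `|u| <= 1 -> cvgn (pseries c u).
Proof.
move=> u1.
have cv1 : cvgn (pseries c 1).
  apply: nondecreasing_is_cvgn.
    apply: nondecreasing_series => i _ _.
    by rewrite mulr_ge0 ?expasin_coef_ge0// exprn_ge0.
  by exists (g 0) => _ [n _ <-]; exact: expasin_partial_le.
apply: normed_cvg; apply: series_le_cvg cv1 => n //=.
  by rewrite expr1n mulr1 expasin_coef_ge0.
rewrite normrM (ger0_norm (expasin_coef_ge0 t0 n)) ler_wpM2l ?expasin_coef_ge0//.
by rewrite normrX expr1n exprn_ile1.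
Qed.

(** As the coefficients are nonnegative, continuity along any radius follows from
    continuity along the positive one. *)
Lemma expasin_endpoint_diff (s v : R) : `|s| = 1 -> 0 <= v <= 1 ->
  `|limn (pseries c s) - limn (pseries c (s * v))| <=
  limn (pseries c 1) - limn (pseries c v).
Proof.
move=> s1 /andP[v0 v1].
have sv : `|s * v| <= 1 by rewrite normrM s1 mul1r ger0_norm.
have cs : cvgn (pseries c s) by apply: expasin_is_cvg; rewrite s1.
have csv := expasin_is_cvg sv.
have c1 : cvgn (pseries c 1) by apply: expasin_is_cvg; rewrite normr1.
have cv : cvgn (pseries c v) by apply: expasin_is_cvg; rewrite ger0_norm.
have L : `|pseries c s n - pseries c (s * v) n| @[n --> \oo] -->
    `|limn (pseries c s) - limn (pseries c (s * v))|.
  by apply: cvg_norm; exact: cvgB.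
have L' : pseries c 1 n - pseries c v n @[n --> \oo] -->
    limn (pseries c 1) - limn (pseries c v) by exact: cvgB.
apply: (ler_cvg_to L L'); near=> n.
rewrite /pseries /series /= -!sumrB; apply: le_trans (ler_norm_sum _ _ _) _.
apply: ler_sum => i _; rewrite -mulrBr normrM expr1n (ger0_norm (expasin_coef_ge0 t0 i)).
rewrite -mulrBr ler_wpM2l ?expasin_coef_ge0// exprMn -{1}[s ^+ i]mulr1 -mulrBr.
rewrite normrM normrX s1 expr1n mul1r ger0_norm//.
by rewrite subr_ge0 exprn_ile1.
Unshelve. all: by end_near.
Qed.

Lemma expasin_cvg (a : R) : 0 <= a <= pi -> pseries c (cos a) @ \oo --> g a.
Proof.
move=> a_pi.
suff <- : limn (pseries c (cos a)) = g a.
  by apply: expasin_is_cvg; rewrite ler_norml cos_geN1 cos_le1.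
have g00 : 0 < g 0 := expR_gt0 _.
have small (x b : R) : 0 <= x -> 0 <= b -> g x - g (x + b) <= g 0 * (t * b).
  move=> x0 b0; have -> : g (x + b) = g x * expR (- (t * b)).
    by rewrite /g -expRD; congr expR; lra.
  rewrite -{1}[g x]mulr1 -mulrBr; apply: (@le_trans _ _ (g x * (t * b))).
    by rewrite ler_wpM2l ?expR_ge0//; have := expR_ge1Dx (- (t * b)); lra.
  by rewrite ler_wpM2r ?mulr_ge0// ler_expR ler_wpM2l//; lra.
have choose (e : R) : 0 < e -> exists2 b, 0 < b < pi / 2 & g 0 * (t * b) <= e.
  move=> e0; have e1 : 0 < e + g 0 * t by rewrite ltr_pwDl// mulr_ge0// ltW.
  have b1 : 0 < e / (e + g 0 * t) <= 1.
    by rewrite divr_gt0//= ler_pdivrMr// mul1r lerDl mulr_ge0// ltW.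
  exists (e / (e + g 0 * t) / 2); first by have := @pi_ge2 R; lra.
  have : g 0 * t * (e / (e + g 0 * t)) <= e.
    rewrite mulrCA ger_pMr// ler_pdivrMr// mul1r lerDr ltW//.
  have : 0 <= g 0 * t by rewrite mulr_ge0// ltW.
  move: (e / _) b1 => b /andP[b0 _] h1 h2.
  have : 0 <= g 0 * t * b by rewrite mulr_ge0// ltW.
  lra.
have cosin (b : R) : 0 < b < pi / 2 -> 0 <= cos b <= 1.
  by move=> ?; rewrite cos_le1 andbT cos_ge0_pihalf//; lra.
have c1 : cvgn (pseries c 1) by apply: expasin_is_cvg; rewrite normr1.
have lim0 : limn (pseries c 1) = g 0.
  apply/eqP; rewrite eq_le; apply/andP; split.
    by apply: limr_le => //; near=> n; exact: expasin_partial_le.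
  apply/ler_addgt0Pr => e /choose[b b0 be].
  have gb : g b <= limn (pseries c 1).
    have <- : limn (pseries c (cos b)) = g b by apply: expasin_series_cos => //; lra.
    have cb : `|cos b| <= 1 by have := cosin _ b0; rewrite ler_norml; lra.
    apply: ler_lim => //; first exact: expasin_is_cvg.
    by near=> n; apply: le_trans (ler_norm _) _; exact: expasin_term_le.
  by have := small 0 b (lexx _); rewrite add0r => /(_ _); lra.
case: (ltgtP a 0) => [|ap|->]; first lra; last by rewrite cos0.
case: (ltgtP a pi) => [ap'|//|->]; [|lra|].
  by apply: expasin_series_cos => //; rewrite ap ap'.
rewrite cospi; apply/eqP; rewrite -subr_eq0 -normr_le0; apply/ler_addgt0Pr => e e0.
have e20 : 0 < e / 2 by lra.
have [b b0 be] := choose _ e20.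
have h1 := @expasin_endpoint_diff (-1) (cos b) (normrN1 _) (cosin _ b0).
have Ecos : -1 * cos b = cos (- b + pi) by rewrite cosDpi cosN mulN1r.
rewrite Ecos lim0 in h1.
have E1 : limn (pseries c (cos b)) = g b by apply: expasin_series_cos => //; lra.
have E2 : limn (pseries c (cos (- b + pi))) = g (pi - b).
  by rewrite addrC; apply: expasin_series_cos => //; lra.
rewrite E1 E2 in h1.
have h2 := small 0 b (lexx _); rewrite add0r in h2.
have h3 : g (pi - b) - g pi <= g 0 * (t * b).
  by have := small (pi - b) b; rewrite subrK; apply; lra.
have h4 : 0 <= g (pi - b) - g pi by rewrite subr_ge0 ler_expR ler_wpM2l//; lra.
apply: le_trans (ler_distD (g (pi - b)) _ _) _.
rewrite (ger0_norm h4); have := h2 _; lra.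
Unshelve. all: by end_near.
Qed.
End endpoints.

(** * Positive definiteness of exp (- t rho) *)

Section positive_definiteness.
Context {R : realType} (d : nat).
Local Notation sigma := (@surface_measure R d).
Local Notation S := (@sphere R d).

Lemma measurable_sphere : measurable S.
Proof.
rewrite (_ : S = (@enorm R d.+1) @^-1` [set 1]).
  by rewrite -[X in measurable X]setTI; exact: measurable_enorm.
by apply/seteqP; split.
Qed.

Lemma surface_measure_sphereC : sigma (~` S) = 0%E.
Proof.
have := @probability_setC _ _ _ (Defs_surface_measure__canonical__probability_measure_Probability d) _ measurable_sphere.
by move=> /= ->; rewrite surface_measure_sphere subee.
Qed.

Lemma integral_sphereT f : sigma.-integrable setT f ->
  (\int[sigma]_(x in S) f x = \int[sigma]_x f x)%E.
Proof.
move=> intf; rewrite [RHS](negligible_integral (measurableC measurable_sphere))//; last first.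
  exact: surface_measure_sphereC.
by rewrite setTD setCK.
Qed.

Definition monomial k (alpha : {ffun 'I_k -> 'I_d.+1}) (x : d.+1.-tuple R) : R :=
  \prod_i tnth x (alpha i).

Lemma dotpX k (x y : d.+1.-tuple R) :
  dotp x y ^+ k = \sum_(alpha : {ffun 'I_k -> 'I_d.+1}) monomial alpha x * monomial alpha y.
Proof.
rewrite -[k in LHS]card_ord -prodr_const /dotp.
rewrite (bigA_distr_bigA (fun _ j => tnth x j * tnth y j)).
by apply: eq_bigr => alpha _; rewrite -big_split.
Qed.

Lemma measurable_monomial k (alpha : {ffun 'I_k -> 'I_d.+1}) :
  measurable_fun setT (monomial alpha).
Proof. by apply: measurable_prod => i _; exact: measurable_tnth. Qed.

Lemma integrable_monomial k (alpha : {ffun 'I_k -> 'I_d.+1}) :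
  sigma.-integrable S (EFin \o monomial alpha).
Proof.
apply: measurable_bounded_integrable.
- exact: measurable_sphere.
- by rewrite /= surface_measure_sphere ltry.
- exact: measurable_funS (measurable_monomial alpha).
exists 1; split; first exact: num_real.
move=> B B1 x Sx; rewrite /= /monomial normr_prod; apply: le_trans (ltW B1).
by apply: prodr_ile1 => i _; rewrite normr_ge0/=; exact: tnth_sphere_le1.
Qed.

(** The clamp is the identity on inner products of unit vectors; it makes the
    kernel bounded on the line. *)
Definition moment k : R := zonal d (fun u => Num.max (-1) (Num.min 1 u) ^+ k).

Lemma bounded_measurable_clampX k :
  bounded_measurable (fun u : R => Num.max (-1) (Num.min 1 u) ^+ k).
Proof.
split.
  apply: measurable_funX; apply: measurable_maxr => //; exact: measurable_minr.
exists 1 => u; rewrite normrX exprn_ile1// ler_norml; exact: clampP.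
Qed.

Lemma sum_monomial_integral k x : S x ->
  \sum_(alpha : {ffun 'I_k -> 'I_d.+1})
    monomial alpha x * \int[sigma]_(y in S) monomial alpha y = moment k.
Proof.
move=> Sx; apply/eqP; rewrite -eqe; apply/eqP; rewrite /moment -(zonalE (bounded_measurable_clampX k) Sx).
rewrite -integral_sphereT; last exact: integrable_dotp (bounded_measurable_clampX k).
rewrite -sumEFin.
transitivity (\int[sigma]_(y in S) \sum_(alpha : {ffun 'I_k -> 'I_d.+1})
   ((monomial alpha x)%:E * (monomial alpha y)%:E)%E)%E.
  rewrite integral_sum//; last 2 first.
  - exact: measurable_sphere.
  - by move=> alpha; apply: integrableZl; [exact: measurable_sphere|exact: integrable_monomial].
  apply: eq_bigr => alpha _; rewrite integralZl//; last 2 first.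
  - exact: measurable_sphere.
  - exact: integrable_monomial.
  rewrite EFinM fineK//; apply: integrable_fin_num; last exact: integrable_monomial.
  exact: measurable_sphere.
apply: eq_integral => y /[!inE] Sy; rewrite clamp_id ?dotp_sphere// dotpX.
by rewrite -sumEFin; apply: eq_bigr => alpha _; rewrite EFinM.
Qed.

(** Expanding [(x . y) ^ k] into monomials [m_a x * m_a y], the difference of the
    two sides is the sum over [a] of the squares of the sum of the [m_a (z i)]
    minus [N] times the mean of [m_a]. *)
Lemma moment_le k N (z : 'I_N -> d.+1.-tuple R) : (forall i, S (z i)) ->
  N%:R ^+ 2 * moment k <= \sum_(i < N) \sum_(j < N) dotp (z i) (z j) ^+ k.
Proof.
move=> Sz.
pose A (alpha : {ffun 'I_k -> 'I_d.+1}) := \sum_(i < N) monomial alpha (z i).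
pose B (alpha : {ffun 'I_k -> 'I_d.+1}) := \int[sigma]_(y in S) monomial alpha y.
have AA : \sum_alpha A alpha ^+ 2 = \sum_(i < N) \sum_(j < N) dotp (z i) (z j) ^+ k.
  transitivity (\sum_(alpha : {ffun 'I_k -> 'I_d.+1}) \sum_(i < N) \sum_(j < N) monomial alpha (z i) * monomial alpha (z j)).
    apply: eq_bigr => alpha _; rewrite expr2 /A mulr_suml; apply: eq_bigr => i _.
    by rewrite mulr_sumr.
  rewrite exchange_big/=; apply: eq_bigr => i _; rewrite exchange_big/=.
  by apply: eq_bigr => j _; rewrite dotpX.
have AB : \sum_alpha A alpha * B alpha = N%:R * moment k.
  rewrite -[N in RHS]card_ord -sum1_card natr_sum mulr_suml.
  under eq_bigr do rewrite /A mulr_suml.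
  rewrite exchange_big/=; apply: eq_bigr => i _; rewrite mul1r.
  exact: sum_monomial_integral.
have BB : \sum_alpha B alpha ^+ 2 = moment k.
  have intB alpha : sigma.-integrable S (fun y => (B alpha)%:E * (monomial alpha y)%:E)%E.
    by apply: integrableZl; [exact: measurable_sphere|exact: integrable_monomial].
  apply/eqP; rewrite -eqe; apply/eqP; rewrite -sumEFin.
  transitivity (\int[sigma]_(y in S) (cst (moment k)%:E y))%E; last first.
    rewrite integral_cst; last exact: measurable_sphere.
    by have := @surface_measure_sphere R d; move=> /= ->; rewrite mule1.
  transitivity (\int[sigma]_(y in S) \sum_alpha ((B alpha)%:E * (monomial alpha y)%:E))%E.
    rewrite integral_sum//; last exact: measurable_sphere.
    apply: eq_bigr => alpha _; rewrite integralZl//; last 2 first.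
    - exact: measurable_sphere.
    - exact: integrable_monomial.
    rewrite expr2 EFinM; congr (_ * _)%E; rewrite /B /Rintegral fineK//.
    by apply: integrable_fin_num; [exact: measurable_sphere|exact: integrable_monomial].
  apply: eq_integral => y /[!inE] Sy; rewrite -(sum_monomial_integral k Sy) -sumEFin.
  by apply: eq_bigr => alpha _; rewrite -EFinM mulrC.
have : 0 <= \sum_alpha (A alpha - N%:R * B alpha) ^+ 2.
  by apply: sumr_ge0 => alpha _; exact: sqr_ge0.
have -> : \sum_alpha (A alpha - N%:R * B alpha) ^+ 2 =
  \sum_alpha A alpha ^+ 2 - 2 * N%:R * (\sum_alpha A alpha * B alpha)
   + N%:R ^+ 2 * \sum_alpha B alpha ^+ 2.
  rewrite !mulr_sumr -sumrB -big_split/=; apply: eq_bigr => alpha _; lra.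
rewrite AA AB BB; lra.
Qed.

Lemma decay_cvg (t u : R) : 0 <= t ->
  expR (- (t * (pi / 2))) * pseries (expasin_coef t) (Num.max (-1) (Num.min 1 u)) n
    @[n --> \oo] --> decay t u.
Proof.
move=> t0; have -> : decay t u = expR (- (t * (pi / 2))) * expR (t * (pi / 2 - arc u)).
  by rewrite /decay -expRD; congr expR; lra.
apply: cvgMr; have cu := clampP u.
rewrite -[X in pseries _ X]acosK; last by rewrite in_itv.
by apply: expasin_cvg => //; rewrite arc_ge0 arc_lepi.
Qed.

(** The power series of the kernel reduces this to the moments. *)
Lemma decay_energy N (z : 'I_N -> d.+1.-tuple R) t : 0 <= t -> (forall i, S (z i)) ->
  N%:R ^+ 2 * zonal d (decay t) <=
  \sum_(i < N) \sum_(j < N) decay t (dotp (z i) (z j)).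
Proof.
move=> t0 Sz.
pose a := expR (- (t * (pi / 2))).
have a0 : 0 < a by exact: expR_gt0.
pose f n (u : R) := a * pseries (expasin_coef t) (Num.max (-1) (Num.min 1 u)) n.
have fB n u : `|f n u| <= 1.
  rewrite /f normrM (ger0_norm (ltW a0)).
  apply: (@le_trans _ _ (a * expR (t * (pi / 2 - 0)))); last first.
    by rewrite -expRD -[leRHS]expR0 ler_expR; lra.
  rewrite ler_wpM2l ?(ltW a0)//; apply: le_trans (expasin_partial_le t0 n).
  by apply: expasin_term_le => //; rewrite ler_norml; exact: clampP.
have mf n : measurable_fun setT (f n).
  apply: measurable_funM => //.
  apply: measurable_sum => i; apply: measurable_funM => //.
  by case: (bounded_measurable_clampX i).
have bf n : bounded_measurable (f n) by split => //; exists 1.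
have le_n n : N%:R ^+ 2 * zonal d (f n) <=
    \sum_(i < N) \sum_(j < N) f n (dotp (z i) (z j)).
  have -> : zonal d (f n) = a * \sum_(0 <= k < n) expasin_coef t k * moment k.
    elim: n => [|n IH].
      rewrite big_geq// mulr0 -[RHS](zonal_cst d); congr zonal; apply/funext => u.
      by rewrite /f /pseries /series /= big_geq// mulr0.
    rewrite big_nat_recr//= mulrDr -IH /moment mulrA.
    rewrite -(zonalZ _ _ (bounded_measurable_clampX n)).
    rewrite -zonalD//; last exact/bounded_measurableZ/bounded_measurable_clampX.
    congr zonal; apply/funext => u; rewrite /f /pseries /series /= big_nat_recr//=.
    by rewrite mulrDr mulrA.
  have E i j : f n (dotp (z i) (z j)) =
      a * \sum_(0 <= k < n) expasin_coef t k * dotp (z i) (z j) ^+ k.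
    by rewrite /f clamp_id ?dotp_sphere.
  have -> : \sum_(i < N) \sum_(j < N) f n (dotp (z i) (z j)) =
      a * \sum_(0 <= k < n) expasin_coef t k * \sum_(i < N) \sum_(j < N) dotp (z i) (z j) ^+ k.
    transitivity (\sum_(i < N) \sum_(j < N)
        a * \sum_(0 <= k < n) expasin_coef t k * dotp (z i) (z j) ^+ k).
      by apply: eq_bigr => i _; apply: eq_bigr => j _; rewrite E.
    rewrite mulr_sumr; under [RHS]eq_bigr do rewrite mulrA mulr_sumr.
    rewrite [RHS]exchange_big/=; apply: eq_bigr => i _.
    under [RHS]eq_bigr do rewrite mulr_sumr.
    rewrite [RHS]exchange_big/=; apply: eq_bigr => j _.
    by rewrite mulr_sumr; apply: eq_bigr => k _; rewrite mulrA.
  rewrite mulrCA ler_wpM2l ?(ltW a0)// mulr_sumr.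
  apply: ler_sum => k _; rewrite mulrCA.
  by rewrite ler_wpM2l ?expasin_coef_ge0//; exact: moment_le.
have lhs : N%:R ^+ 2 * zonal d (f n) @[n --> \oo] --> N%:R ^+ 2 * zonal d (decay t).
  apply: cvgMr.
  have h : (zonal d (f n))%:E @[n --> \oo] --> (zonal d (decay t))%:E.
    rewrite -(zonalE (bounded_measurable_decay t0) (sphere_pole d)).
    rewrite (_ : (fun n => _) = (fun n => \int[sigma]_y (f n (dotp (pole d) y))%:E)%E); last first.
      by apply/funext => n; rewrite -(zonalE (bf n) (sphere_pole d)).
    have [|||//||_ _] := @dominated_convergence _ _ _ sigma setT measurableT
      (fun n y => (f n (dotp (pole d) y))%:E) (fun y => (decay t (dotp (pole d) y))%:E)
      (cst 1%:E).
    - move=> n; apply/measurable_EFinP; apply: measurableT_comp (mf n) _.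
      exact: measurable_dotp.
    - exact: measurable_int (integrable_dotp (pole d) (bounded_measurable_decay t0)).
    - apply: aeW => y _; apply/cvg_EFin; first by apply: nearW.
      exact: decay_cvg.
    - exact: finite_measure_integrable_cst.
    - by apply: aeW => y n _ /=; rewrite lee_fin; exact: fB.
    by [].
  by move/fine_cvg : h.
have rhs : \sum_(i < N) \sum_(j < N) f n (dotp (z i) (z j)) @[n --> \oo] -->
   \sum_(i < N) \sum_(j < N) decay t (dotp (z i) (z j)).
  apply: cvg_big => [|i _]; first exact: add_continuous.
  apply: cvg_big => [|j _]; first exact: add_continuous.
  exact: decay_cvg.
by apply: (ler_cvg_to lhs rhs); near=> n; exact: le_n.
Unshelve. all: by end_near.
Qed.

End positive_definiteness.

(** * Potentials as mixtures of exponentials *)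

Section laplace_mixtures.
Context {R : realType}.
Local Notation mu := (@lebesgue_measure R).
Local Open Scope ereal_scope.

Lemma exp_abs_integral_lty (k : R) : (0 < k)%R ->
  \int[mu]_x (expR (- (k * `|x|)))%:E < +oo.
Proof.
move=> k0; rewrite ge0_symfun_integralT//; first last.
- by move=> x /=; rewrite normrN.
- move=> x; apply: continuous_comp; last exact: continuous_expR.
  apply: cvgN; apply: cvgM; [exact: cvg_cst|exact: norm_continuous].
rewrite lte_mul_pinfty//.
apply: (@le_lt_trans _ _ (\int[mu]_x (k^-1 * exponential_pdf k x)%:E)).
  rewrite integral_mkcond; apply: ge0_le_integral => //.
  - by move=> x _; apply: erestrict_ge0 => y _; rewrite lee_fin expR_ge0.
  - apply/(measurable_restrictT _ _).1 => //.
      rewrite -[X in measurable X]setTI; apply: measurable_fun_ler => //.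
    apply/measurable_EFinP; apply: measurableT_comp => //.
    by apply: measurable_funN; apply: measurable_funM => //; exact: normr_measurable.
  - apply/measurable_EFinP; apply: measurable_funM => //.
    exact: measurable_exponential_pdf.
  - move=> x _; rewrite patchE; case: ifPn => [|_]; last first.
      by rewrite lee_fin mulr_ge0 ?invr_ge0 ?(ltW k0)// exponential_pdf_ge0// ltW.
    rewrite inE/= => x0; rewrite lee_fin exponential_pdfE//.
    by rewrite mulrA mulVf ?gt_eqF// mul1r ger0_norm// mulNr.
under eq_integral do rewrite EFinM.
rewrite ge0_integralZl//; last 3 first.
- by apply/measurable_EFinP; exact: measurable_exponential_pdf.
- by move=> x _; rewrite lee_fin exponential_pdf_ge0// ltW.
- by rewrite lee_fin invr_ge0 ltW.
by rewrite integral_exponential_pdf// mule1 ltry.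
Qed.

Lemma integral_gt0_itv (f : R -> R) (m : R) : measurable_fun setT f ->
  (forall x, 0 <= f x)%R -> (0 < m)%R -> (forall x, 0 <= x <= 1 -> m <= f x)%R ->
  0 < \int[mu]_x (f x)%:E.
Proof.
move=> mf f0 m0 mf1.
apply: (@lt_le_trans _ _ (\int[mu]_(x in `[0%R, 1%R]) (cst m%:E x))).
  rewrite integral_cst//= lebesgue_measure_itv/= lte_fin ltr01 sube0 mule1 lte_fin//.
apply: (@le_trans _ _ (\int[mu]_(x in `[0%R, 1%R]) (f x)%:E)).
  apply: ge0_le_integral => //.
  - by move=> x _; rewrite lee_fin ltW.
  - by apply/measurable_EFinP; exact: measurable_funS mf.
apply: ge0_subset_integral => //; first exact/measurable_EFinP.
by move=> x _; rewrite lee_fin.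
Qed.

(** Scaling in the logarithmic variable is a translation, which turns the
    Mellin integral of [k] into a power of [rho]. *)
Lemma mellin_power (k : R -> R) (delta rho : R) : measurable_fun setT k ->
  (forall x, 0 <= k x)%R -> (0 < rho)%R ->
  \int[mu]_tau (k (expR tau * rho) * expR (- (delta * tau)))%:E =
  (rho `^ delta)%:E * \int[mu]_tau (k (expR tau) * expR (- (delta * tau)))%:E.
Proof.
move=> mk k0 rho0.
pose G (x : R) := (k (expR x) * expR (- (delta * x)))%:E.
have mG : measurable_fun setT G.
  apply/measurable_EFinP; apply: measurable_funM.
    by apply: measurableT_comp => //; exact: measurable_expR.
  by apply: measurableT_comp => //; apply: measurable_funN; exact: measurable_funM.
have G0 x : 0 <= G x by rewrite lee_fin mulr_ge0// expR_ge0.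
rewrite -(ge0_integral_translate (ln rho) mG G0) -ge0_integralZl//; last 2 first.
- apply: measurableT_comp => //; exact: measurable_funD.
- by rewrite lee_fin powR_ge0.
apply: eq_integral => x _; rewrite /G -EFinM; congr EFin.
rewrite expRD lnK ?posrE// mulrCA; congr (_ * _)%R.
rewrite /powR gt_eqF// -expRD; congr expR; lra.
Qed.

(** [exp x - (s + 1) x] is bounded below, by the tangent line of [exp] at
    [ln (s + 1)]. *)
Lemma exp_exp_bound (s : R) : (0 < s)%R -> exists2 C : R, (0 < C)%R &
  forall x, (0 <= x)%R -> (expR (- expR x) * expR (s * x) <= C * expR (- x))%R.
Proof.
move=> s0; exists (expR ((s + 1) * (ln (s + 1) - 1)))%R; first exact: expR_gt0.
move=> x x0; rewrite -!expRD ler_expR.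
have s1 : (0 < s + 1)%R by lra.
have : ((s + 1) * (1 + (x - ln (s + 1))) <= expR x)%R.
  have -> : expR x = ((s + 1) * expR (x - ln (s + 1)))%R.
    by rewrite -[X in (X * _)%R]lnK ?posrE// -expRD; congr expR; lra.
  by rewrite ler_wpM2l ?(ltW s1)// expR_ge1Dx.
lra.
Qed.

Lemma exp_abs_dominated_lty (f : R -> R) (C k : R) : measurable_fun setT f ->
  (forall x, 0 <= f x)%R -> (0 < k)%R -> (0 <= C)%R ->
  (forall x, f x <= C * expR (- (k * `|x|)))%R ->
  \int[mu]_x (f x)%:E < +oo.
Proof.
move=> mf f0 k0 C0 fC.
have mE : measurable_fun setT (fun x : R => (expR (- (k * `|x|)))%:E : \bar R).
  apply/measurable_EFinP; apply: measurableT_comp => //.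
  by apply: measurable_funN; apply: measurable_funM => //; exact: normr_measurable.
apply: (@le_lt_trans _ _ (\int[mu]_x (C%:E * (expR (- (k * `|x|)))%:E))).
  apply: ge0_le_integral => //.
  - by move=> x _; rewrite lee_fin.
  - exact/measurable_EFinP.
  - exact: measurable_funeM.
  - by move=> x _; rewrite -EFinM lee_fin.
rewrite ge0_integralZl ?lee_fin//.
by rewrite lte_mul_pinfty// exp_abs_integral_lty.
Qed.

Lemma fin_pos_EFin (x : \bar R) : 0 < x -> x < +oo ->
  exists2 c : R, (0 < c)%R & x = c%:E.
Proof. by case: x => [r||]// r0 _; exists r. Qed.

Lemma measurable_exp_kernel (k : R -> R) (s : R) : measurable_fun setT k ->
  measurable_fun setT (fun x : R => k (expR x) * expR (- (s * x)))%R.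
Proof.
move=> mk; apply: measurable_funM.
  by apply: measurableT_comp => //; exact: measurable_expR.
by apply: measurableT_comp => //; apply: measurable_funN; exact: measurable_funM.
Qed.

(** The Gamma integral, in the variable [tau = ln t]. *)
Lemma mixture_neg (delta : R) : (delta < 0)%R -> exists2 c : R, (0 < c)%R &
  forall rho, (0 < rho)%R ->
  \int[mu]_tau (expR (- (expR tau * rho)) * expR (- (delta * tau)))%:E =
  (c * rho `^ delta)%:E.
Proof.
move=> d0.
pose k (x : R) := expR (- x).
have mk : measurable_fun setT k by apply: measurableT_comp => //; exact: measurable_funN.
have k0 x : (0 <= k x)%R by exact: expR_ge0.
have mG := @measurable_exp_kernel k delta mk.
have G0 x : (0 <= k (expR x) * expR (- (delta * x)))%R by rewrite mulr_ge0// expR_ge0.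
have [||c c0 cE] := @fin_pos_EFin (\int[mu]_tau (k (expR tau) * expR (- (delta * tau)))%:E).
- apply: (integral_gt0_itv mG G0 (expR_gt0 (- expR 1)%R)) => x /andP[x0 x1].
  rewrite /k -[leLHS]mulr1 ler_pM ?expR_ge0//.
    by rewrite ler_expR lerN2 ler_expR.
  by rewrite -expR0 ler_expR; nra.
- have s0 : (0 < - delta)%R by lra.
  have [C C0 hC] := exp_exp_bound s0.
  pose m := Num.min 1%R (- delta)%R.
  have m0 : (0 < m)%R by rewrite lt_min ltr01.
  apply: (@exp_abs_dominated_lty _ (C + 1) m) => //; first lra.
  move=> x; have [x0|x0] := leP 0%R x.
    have -> : (- (delta * x) = - delta * x)%R by lra.
    apply: le_trans (hC x x0) _; rewrite ler_pM ?expR_ge0 ?(ltW C0)//; first lra.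
    rewrite ler_expR (ger0_norm x0) lerN2 -[leRHS]mul1r ler_wpM2r//.
    by rewrite /m ge_min lexx.
  apply: (@le_trans _ _ (1 * expR (- (m * `|x|)))%R); last first.
    by rewrite ler_wpM2r ?expR_ge0//; lra.
  rewrite ler_pM ?expR_ge0//.
    by rewrite /k -[leRHS]expR0 ler_expR oppr_le0 expR_ge0.
  rewrite ler_expR (ltr0_norm x0) mulrN opprK.
  have : (m <= - delta)%R by rewrite /m ge_min lexx orbT.
  by nra.
exists c => // rho rho0.
by rewrite (@mellin_power k delta rho mk k0 rho0) cE -EFinM mulrC.
Qed.

(** Near [t = 0] the factor [1 - exp (- t rho)] is at most [t rho], so that the
    integral converges for [delta < 1]. *)
Lemma mixture_pos (delta : R) : (0 < delta < 1)%R -> exists2 c : R, (0 < c)%R &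
  forall rho, (0 <= rho)%R ->
  \int[mu]_tau ((1 - expR (- (expR tau * rho))) * expR (- (delta * tau)))%:E =
  (c * rho `^ delta)%:E.
Proof.
move=> /andP[d0 d1].
(* the absolute value makes k nonnegative on the whole line *)
pose k (x : R) := `|1 - expR (- x)|%R.
have mk : measurable_fun setT k.
  apply: measurableT_comp; first exact: normr_measurable.
  by apply: measurable_funB => //; apply: measurableT_comp => //; exact: measurable_funN.
have k0 x : (0 <= k x)%R by exact: normr_ge0.
have kE x : (0 <= x)%R -> k x = (1 - expR (- x))%R.
  by move=> x0; rewrite /k ger0_norm// subr_ge0 -expR0 ler_expR oppr_le0.
have mG := @measurable_exp_kernel k delta mk.
have G0 x : (0 <= k (expR x) * expR (- (delta * x)))%R by rewrite mulr_ge0// expR_ge0.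
have [||c c0 cE] := @fin_pos_EFin (\int[mu]_tau (k (expR tau) * expR (- (delta * tau)))%:E).
- apply: (@integral_gt0_itv _ ((1 - expR (- 1)) * expR (- delta))%R mG G0).
    by rewrite mulr_gt0 ?expR_gt0// subr_gt0 -expR0 ltr_expR oppr_lt0.
  move=> x /andP[x0 x1]; rewrite kE ?expR_ge0//.
  apply: ler_pM; rewrite ?expR_ge0//.
  + by rewrite lerD2l lerN2 ler_expR lerN2 -expR0 ler_expR.
  + by rewrite ler_expR; nra.
- pose m := Num.min delta (1 - delta)%R.
  have m0 : (0 < m)%R by rewrite lt_min d0 subr_gt0.
  have md : (m <= delta)%R by rewrite /m ge_min lexx.
  have md1 : (m <= 1 - delta)%R by rewrite /m ge_min lexx orbT.
  apply: (@exp_abs_dominated_lty _ 1 m) => //.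
  move=> x; rewrite kE ?expR_ge0// mul1r; have [x0|x0] := leP 0%R x.
    apply: (@le_trans _ _ (1 * expR (- (delta * x)))%R).
      by rewrite ler_wpM2r ?expR_ge0//; have := expR_ge0 (- expR x)%R; lra.
    by rewrite mul1r ler_expR (ger0_norm x0); nra.
  apply: (@le_trans _ _ (expR x * expR (- (delta * x)))%R).
    by rewrite ler_wpM2r ?expR_ge0//; have := expR_ge1Dx (- expR x)%R; lra.
  by rewrite -expRD ler_expR (ltr0_norm x0); nra.
exists c => // rho; rewrite le_eqVlt => /predU1P[<-|rho0].
  rewrite powR0 ?gt_eqF// mulr0; under eq_integral do rewrite mulr0 oppr0 expR0 subrr mul0r.
  exact: integral0.
rewrite mulrC EFinM -cE -(@mellin_power k delta rho mk k0 rho0).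
by apply: eq_integral => x _; rewrite kE// mulr_ge0 ?expR_ge0// ltW.
Qed.

Lemma exp_exp_increment (tau a b : R) : (a < b)%R ->
  \int[mu]_(u in `[a, b]) (expR (- expR (u + tau)) * expR (u + tau))%:E =
  (expR (- expR (a + tau)) - expR (- expR (b + tau)))%:E.
Proof.
move=> ab; pose F u := (- expR (- expR (u + tau)))%R.
have dF (u : R) : is_derive u (1%R : R) F (expR (- expR (u + tau)) * expR (u + tau))%R.
  by apply: is_derive_eq; rewrite /GRing.scale /=; lra.
have cF (u : R) : {for u, continuous F}.
  by apply/differentiable_continuous/derivable1_diffP; case: (dF u).
rewrite (@continuous_FTC2 _ _ F a b ab).
- by rewrite -EFinB /F opprK addrC.
- apply: continuous_subspaceT => u; apply: differentiable_continuous.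
  by apply/derivable1_diffP; exact: ex_derive.
- split; first by move=> u _; case: (dF u).
  + exact: cvg_at_right_filter (cF a).
  + exact: cvg_at_left_filter (cF b).
- by move=> u _; rewrite derive1E; exact: derive_val.
Qed.

(** Frullani's integral: the difference of exponentials is the integral of a
    translate of [w u = exp (- exp u) * exp u] over [[ln rho, ln q]], and the order
    of integration is exchanged. *)
Lemma mixture_zero : exists2 c : R, (0 < c)%R &
  forall rho q, (0 < rho <= q)%R ->
  \int[mu]_tau (expR (- (expR tau * rho)) - expR (- (expR tau * q)))%:E =
  (c * ln (q / rho))%:E.
Proof.
have [|c c0 cE] := @mixture_neg (- 1); first lra.
exists c => // rho q /andP[rho0 rhoq]; have q0 : (0 < q)%R by lra.
pose w (u : R) := (expR (- expR u) * expR u)%R.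
have wE : \int[mu]_u (w u)%:E = c%:E.
  have := cE 1%R ltr01; rewrite powR1 mulr1 => <-; apply: eq_integral => u _.
  by rewrite /w mulr1 mulN1r opprK.
have w0 u : (0 <= w u)%R by rewrite mulr_ge0 ?expR_ge0.
have mw : measurable_fun setT w.
  apply: measurable_funM; last exact: measurable_expR.
  apply: measurableT_comp => //; apply: measurable_funN; exact: measurable_expR.
move: rhoq; rewrite le_eqVlt => /predU1P[<-|rhoq].
  rewrite divff ?gt_eqF// ln1 mulr0; under eq_integral do rewrite subrr.
  exact: integral0.
have ab : (ln rho < ln q)%R by rewrite ltr_ln.
rewrite ln_div ?posrE//.
transitivity (\int[mu]_tau \int[mu]_u (\1_(`[ln rho, ln q]%classic) u * w (u + tau))%:E).
  apply: eq_integral => tau _.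
  have := exp_exp_increment tau ab; rewrite !expRD !lnK ?posrE// ![(_ * expR tau)%R]mulrC => <-.
  rewrite integral_mkcond; apply: eq_integral => u _.
  rewrite patchE indicE; case: (_ \in _); rewrite ?mul0r// mul1r /w.
  by rewrite expRD [(expR u * _)%R]mulrC.
rewrite (@fubini_tonelli _ _ _ _ R mu mu (fun p => (\1_(`[ln rho, ln q]%classic) p.2 * w (p.2 + p.1))%:E)); last 2 first.
- apply/measurable_EFinP; apply: measurable_funM.
    by apply: measurableT_comp => //; exact: measurable_snd.
  by apply: measurableT_comp => //; apply: measurable_funD; [exact: measurable_snd|exact: measurable_fst].
- by move=> p; rewrite lee_fin mulr_ge0.
transitivity (\int[mu]_u (c%:E * (\1_(`[ln rho, ln q]%classic) u)%:E)).
  apply: eq_integral => u _ /=.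
  under eq_integral do rewrite EFinM.
  rewrite ge0_integralZl//; last 2 first.
  - by apply/measurable_EFinP; apply: measurableT_comp => //; exact: measurable_funD.
  - by move=> x _; rewrite lee_fin.
  rewrite muleC; congr (_ * _).
  under eq_integral do rewrite addrC.
  rewrite (@ge0_integral_translate _ u (fun x => (w x)%:E))//.
  exact/measurable_EFinP.
rewrite ge0_integralZl//; last 2 first.
- exact/measurable_EFinP.
- by rewrite lee_fin ltW.
rewrite integral_indic// setIT /= lebesgue_measure_itv/= lte_fin ab.
by rewrite -EFinB -EFinM.
Qed.

End laplace_mixtures.

(** * The energy of the uniform measure *)

Section potentials.
Context {R : realType}.
Local Notation mu := (@lebesgue_measure R).

Definition radial (delta rho : R) : R :=
  if delta == 0 then ln (pi / rho) else rho `^ delta.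

Definition rpot (delta u : R) : R := radial delta (arc u).

Lemma rpotE delta u : -1 <= u <= 1 -> potential delta u = rpot delta u.
Proof. by move=> u1; rewrite /potential /rpot arcE. Qed.

Lemma rpot_ge0 delta u : 0 <= rpot delta u.
Proof.
rewrite /rpot /radial; case: ifPn => _; last exact: powR_ge0.
have := arc_ge0 u; rewrite le_eqVlt => /predU1P[<-|a0]; first by rewrite invr0 mulr0 ln0.
by rewrite ln_ge0// ler_pdivlMr// mul1r arc_lepi.
Qed.

Lemma measurable_rpot delta : measurable_fun setT (rpot delta).
Proof.
have [->|d0] := eqVneq delta 0; last first.
  rewrite (_ : rpot delta = fun u => arc u `^ delta).
    apply: (measurableT_comp (measurable_powR _)); exact: measurable_arc.
  by apply/funext => u; rewrite /rpot /radial (negbTE d0).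
rewrite (_ : rpot 0 = fun u => ln (pi * arc u `^ (-1))).
  apply: measurableT_comp; first exact: measurable_ln.
  apply: measurable_funM => //.
  apply: (measurableT_comp (measurable_powR _)); exact: measurable_arc.
by apply/funext => u; rewrite /rpot /radial eqxx powR_inv1// arc_ge0.
Qed.

End potentials.

Section energies.
Context {R : realType} (d : nat).
Hypothesis d0 : (0 < d)%N.
Local Notation mu := (@lebesgue_measure R).
Local Notation sigma := (@surface_measure R d).
Local Notation S := (@sphere R d).

(** The point [x] is the intersection of the caps around it. *)
Lemma surface_measure_point (x : d.+1.-tuple R) : S x ->
  sigma [set y | arc (dotp x y) <= 0] = 0%E.
Proof.
move=> Sx; have [C C0 capC] := @surface_measure_cap R d.
apply/eqP; rewrite eq_le measure_ge0 andbT.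
have le_e (e : R) : 0 < e -> (sigma [set y | (arc (dotp x y) <= 0)%R] <= (C * e ^+ d)%:E)%E.
  move=> e0; apply: le_trans (capC x e Sx e0); apply: le_measure; rewrite ?inE.
  - exact: (measurable_le_set _ (measurable_arc_dotp _)).
  - exact: measurable_cap.
  - by move=> y /= /le_lt_trans; apply.
apply/lee_addgt0Pr => e e0; rewrite add0e.
pose r := Num.min 1 (e / C).
have r0 : 0 < r by rewrite lt_min ltr01 divr_gt0.
have r1 : r <= 1 by rewrite /r ge_min lexx.
apply: le_trans (le_e r r0) _; rewrite lee_fin.
have rd : r ^+ d <= r by rewrite -(prednK d0) exprS ler_piMr ?exprn_ile1 ?(ltW r0).
have : C * r <= e by rewrite mulrC -ler_pdivlMr// /r ge_min lexx orbT.
by have := ler_wpM2l (ltW C0) rd; lra.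
Qed.

Lemma dotp_sphere_eq1 (x y : d.+1.-tuple R) : S x -> S y -> dotp x y = 1 -> x = y.
Proof.
move=> /sphereP x1 /sphereP y1 xy.
have : dotp (addt x (oppt y)) (addt x (oppt y)) = 0 by rewrite dotpBB x1 y1 xy; lra.
move/dotp_eq0 => h; apply: eq_from_tnth => i.
by have := h i; rewrite !tnth_mktuple => /eqP; rewrite subr_eq0 => /eqP.
Qed.

Lemma arc_gt0 (x y : d.+1.-tuple R) : S x -> S y -> x <> y -> 0 < arc (dotp x y).
Proof.
move=> Sx Sy xy; have /andP[h1 h2] := dotp_sphere Sx Sy.
rewrite arcE ?h1//; apply: acos_gt0; rewrite h1/= lt_neqAle h2 andbT.
by apply/eqP => /(dotp_sphere_eq1 Sx Sy).
Qed.

Local Open Scope ereal_scope.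

Definition mean_potential delta : \bar R :=
  \int[sigma]_y (rpot delta (dotp (pole d) y))%:E.

Lemma mean_potentialE delta x : S x ->
  \int[sigma]_y (rpot delta (dotp x y))%:E = mean_potential delta.
Proof. by move=> Sx; apply: integral_sphere_pole => //; exact: measurable_rpot. Qed.

Lemma measurable_rpot_dotp delta (x : d.+1.-tuple R) :
  measurable_fun setT (fun y => (rpot delta (dotp x y))%:E : \bar R).
Proof. by apply/measurable_EFinP; apply: measurable_comp_dotp; exact: measurable_rpot. Qed.

Lemma energy_integralE delta : energy_integral d delta = mean_potential delta.
Proof.
rewrite /energy_integral.
transitivity (\int[sigma]_(x in S) (cst (mean_potential delta) x)).
  apply: eq_integral => x /[!inE] Sx /=; rewrite -(mean_potentialE delta Sx).
  have -> := ge0_negligible_integral (measurableC (@measurable_sphere R d)) measurableT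
    (measurable_rpot_dotp delta x) (fun y _ => rpot_ge0 delta (dotp x y))
    (@surface_measure_sphereC R d).
  rewrite setTD setCK; apply: eq_integral => y /[!inE] Sy.
  by rewrite rpotE// dotp_sphere.
rewrite integral_cst; last exact: measurable_sphere.
by have := @surface_measure_sphere R d; move=> /= ->; rewrite mule1.
Qed.

(** The mixture formula holds off [rho = 0], which is a null set. *)
Lemma mean_potential_mixture (w : R -> R -> R) (c delta : R) :
  measurable_fun setT (fun p : R * R => w p.1 p.2) ->
  (forall tau rho, 0 <= rho <= pi -> 0 <= w tau rho)%R ->
  (forall rho, (0 < rho <= pi)%R ->
    \int[mu]_tau (w tau rho)%:E = (c * radial delta rho)%:E) ->
  (0 <= c)%R ->
  c%:E * mean_potential delta =
  \int[mu]_tau \int[sigma]_y (w tau (arc (dotp (pole d) y)))%:E.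
Proof.
move=> mw w0 wE c0.
have SP := @sphere_pole R d.
pose r (y : d.+1.-tuple R) := arc (dotp (pole d) y).
have r01 y : (0 <= r y <= pi)%R by rewrite /r arc_ge0 arc_lepi.
have mr : measurable_fun setT r by exact: measurable_arc_dotp.
have mwr : measurable_fun setT (fun p : R * d.+1.-tuple R => (w p.1 (r p.2))%:E).
  apply/measurable_EFinP; apply: (measurableT_comp mw (g := fun p : R * d.+1.-tuple R => (p.1, r p.2))).
  apply/measurable_fun_pairP; split; first exact: measurable_fst.
  by apply: measurableT_comp mr _; exact: measurable_snd.
have F := @fubini_tonelli _ _ _ _ R mu sigma (fun p => (w p.1 (r p.2))%:E) mwr
  (fun p => w0 p.1 _ (r01 p.2)).
rewrite [RHS]F /= -ge0_integralZl//; last 2 first.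
- exact: measurable_rpot_dotp.
- by move=> y _; rewrite lee_fin rpot_ge0.
have mN : measurable [set y | (r y <= 0)%R] by exact: measurable_le_set.
have N0 := surface_measure_point SP.
rewrite (ge0_negligible_integral mN _ _ _ N0)//; last 2 first.
- by apply: measurable_funeM; exact: measurable_rpot_dotp.
- by move=> y _; rewrite mule_ge0 ?lee_fin ?rpot_ge0.
rewrite [RHS](ge0_negligible_integral mN _ _ _ N0)//; last 2 first.
- have := @measurable_fun_fubini_tonelli_G _ _ _ _ R mu (fun p => (w p.1 (r p.2))%:E) mwr (fun p => w0 p.1 _ (r01 p.2)).
  by rewrite /fubini_G.
- by move=> y _; apply: integral_ge0 => tau _; rewrite lee_fin w0.
apply: eq_integral => y; rewrite inE /= => -[_ /negP]; rewrite -ltNge => ry.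
by rewrite wE ?ry//=; case/andP: (r01 y).
Qed.

End energies.

(** * Bounds for every configuration *)

Section pair_sums.
Context {R : realType}.

Definition pairs N : seq ('I_N * 'I_N) :=
  [seq p : 'I_N * 'I_N <- index_enum ('I_N * 'I_N)%type | (p.1 < p.2)%N].

Lemma sum_pairsE N (g : 'I_N -> 'I_N -> R) :
  \sum_(i < N) \sum_(j < N | (i < j)%N) g i j = \sum_(p <- pairs N) g p.1 p.2.
Proof. by rewrite pair_big_dep/= /pairs big_filter. Qed.

Lemma sum_symmetric N (g : 'I_N -> 'I_N -> R) : (forall i j, g i j = g j i) ->
  \sum_(i < N) \sum_(j < N) g i j =
  \sum_(i < N) g i i + 2 * \sum_(p <- pairs N) g p.1 p.2.
Proof.
move=> gC; rewrite -sum_pairsE.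
have E i : \sum_(j < N) g i j = \sum_(j < N | (j < i)%N) g i j + g i i +
    \sum_(j < N | (i < j)%N) g i j.
  rewrite (bigD1 i)//= (bigID (fun j : 'I_N => (j < i)%N))/=.
  rewrite addrCA addrA; congr (_ + _ + _); apply: eq_bigl => j.
    by case: eqVneq => [->|]; rewrite ?ltnn ?andbT.
  by rewrite -leqNgt ltn_neqAle; congr (_ && _); rewrite eq_sym.
under eq_bigr do rewrite E.
rewrite !big_split/=.
have -> : \sum_(i < N) \sum_(j < N | (j < i)%N) g i j =
    \sum_(i < N) \sum_(j < N | (i < j)%N) g i j.
  rewrite (exchange_big_dep xpredT)//=; apply: eq_bigr => i _.
  by apply: eq_bigr => j _; exact: gC.
lra.
Qed.

Lemma card_pairs N : N%:R ^+ 2 = N%:R + 2 * \sum_(p <- pairs N) 1 :> R.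
Proof.
have := @sum_symmetric N (fun _ _ => 1) (fun _ _ => erefl).
by rewrite !sumr_const card_ord -natrX -[(1 *+ N) *+ N]mulr_natr; move=> <-; rewrite natrX expr2.
Qed.

End pair_sums.

Section universal_bounds.
Context {R : realType} (d : nat).
Hypothesis d0 : (0 < d)%N.
Local Notation mu := (@lebesgue_measure R).
Local Notation sigma := (@surface_measure R d).
Local Notation S := (@sphere R d).

Lemma discrete_energyE delta N (z : 'I_N -> d.+1.-tuple R) : (forall i, S (z i)) ->
  discrete_energy delta z = \sum_(p <- pairs N) rpot delta (dotp (z p.1) (z p.2)).
Proof.
move=> Sz; rewrite /discrete_energy sum_pairsE; apply: eq_bigr => p _.
by rewrite rpotE// dotp_sphere.
Qed.

(** Each of the [N] diagonal terms is [exp 0 = 1]. *)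
Lemma decay_energy_pairs N (z : 'I_N -> d.+1.-tuple R) (t : R) : 0 <= t ->
  (0 < N)%N -> (forall i, S (z i)) ->
  zonal d (decay t) <= 2 / N%:R ^+ 2 *
    (\sum_(p <- pairs N) decay t (dotp (z p.1) (z p.2))) + N%:R^-1.
Proof.
move=> t0 N0 Sz; have N1 : 0 < N%:R :> R by rewrite ltr0n.
have := decay_energy t0 Sz.
rewrite sum_symmetric; last by move=> i j; rewrite dotpC.
have -> : \sum_(i < N) decay t (dotp (z i) (z i)) = N%:R.
  under eq_bigr => i _.
    rewrite ((sphereP (z i)).1 (Sz i)) /decay arc1 mulr0 expR0. over.
  by rewrite sumr_const card_ord.
rewrite mulrC -ler_pdivlMr ?exprn_gt0// => /le_trans; apply.
rewrite mulrDl expr2 invfM mulrA divff ?gt_eqF// mul1r.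
by set s := \sum_(_ <- _) _; rewrite le_eqVlt; apply/orP; left; apply/eqP; lra.
Qed.

(** Inequalities between the discrete and the continuous energies of the kernels
    [w tau], with errors [b tau], integrate to an inequality for the potential. *)
Section mixture.
Variables (w : R -> R -> R) (c delta : R) (b : R -> R).
Variables (N : nat) (z : 'I_N -> d.+1.-tuple R).
Hypothesis mw : measurable_fun setT (fun p : R * R => w p.1 p.2).
Hypothesis w0 : forall tau rho, 0 <= rho <= pi -> 0 <= w tau rho.
Hypothesis wE : forall rho, 0 < rho <= pi ->
  (\int[mu]_tau (w tau rho)%:E = (c * radial delta rho)%:E)%E.
Hypothesis c0 : 0 < c.
Hypothesis bw : forall tau, bounded_measurable (fun u => w tau (arc u)).
Hypothesis mb : measurable_fun setT b.
Hypothesis b0 : forall tau, 0 <= b tau.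
Hypothesis zconf : configuration d N z.

Let P tau := \sum_(p <- pairs N) w tau (arc (dotp (z p.1) (z p.2))).

Let mwr rho : measurable_fun setT (w ^~ rho).
Proof.
apply: (measurableT_comp mw (g := fun tau => (tau, rho))).
by apply/measurable_fun_pairP; split => /=; [exact: measurable_id|exact: measurable_cst].
Qed.

Let mP : measurable_fun setT P.
Proof. by apply: measurable_sum => p; exact: mwr. Qed.

Let P0 tau : 0 <= P tau.
Proof. by apply: sumr_ge0 => p _; rewrite w0// arc_ge0 arc_lepi. Qed.

Let integral_P : (\int[mu]_tau (P tau)%:E = (c * discrete_energy delta z)%:E)%E.
Proof.
have [zinj Sz] := zconf.
under eq_integral do rewrite -sumEFin.
rewrite ge0_integral_sum//; last 2 first.
- by move=> p; apply/measurable_EFinP; exact: mwr.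
- by move=> p tau _; rewrite lee_fin w0// arc_ge0 arc_lepi.
rewrite discrete_energyE// mulr_sumr -sumEFin.
rewrite /pairs !big_filter; apply: eq_bigr => p pp.
rewrite wE// arc_lepi andbT; apply: arc_gt0 => // /zinj zz.
by move: pp; rewrite zz ltnn.
Qed.

Let integral_rhs : (\int[mu]_tau ((2 / N%:R ^+ 2 * P tau + b tau)%:E) =
  (c * (2 / N%:R ^+ 2 * discrete_energy delta z))%:E + \int[mu]_tau (b tau)%:E)%E.
Proof.
have N2 : 0 <= 2 / N%:R ^+ 2 :> R by rewrite divr_ge0// exprn_ge0.
under eq_integral do rewrite EFinD EFinM.
rewrite ge0_integralD//; last 4 first.
- by move=> tau _; rewrite -EFinM lee_fin mulr_ge0.
- by apply: measurable_funeM; exact/measurable_EFinP.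
- by move=> tau _; rewrite lee_fin.
- exact/measurable_EFinP.
rewrite ge0_integralZl ?lee_fin//; last 2 first.
- exact/measurable_EFinP.
- by move=> tau _; rewrite lee_fin.
by rewrite integral_P -EFinM mulrCA.
Qed.

Let mlhs : measurable_fun setT (fun tau => zonal d (fun u => w tau (arc u))).
Proof.
apply/measurable_EFinP.
pose r (y : d.+1.-tuple R) := arc (dotp (pole d) y).
have mr : measurable_fun setT r by exact: measurable_arc_dotp.
have mwrr : measurable_fun setT (fun p : R * d.+1.-tuple R => (w p.1 (r p.2))%:E).
  apply/measurable_EFinP; apply: (measurableT_comp mw (g := fun p : R * d.+1.-tuple R => (p.1, r p.2))).
  apply/measurable_fun_pairP; split; first exact: measurable_fst.
  by apply: measurableT_comp mr _; exact: measurable_snd.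
have r01 y : 0 <= r y <= pi by rewrite /r arc_ge0 arc_lepi.
have := @measurable_fun_fubini_tonelli_F _ _ _ _ R sigma (fun p => (w p.1 (r p.2))%:E) mwrr
  (fun p => w0 p.1 (r01 p.2)).
rewrite /fubini_F (_ : (fun x => _) = EFin \o (fun tau => zonal d (fun u => w tau (arc u))))//.
by apply/funext => tau /=; rewrite -(zonalE (bw tau) (sphere_pole d)).
Qed.

Let integral_lhs : (\int[mu]_tau (zonal d (fun u => w tau (arc u)))%:E =
  c%:E * mean_potential d delta)%E.
Proof.
rewrite (mean_potential_mixture d0 mw w0 wE (ltW c0)); apply: eq_integral => tau _.
by rewrite -(zonalE (bw tau) (sphere_pole d)).
Qed.

Let mean_potentialV : (mean_potential d delta =
  (c^-1)%:E * (c%:E * mean_potential d delta))%E.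
Proof. by rewrite muleA -EFinM mulVf ?gt_eqF// mul1e. Qed.

Let scaleV (x B : R) : c^-1 * (c * x + B) = x + B / c.
Proof. by rewrite mulrDr mulrA mulVf ?gt_eqF// mul1r [B / c]mulrC. Qed.

Lemma mixture_upper (B : R) :
  (forall tau, zonal d (fun u => w tau (arc u)) <= 2 / N%:R ^+ 2 * P tau + b tau) ->
  (\int[mu]_tau (b tau)%:E <= B%:E)%E ->
  (mean_potential d delta <= (2 / N%:R ^+ 2 * discrete_energy delta z + B / c)%:E)%E.
Proof.
move=> h bB; rewrite mean_potentialV -scaleV [leRHS]EFinM.
rewrite lee_wpmul2l ?lee_fin ?invr_ge0 ?(ltW c0)// EFinD.
apply: le_trans (leeD2l _ bB); rewrite -integral_lhs -integral_rhs.
apply: le_integral_EFin => // [|tau]; first by apply: measurable_funD => //; exact: measurable_funM.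
by apply: zonal_ge0 => u; rewrite w0// arc_ge0 arc_lepi.
Qed.

Lemma mixture_lower (B : R) :
  (forall tau, 2 / N%:R ^+ 2 * P tau + b tau <= zonal d (fun u => w tau (arc u))) ->
  (B%:E <= \int[mu]_tau (b tau)%:E)%E ->
  ((2 / N%:R ^+ 2 * discrete_energy delta z + B / c)%:E <= mean_potential d delta)%E.
Proof.
move=> h bB; rewrite mean_potentialV -scaleV [leLHS]EFinM.
rewrite lee_wpmul2l ?lee_fin ?invr_ge0 ?(ltW c0)// EFinD.
apply: le_trans (leeD2l _ bB) _; rewrite -integral_lhs -integral_rhs.
apply: le_integral_EFin => // [|tau]; first by apply: measurable_funD => //; exact: measurable_funM.
by rewrite addr_ge0// mulr_ge0// divr_ge0// exprn_ge0.
Qed.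

End mixture.
End universal_bounds.

Section energy_bounds.
Context {R : realType} (d : nat).
Hypothesis d0 : (0 < d)%N.
Local Notation mu := (@lebesgue_measure R).

Lemma measurable_exp_prod : measurable_fun setT (fun p : R * R => expR (- (expR p.1 * p.2))).
Proof.
apply: measurableT_comp => //; apply: measurable_funN; apply: measurable_funM; last exact: measurable_snd.
by apply: measurableT_comp; [exact: measurable_expR|exact: measurable_fst].
Qed.

Lemma measurable_exp_fst (s : R) : measurable_fun setT (fun p : R * R => expR (- (s * p.1))).
Proof.
apply: measurableT_comp => //; apply: measurable_funN; apply: measurable_funM => //.
Qed.

Lemma exp_decayE (tau u : R) : expR (- (expR tau * arc u)) = decay (expR tau) u.
Proof. by rewrite /decay mulNr. Qed.

Lemma measurable_cap_bound (C : R) :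
  measurable_fun setT (fun tau : R => C / expR tau ^+ d).
Proof.
rewrite (_ : (fun _ => _) = fun tau : R => C * expR (- (d%:R * tau))).
  apply: measurable_funM => //; apply: measurableT_comp => //.
  by apply: measurable_funN; exact: measurable_funM.
by apply/funext => tau; rewrite -expRM_natl -expRN.
Qed.

Lemma exp_abs_fin (k : R) : 0 < k -> exists2 A : R, 0 <= A &
  (\int[mu]_tau (expR (- (k * `|tau|)))%:E = A%:E)%E.
Proof.
move=> k0; have ge : (0 <= \int[mu]_tau (expR (- (k * `|tau|)))%:E)%E.
  by apply: integral_ge0 => x _; rewrite lee_fin expR_ge0.
exists (fine (\int[mu]_tau (expR (- (k * `|tau|)))%:E)%E); first exact: fine_ge0.
by rewrite fineK// ge0_fin_numE// exp_abs_integral_lty.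
Qed.

Lemma measurable_exp_abs (k : R) :
  measurable_fun setT (fun x : R => expR (- (k * `|x|))).
Proof.
apply: measurableT_comp => //; apply: measurable_funN; apply: measurable_funM => //.
Qed.

(** The terms [1 / N] and [C * exp (- d * tau)] are of the same size at
    [tau = ln N / d]; translating to that point extracts the power of [N]. *)
Lemma min_mass_integral (C s : R) (N : nat) : 0 < C -> (0 < N)%N -> 0 < s < d%:R ->
  (\int[mu]_tau (Num.min N%:R^-1 (C / expR tau ^+ d) * expR (s * tau))%:E <=
   (N%:R `^ (s / d%:R - 1) * (1 + C))%:E *
   \int[mu]_tau (expR (- (Num.min s (d%:R - s) * `|tau|)))%:E)%E.
Proof.
move=> C0 N0 /andP[s0 sd].
have dR : 0 < d%:R :> R by rewrite ltr0n.
have NR : 0 < N%:R :> R by rewrite ltr0n.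
pose L : R := ln N%:R / d%:R.
set m := Num.min s _.
have ms : m <= s by rewrite /m ge_min lexx.
have mds : m <= d%:R - s by rewrite /m ge_min lexx orbT.
pose B tau : R := Num.min N%:R^-1 (C / expR tau ^+ d) * expR (s * tau).
have mB : measurable_fun setT B.
  apply: measurable_funM; last first.
    by apply: measurableT_comp => //; exact: measurable_funM.
  by apply: measurable_minr => //; exact: measurable_cap_bound.
have B0 tau : 0 <= B tau.
  by rewrite mulr_ge0 ?expR_ge0// le_min invr_ge0 ler0n/= divr_ge0 ?exprn_ge0 ?expR_ge0 ?ltW.
have mE : measurable_fun setT (fun x : R => (expR (- (m * `|x|)))%:E : \bar R).
  apply/measurable_EFinP; apply: measurableT_comp => //.
  by apply: measurable_funN; apply: measurable_funM => //; exact: normr_measurable.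
have N1 : 0 <= N%:R `^ (s / d%:R - 1) * (1 + C).
  by rewrite mulr_ge0 ?powR_ge0// addr_ge0// ltW.
rewrite -(@ge0_integral_translate _ L (fun tau => (B tau)%:E))//; last exact/measurable_EFinP.
rewrite -ge0_integralZl//.
apply: ge0_le_integral => //.
- by move=> x _; rewrite lee_fin.
- apply/measurable_EFinP; apply: measurableT_comp mB _; exact: measurable_funD.
- exact: measurable_funeM.
move=> x _; rewrite -EFinM lee_fin.
have eL : expR L ^+ d = N%:R.
  by rewrite -expRM_natl /L mulrCA divff ?gt_eqF// mulr1 lnK.
have Np : N%:R `^ (s / d%:R - 1) = N%:R^-1 * expR (s * L).
  rewrite /powR gt_eqF// -[N%:R^-1]lnK ?posrE ?invr_gt0// lnV ?posrE// -expRD.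
  by congr expR; rewrite /L; lra.
have -> : B (x + L) = N%:R^-1 * expR (s * L) * (Num.min 1 (C / expR x ^+ d) * expR (s * x)).
  rewrite /B expRD exprMn eL mulrDr expRD.
  have -> : C / (expR x ^+ d * N%:R) = N%:R^-1 * (C / expR x ^+ d).
    by rewrite invfM; lra.
  have -> : Num.min N%:R^-1 (N%:R^-1 * (C / expR x ^+ d)) = N%:R^-1 * Num.min 1 (C / expR x ^+ d).
    by rewrite minr_pMr ?mulr1// invr_ge0 ltW.
  by lra.
rewrite Np -!mulrA ler_wpM2l ?invr_ge0 ?(ltW NR)// ler_wpM2l ?expR_ge0//.
have [x0|x0] := leP 0 x.
  apply: (@le_trans _ _ (C / expR x ^+ d * expR (s * x))).
    by rewrite ler_wpM2r ?expR_ge0// ge_min lexx orbT.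
  rewrite -expRM_natl -expRN -mulrA -expRD ler_pM ?expR_ge0 ?(ltW C0)//; first lra.
  by rewrite ler_expR (ger0_norm x0); nra.
apply: (@le_trans _ _ (1 * expR (s * x))).
  by rewrite ler_wpM2r ?expR_ge0// ge_min lexx.
rewrite ler_pM ?expR_ge0//; first lra.
by rewrite ler_expR (ltr0_norm x0); nra.
Qed.

(** The mean of the kernel [exp (- t rho)] exceeds its normalized discrete energy
    by at most [1 / N], by positive definiteness, and by at most the mean itself,
    that is [C t ^ (- d)]. *)
Lemma energy_ge_neg (delta : R) : - d%:R < delta -> delta < 0 ->
  exists2 K : R, 0 < K & forall N (z : 'I_N -> d.+1.-tuple R), (0 < N)%N ->
  configuration d N z ->
  (mean_potential d delta <= (2 / N%:R ^+ 2 * discrete_energy delta z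
    + K * N%:R `^ (- 1 - delta / d%:R))%:E)%E.
Proof.
move=> dd de0.
have [c c0 cE] := mixture_neg de0.
have [C C0 hC] := @zonal_decay_le R d.
have dR : 0 < d%:R :> R by rewrite ltr0n.
pose m := Num.min (- delta) (d%:R - - delta).
have m0 : 0 < m by rewrite lt_min; apply/andP; split; lra.
have [A A0 AE] := exp_abs_fin m0.
exists ((1 + C) * (A + 1) / c); first by rewrite divr_gt0// mulr_gt0; lra.
move=> N z N0 zc; have [_ Sz] := zc.
have NR : 0 < N%:R :> R by rewrite ltr0n.
pose w (tau rho : R) := expR (- (expR tau * rho)) * expR (- (delta * tau)).
pose b (tau : R) := Num.min N%:R^-1 (C / expR tau ^+ d) * expR (- delta * tau).
have mw : measurable_fun setT (fun p : R * R => w p.1 p.2).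
  by apply: measurable_funM; [exact: measurable_exp_prod|exact: measurable_exp_fst].
have w0 tau rho : 0 <= rho <= pi -> 0 <= w tau rho by rewrite mulr_ge0 ?expR_ge0.
have wE rho : 0 < rho <= pi -> (\int[mu]_tau (w tau rho)%:E = (c * radial delta rho)%:E)%E.
  by move=> /andP[r0 _]; rewrite cE// /radial lt_eqF.
have wdec tau : (fun u => w tau (arc u)) = (fun u => expR (- (delta * tau)) * decay (expR tau) u).
  by apply/funext => u; rewrite /w exp_decayE mulrC.
have bw tau : bounded_measurable (fun u => w tau (arc u)).
  by rewrite wdec; apply/bounded_measurableZ/bounded_measurable_decay; exact: expR_ge0.
have mb : measurable_fun setT b.
  apply: measurable_funM; last first.
    by apply: measurableT_comp => //; exact: measurable_funM.
  by apply: measurable_minr => //; exact: measurable_cap_bound.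
have b0 tau : 0 <= b tau.
  by rewrite mulr_ge0 ?expR_ge0// le_min invr_ge0 ler0n/= divr_ge0 ?exprn_ge0 ?expR_ge0 ?ltW.
have pw tau : zonal d (fun u => w tau (arc u)) <=
    2 / N%:R ^+ 2 * (\sum_(p <- pairs N) w tau (arc (dotp (z p.1) (z p.2)))) + b tau.
  rewrite wdec zonalZ; last by apply: bounded_measurable_decay; exact: expR_ge0.
  have -> : \sum_(p <- pairs N) w tau (arc (dotp (z p.1) (z p.2))) =
      expR (- (delta * tau)) * \sum_(p <- pairs N) decay (expR tau) (dotp (z p.1) (z p.2)).
    by rewrite mulr_sumr; apply: eq_bigr => p _; rewrite /w exp_decayE mulrC.
  rewrite /b mulNr mulrCA [Num.min _ _ * _]mulrC -mulrDr ler_wpM2l ?expR_ge0//.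
  rewrite addr_minr le_min; apply/andP; split.
    exact: decay_energy_pairs (expR_ge0 _) N0 Sz.
  apply: le_trans (hC _ (expR_gt0 tau)) _; rewrite lerDr; apply: mulr_ge0.
    by rewrite divr_ge0 ?exprn_ge0.
  by apply: sumr_ge0 => p _; exact: expR_ge0.
have sd : 0 < - delta < d%:R by apply/andP; split; lra.
have int_b := min_mass_integral C0 N0 sd.
rewrite -/m AE -EFinM in int_b.
apply: le_trans (mixture_upper d0 mw w0 wE c0 bw mb b0 zc pw int_b) _.
rewrite lee_fin lerD2l.
have -> : - delta / d%:R - 1 = - 1 - delta / d%:R by lra.
set X := N%:R `^ _; have X0 : 0 <= X by exact: powR_ge0.
have XC0 : 0 <= X * (1 + C) / c by rewrite mulr_ge0 ?invr_ge0 ?(ltW c0)// mulr_ge0// addr_ge0 ?(ltW C0).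
move: c^-1 XC0 => ci XC0; have : X * (1 + C) * ci * A <= X * (1 + C) * ci * (A + 1).
  by rewrite ler_wpM2l//; lra.
lra.
Qed.

Lemma integral_shift (f : R -> R) (v : R) : measurable_fun setT f ->
  (forall x, 0 <= f x) ->
  (\int[mu]_x (f (x + v)%R)%:E = \int[mu]_x (f x)%:E)%E.
Proof.
move=> mf f0; apply: (@ge0_integral_translate _ v (fun x => (f x)%:E)).
  exact/measurable_EFinP.
by move=> x; rewrite lee_fin.
Qed.

(** With [L = ln N / d], the integrand is at most [pi * exp tau / N] for
    [tau < 0], at most [1 / N] on [[0, L]], where the logarithm comes from, and
    exponentially small beyond [L]. *)
Lemma min_mass_integral_log (C : R) (N : nat) : 0 < C -> (0 < N)%N ->
  (\int[mu]_tau (Num.min (N%:R^-1 * (1 - expR (- (expR tau * pi)))) (C / expR tau ^+ d))%:E <=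
   (N%:R^-1)%:E * (pi%:E * \int[mu]_tau (expR (- (1 * `|tau|)))%:E + (ln N%:R / d%:R)%:E
     + C%:E * \int[mu]_tau (expR (- (d%:R * `|tau|)))%:E))%E.
Proof.
move=> C0 N0.
have dR : 0 < d%:R :> R by rewrite ltr0n.
have NR : 0 < N%:R :> R by rewrite ltr0n.
have NI : 0 <= N%:R^-1 :> R by rewrite invr_ge0 ltW.
pose L : R := ln N%:R / d%:R.
have L0 : 0 <= L by rewrite divr_ge0 ?(ltW dR)// ln_ge0// ler1n.
pose f1 (tau : R) : R := pi * expR (- (1 * `|tau|)).
pose f2 (tau : R) : R := \1_(`[0, L]%classic) tau.
pose f3 (tau : R) : R := C * expR (- (d%:R * `|tau - L|)).
have mf1 : measurable_fun setT f1 by apply: measurable_funM => //; exact: measurable_exp_abs.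
have mf2 : measurable_fun setT f2 by exact: measurable_indic.
have mf3 : measurable_fun setT f3.
  apply: measurable_funM => //; apply: (measurableT_comp (measurable_exp_abs d%:R)).
  exact: measurable_funB.
have f10 tau : 0 <= f1 tau by rewrite mulr_ge0 ?expR_ge0// pi_ge0.
have f20 tau : 0 <= f2 tau by rewrite /f2 indicE.
have f30 tau : 0 <= f3 tau by rewrite mulr_ge0 ?expR_ge0// ltW.
have I1 : (\int[mu]_tau (f1 tau)%:E = pi%:E * \int[mu]_tau (expR (- (1 * `|tau|)))%:E)%E.
  by apply: integral_EFinZ; rewrite ?pi_ge0//; exact: measurable_exp_abs.
have I2 : (\int[mu]_tau (f2 tau)%:E = L%:E)%E.
  rewrite integral_indic// setIT /= lebesgue_measure_itv/= lte_fin.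
  case: ltP => [_|L1]; first by rewrite sube0.
  by congr EFin; apply/eqP; rewrite eq_le L0 L1.
have I3 : (\int[mu]_tau (f3 tau)%:E = C%:E * \int[mu]_tau (expR (- (d%:R * `|tau|)))%:E)%E.
  rewrite -(integral_shift (- L) (measurable_exp_abs d%:R) (fun x => expR_ge0 _)).
  apply: (@integral_EFinZ _ _ _ mu (fun tau => expR (- (d%:R * `|tau - L|))) C); rewrite ?(ltW C0)//.
  apply: (measurableT_comp (measurable_exp_abs d%:R)).
  exact: measurable_funD.
have mf12 : measurable_fun setT (fun tau => f1 tau + f2 tau) by exact: measurable_funD.
have mf123 : measurable_fun setT (fun tau => f1 tau + f2 tau + f3 tau) by exact: measurable_funD.
rewrite -I1 -I3 -I2 -integral_EFinD// -integral_EFinD//; last by move=> x; rewrite addr_ge0.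
rewrite -integral_EFinZ//; last by move=> x; rewrite !addr_ge0.
have m01 (tau : R) : 0 <= N%:R^-1 * (1 - expR (- (expR tau * pi))).
  by rewrite mulr_ge0// subr_ge0 -expR0 ler_expR oppr_le0 mulr_ge0 ?expR_ge0 ?pi_ge0.
apply: le_integral_EFin.
- apply: measurable_minr; last exact: measurable_cap_bound.
  apply: measurable_funM => //; apply: measurable_funB => //; apply: measurableT_comp => //.
  by apply: measurable_funN; apply: measurable_funM => //; exact: measurable_expR.
- exact: measurable_funM.
- move=> tau; rewrite le_min m01/=.
  by rewrite divr_ge0 ?exprn_ge0 ?expR_ge0 ?ltW.
move=> x.
have [x0|x0] := ltP x 0.
  apply: (@le_trans _ _ (N%:R^-1 * f1 x)); last by rewrite ler_wpM2l// -addrA lerDl addr_ge0.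
  rewrite ge_min; apply/orP; left; rewrite ler_wpM2l// /f1 (ltr0_norm x0) mul1r opprK.
  by have := expR_ge1Dx (- (expR x * pi)); lra.
have [xL|xL] := leP x L.
  apply: (@le_trans _ _ (N%:R^-1 * f2 x)); last by rewrite ler_wpM2l// addrAC lerDr addr_ge0.
  rewrite ge_min; apply/orP; left; rewrite ler_wpM2l// /f2 indicE mem_set/=.
    by have := expR_ge0 (- (expR x * pi)); lra.
  by rewrite in_itv/= x0 xL.
apply: (@le_trans _ _ (N%:R^-1 * f3 x)); last by rewrite ler_wpM2l// lerDr addr_ge0.
rewrite ge_min; apply/orP; right; rewrite /f3 gtr0_norm ?subr_gt0//.
have -> : N%:R^-1 = expR (- (d%:R * L)).
  by rewrite /L mulrCA divff ?gt_eqF// mulr1 expRN lnK.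
by rewrite mulrCA -expRD -expRM_natl -expRN ler_wpM2l ?(ltW C0)// ler_expR; lra.
Qed.

Lemma decay_cst_pairs N : (0 < N)%N ->
  2 / N%:R ^+ 2 * (\sum_(p <- pairs N) 1) = 1 - N%:R^-1 :> R.
Proof.
move=> N0; have NR : N%:R != 0 :> R by rewrite pnatr_eq0 -lt0n.
have E : 2 * (\sum_(p <- pairs N) 1) = N%:R ^+ 2 - N%:R :> R.
  by have := @card_pairs R N; lra.
rewrite mulrAC E mulrBl divff ?expf_neq0//; congr (_ - _).
by rewrite expr2 invfM mulrA divff// mul1r.
Qed.

(** The kernel is now [exp (- t rho) - q] with [q = exp (- t pi)]; its diagonal value
    [1 - q] makes the integral converge as [t] tends to 0. *)
Lemma energy_ge_zero : exists2 K : R, 0 < K &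
  forall N (z : 'I_N -> d.+1.-tuple R), (0 < N)%N -> configuration d N z ->
  (mean_potential d (0 : R) <= (2 / N%:R ^+ 2 * discrete_energy 0 z
    + K * (N%:R^-1 * (1 + ln N%:R)))%:E)%E.
Proof.
have [c c0 cE] := @mixture_zero R.
have [C C0 hC] := @zonal_decay_le R d.
have dR : 0 < d%:R :> R by rewrite ltr0n.
have d1 : 1 <= d%:R :> R by rewrite ler1n.
have [A1 A10 A1E] := exp_abs_fin ltr01.
have [A2 A20 A2E] := exp_abs_fin dR.
have pi0 := @pi_gt0 R.
have piA : 0 <= pi * A1 by rewrite mulr_ge0// ltW.
have CA : 0 <= C * A2 by rewrite mulr_ge0// ltW.
exists ((pi * A1 + 1 + C * A2) / c); first by rewrite divr_gt0//; lra.
move=> N z N0 zc; have [_ Sz] := zc.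
have NR : 0 < N%:R :> R by rewrite ltr0n.
have NI : 0 <= N%:R^-1 :> R by rewrite invr_ge0 ltW.
pose w (tau rho : R) : R := `|expR (- (expR tau * rho)) - expR (- (expR tau * pi))|.
have wrho tau rho : 0 <= rho <= pi -> w tau rho = expR (- (expR tau * rho)) - expR (- (expR tau * pi)).
  move=> /andP[_ rpi]; rewrite /w ger0_norm// subr_ge0 ler_expR lerN2.
  by rewrite ler_wpM2l// expR_ge0.
pose b (tau : R) := Num.min (N%:R^-1 * (1 - expR (- (expR tau * pi)))) (C / expR tau ^+ d).
have mexpi : measurable_fun setT (fun tau : R => expR (- (expR tau * pi))).
  apply: measurableT_comp => //.
  by apply: measurable_funN; apply: measurable_funM => //; exact: measurable_expR.
have mw : measurable_fun setT (fun p : R * R => w p.1 p.2).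
  apply: measurableT_comp; first exact: normr_measurable.
  apply: measurable_funB; first exact: measurable_exp_prod.
  by apply: (measurableT_comp mexpi); exact: measurable_fst.
have w0 tau rho : 0 <= rho <= pi -> 0 <= w tau rho by rewrite /w normr_ge0.
have wE rho : 0 < rho <= pi -> (\int[mu]_tau (w tau rho)%:E = (c * radial 0 rho)%:E)%E.
  move=> /andP[r0 rpi]; rewrite /radial eqxx -cE ?r0//.
  by apply: eq_integral => tau _; rewrite wrho// (ltW r0).
have arcpi u : 0 <= arc u <= (pi : R) by rewrite arc_ge0 arc_lepi.
have wdec tau : (fun u => w tau (arc u)) =
    (fun u => decay (expR tau) u + cst (- expR (- (expR tau * pi))) u).
  by apply/funext => u; rewrite wrho// exp_decayE.
have bdec tau := @bounded_measurable_decay R (expR tau) (expR_ge0 tau).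
have bcst tau := @bounded_measurable_cst R (- expR (- (expR tau * pi))).
have bw tau : bounded_measurable (fun u => w tau (arc u)).
  by rewrite wdec; exact: bounded_measurableD.
have mb : measurable_fun setT b.
  apply: measurable_minr; last exact: measurable_cap_bound.
  by apply: measurable_funM => //; exact: measurable_funB.
have q1 (tau : R) : 0 <= 1 - expR (- (expR tau * pi)).
  by rewrite subr_ge0 -expR0 ler_expR oppr_le0 mulr_ge0 ?expR_ge0 ?pi_ge0.
have b0 tau : 0 <= b tau.
  by rewrite le_min mulr_ge0//= divr_ge0 ?exprn_ge0 ?expR_ge0 ?ltW.
have pw tau : zonal d (fun u => w tau (arc u)) <=
    2 / N%:R ^+ 2 * (\sum_(p <- pairs N) w tau (arc (dotp (z p.1) (z p.2)))) + b tau.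
  rewrite wdec zonalD// zonal_cst.
  set q := expR (- (expR tau * pi)).
  have -> : \sum_(p <- pairs N) w tau (arc (dotp (z p.1) (z p.2))) =
      \sum_(p <- pairs N) decay (expR tau) (dotp (z p.1) (z p.2)) - q * \sum_(p <- pairs N) 1.
    by rewrite mulr_sumr -sumrB; apply: eq_bigr => p _; rewrite mulr1 wrho// exp_decayE.
  rewrite mulrBr [X in _ - X + _]mulrCA decay_cst_pairs//.
  have h1 := decay_energy_pairs (expR_ge0 tau) N0 Sz.
  have h2 := hC _ (expR_gt0 tau).
  have P0 : 0 <= 2 / N%:R ^+ 2 * (\sum_(p <- pairs N) decay (expR tau) (dotp (z p.1) (z p.2))).
    apply: mulr_ge0; first by rewrite divr_ge0 ?exprn_ge0.
    by apply: sumr_ge0 => p _; exact: expR_ge0.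
  have qN : 0 <= q * N%:R^-1 by rewrite mulr_ge0 ?expR_ge0.
  rewrite addr_minr le_min; apply/andP; split; first by rewrite -/q; lra.
  by lra.
have int_b := min_mass_integral_log C0 N0.
rewrite A1E A2E !(=^~ EFinM, =^~ EFinD) in int_b.
apply: le_trans (mixture_upper d0 mw w0 wE c0 bw mb b0 zc pw int_b) _.
rewrite lee_fin lerD2l.
have lN : 0 <= ln N%:R :> R by rewrite ln_ge0// ler1n.
have lNd : ln N%:R / d%:R <= ln N%:R :> R by rewrite ler_pdivrMr// ler_peMr.
have cN : 0 <= c^-1 * N%:R^-1 by rewrite mulr_ge0// invr_ge0 ltW.
have : pi * A1 + ln N%:R / d%:R + C * A2 <= (pi * A1 + 1 + C * A2) * (1 + ln N%:R).
  have := mulr_ge0 piA lN; have := mulr_ge0 CA lN; lra.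
move=> /(ler_wpM2l cN); move: c^-1 N%:R^-1 => ? ?; lra.
Qed.

(** With the kernels [1 - exp (- t rho)] positive definiteness bounds the discrete
    energy from above, with a gain of [1 / N] minus the mean of [exp (- t rho)].
    From [t = (2 C N) ^ (1 / d)] on this gain is at least [1 / (2 N)], and the first
    unit of [tau = ln t] from there already yields the power of [N]. *)
Lemma energy_le_pos (delta : R) : 0 < delta < 1 -> exists2 K : R, 0 < K &
  forall N (z : 'I_N -> d.+1.-tuple R), (0 < N)%N -> configuration d N z ->
  ((2 / N%:R ^+ 2 * discrete_energy delta z
    + K * N%:R `^ (- 1 - delta / d%:R))%:E <= mean_potential d delta)%E.
Proof.
move=> de01; have /andP[de0 de1] := de01.
have [c c0 cE] := mixture_pos de01.
have [C C0 hC] := @zonal_decay_le R d.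
have dR : 0 < d%:R :> R by rewrite ltr0n.
pose T : R := ln (2 * C) / d%:R.
exists (2^-1 * expR (- (delta * (T + 1))) / c).
  by rewrite divr_gt0// mulr_gt0 ?expR_gt0// invr_gt0.
move=> N z N0 zc; have [_ Sz] := zc.
have NR : 0 < N%:R :> R by rewrite ltr0n.
have NI : 0 <= N%:R^-1 :> R by rewrite invr_ge0 ltW.
pose w (tau rho : R) : R := `|1 - expR (- (expR tau * rho))| * expR (- (delta * tau)).
have wrho tau rho : 0 <= rho <= pi -> w tau rho = (1 - expR (- (expR tau * rho))) * expR (- (delta * tau)).
  move=> /andP[r0 _]; rewrite /w ger0_norm// subr_ge0 -expR0 ler_expR oppr_le0.
  by rewrite mulr_ge0// expR_ge0.
pose b (tau : R) := Num.max 0 (N%:R^-1 - C / expR tau ^+ d) * expR (- (delta * tau)).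
have mw : measurable_fun setT (fun p : R * R => w p.1 p.2).
  apply: measurable_funM; last exact: measurable_exp_fst.
  apply: measurableT_comp; first exact: normr_measurable.
  by apply: measurable_funB => //; exact: measurable_exp_prod.
have w0 tau rho : 0 <= rho <= pi -> 0 <= w tau rho by rewrite /w mulr_ge0 ?expR_ge0.
have wE rho : 0 < rho <= pi -> (\int[mu]_tau (w tau rho)%:E = (c * radial delta rho)%:E)%E.
  move=> /andP[r0 rpi]; rewrite /radial gt_eqF// -cE ?(ltW r0)//.
  by apply: eq_integral => tau _; rewrite wrho// (ltW r0).
have arcpi u : 0 <= arc u <= (pi : R) by rewrite arc_ge0 arc_lepi.
have wdec tau : (fun u => w tau (arc u)) =
    (fun u => expR (- (delta * tau)) * (cst 1 u + -1 * decay (expR tau) u)).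
  by apply/funext => u; rewrite wrho// exp_decayE mulrC mulN1r.
have bdec tau := @bounded_measurable_decay R (expR tau) (expR_ge0 tau).
have bcst := @bounded_measurable_cst R 1.
have bw tau : bounded_measurable (fun u => w tau (arc u)).
  by rewrite wdec; apply/bounded_measurableZ/bounded_measurableD => //; exact: bounded_measurableZ.
have mb : measurable_fun setT b.
  apply: measurable_funM; last first.
    by apply: measurableT_comp => //; apply: measurable_funN; exact: measurable_funM.
  by apply: measurable_maxr => //; apply: measurable_funB => //; exact: measurable_cap_bound.
have b0 tau : 0 <= b tau by rewrite mulr_ge0 ?expR_ge0// le_max lexx.
have pw tau : 2 / N%:R ^+ 2 * (\sum_(p <- pairs N) w tau (arc (dotp (z p.1) (z p.2)))) + b tau <=
    zonal d (fun u => w tau (arc u)).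
  rewrite wdec zonalZ; last by apply: bounded_measurableD => //; exact: bounded_measurableZ.
  rewrite zonalD//; last exact: bounded_measurableZ.
  rewrite zonal_cst zonalZ//.
  have -> : \sum_(p <- pairs N) w tau (arc (dotp (z p.1) (z p.2))) =
      expR (- (delta * tau)) * (\sum_(p <- pairs N) 1 -
        \sum_(p <- pairs N) decay (expR tau) (dotp (z p.1) (z p.2))).
    by rewrite -sumrB mulr_sumr; apply: eq_bigr => p _; rewrite wrho// exp_decayE mulrC.
  rewrite mulrCA /b [Num.max _ _ * _]mulrC -mulrDr ler_wpM2l ?expR_ge0//.
  rewrite mulrBr decay_cst_pairs//.
  have h1 := decay_energy_pairs (expR_ge0 tau) N0 Sz.
  have h2 := hC _ (expR_gt0 tau).
  have P0 : 0 <= 2 / N%:R ^+ 2 * (\sum_(p <- pairs N) decay (expR tau) (dotp (z p.1) (z p.2))).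
    apply: mulr_ge0; first by rewrite divr_ge0 ?exprn_ge0.
    by apply: sumr_ge0 => p _; exact: expR_ge0.
  rewrite addr_maxr ge_max; apply/andP; split; lra.
pose L : R := ln N%:R / d%:R.
have lower : ((2^-1 * expR (- (delta * (T + 1))) * N%:R `^ (- 1 - delta / d%:R))%:E <=
    \int[mu]_tau (b tau)%:E)%E.
  set v := _ * _ * _.
  have v0 : 0 <= v by rewrite !mulr_ge0 ?invr_ge0 ?expR_ge0 ?powR_ge0.
  apply: (@le_trans _ _ (\int[mu]_(x in `[(T + L)%R, (T + L + 1)%R]) (cst v%:E x))%E).
    rewrite integral_cst//= lebesgue_measure_itv/= lte_fin ltrDl ltr01 -EFinB -EFinM lee_fin.
    by rewrite [T + L + 1]addrC addrK mulr1.
  apply: (@le_trans _ _ (\int[mu]_(x in `[(T + L)%R, (T + L + 1)%R]) (b x)%:E)%E).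
    apply: ge0_le_integral => //.
    - by apply/measurable_EFinP; exact: measurable_funS mb.
    - move=> x /=; rewrite in_itv/= => /andP[x1 x2]; rewrite lee_fin /v /b.
      have NL : N%:R = expR (d%:R * L) by rewrite /L mulrCA divff ?gt_eqF// mulr1 lnK.
      have CT : C = 2^-1 * expR (d%:R * T).
        by rewrite /T mulrCA divff ?gt_eqF// mulr1 lnK ?posrE ?mulr_gt0//; lra.
      have -> : 2^-1 * expR (- (delta * (T + 1))) * N%:R `^ (- 1 - delta / d%:R) =
          2^-1 * N%:R^-1 * expR (- (delta * (T + L + 1))).
        rewrite /powR gt_eqF// [in RHS]NL -expRN -!mulrA -!expRD; congr (_ * expR _).
        have dL : d%:R * L = ln N%:R by rewrite /L mulrCA divff ?gt_eqF// mulr1.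
        by rewrite dL /L; lra.
      apply: ler_pM; rewrite ?expR_ge0 ?mulr_ge0 ?invr_ge0 ?(ltW NR)//; last first.
        by rewrite ler_expR lerN2 ler_wpM2l// ltW.
      rewrite le_max; apply/orP; right.
      have : C / expR x ^+ d <= 2^-1 * N%:R^-1.
        rewrite {1}CT NL -expRM_natl -!expRN -mulrA -expRD ler_wpM2l// ?invr_ge0//.
        by rewrite ler_expR; have := ler_wpM2l (ltW dR) x1; lra.
      lra.
  have mb' : measurable_fun setT (EFin \o b) by exact/measurable_EFinP.
  by apply: (@ge0_subset_integral _ _ _ mu _ setT _ _ _ mb') => // x _; rewrite lee_fin.
apply: le_trans (mixture_lower d0 mw w0 wE c0 bw mb b0 zc pw lower).
by rewrite lee_fin lerD2l mulrAC.
Qed.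

End energy_bounds.

(** * Random configurations *)

Section random_points.
Context {R : realType} (d : nat).
Hypothesis d0 : (0 < d)%N.
Local Notation T := (d.+1.-tuple R).
Local Notation sigma := (@surface_measure R d).
Local Notation S := (@sphere R d).
Local Open Scope ereal_scope.

(** Boundedness keeps all energies of densities finite. *)
Definition density (g : T -> R) : Prop :=
  [/\ measurable_fun setT g, forall x, (0 <= g x)%R,
      forall x, ~ S x -> g x = 0%R & exists B : R, forall x, (g x <= B)%R].

Definition mass (g : T -> R) : \bar R := \int[sigma]_x (g x)%:E.

Variable k : R -> R.
Hypothesis mk : measurable_fun setT k.
Hypothesis k0 : forall t, (0 <= k t)%R.

Definition potential_of (g : T -> R) (x : T) : \bar R :=
  \int[sigma]_y (k (dotp x y) * g y)%:E.

Definition mutual_energy (f g : T -> R) : \bar R :=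
  \int[sigma]_x ((f x)%:E * potential_of g x).

Let measurable_pair (f g : T -> R) : measurable_fun setT f -> measurable_fun setT g ->
  measurable_fun setT (fun p : T * T => (f p.1 * (k (dotp p.1 p.2) * g p.2))%:E : \bar R).
Proof.
move=> mf mg; apply/measurable_EFinP; apply: measurable_funM.
  by apply: (measurableT_comp mf); exact: measurable_fst.
apply: measurable_funM; last by apply: (measurableT_comp mg); exact: measurable_snd.
apply: (measurableT_comp mk); apply: measurable_dotp; [exact: measurable_fst|exact: measurable_snd].
Qed.

Lemma potential_of_ge0 g x : (forall x, (0 <= g x)%R) -> 0 <= potential_of g x.
Proof. by move=> g0; apply: integral_ge0 => y _; rewrite lee_fin mulr_ge0. Qed.

Lemma measurable_potential_of g : density g -> measurable_fun setT (potential_of g).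
Proof.
move=> [mg g0 _ _].
have m1 : measurable_fun setT (cst 1%R : T -> R) by [].
have := @measurable_fun_fubini_tonelli_F _ _ _ _ R sigma _
  (measurable_pair m1 mg)
  (fun p => mulr_ge0 ler01 (mulr_ge0 (k0 _) (g0 p.2))).
rewrite /fubini_F /= (_ : (fun x => _) = potential_of g)//.
by apply/funext => x; apply: eq_integral => y _; rewrite mul1r.
Qed.

Lemma mutual_energyE (f g : T -> R) : density f -> density g ->
  mutual_energy f g = \int[sigma]_x \int[sigma]_y (f x * (k (dotp x y) * g y))%:E.
Proof.
move=> [mf f0 _ _] [mg g0 _ _]; apply: eq_integral => x _.
under [RHS]eq_integral do rewrite EFinM.
rewrite ge0_integralZl//.
- apply/measurable_EFinP; apply: measurable_funM => //.
  by apply: (measurableT_comp mk); exact: measurable_dotp.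
- by move=> y _; rewrite lee_fin mulr_ge0.
- by rewrite lee_fin.
Qed.

Lemma mutual_energyC f g : density f -> density g ->
  mutual_energy f g = mutual_energy g f.
Proof.
move=> df dg; rewrite (mutual_energyE df dg) (mutual_energyE dg df); move: df dg => [mf f0 _ _] [mg g0 _ _].
have := @fubini_tonelli _ _ _ _ R sigma sigma _ (measurable_pair mf mg)
  (fun p => mulr_ge0 (f0 p.1) (mulr_ge0 (k0 _) (g0 p.2))).
move=> /= ->; apply: eq_integral => x _; apply: eq_integral => y _.
by rewrite (dotpC y x); congr EFin; lra.
Qed.

Lemma surface_measure_points (A : seq T) : (forall a, a \in A -> S a) ->
  exists2 Z : set T, measurable Z /\ sigma Z = 0 & forall a, a \in A -> Z a.
Proof.
elim: A => [|a A IH] SA; first by exists set0; rewrite ?measure0.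
have [b Ab|Z [mZ Z0] ZA] := IH; first by apply: SA; rewrite inE Ab orbT.
have Sa : S a by apply: SA; rewrite inE eqxx.
have mpt : measurable [set y : T | (arc (dotp a y) <= 0)%R].
  exact: (measurable_le_set _ (measurable_arc_dotp _)).
exists ([set y | (arc (dotp a y) <= 0)%R] `|` Z).
  split; first exact: measurableU.
  by rewrite measureU0//; exact: surface_measure_point.
move=> b; rewrite inE => /orP[/eqP ->|/ZA]; last by right.
by left; rewrite /= ((sphereP a).1 Sa) arc1.
Qed.

Lemma measurable_cmul (g : T -> R) (f : T -> \bar R) : measurable_fun setT g ->
  measurable_fun setT f -> measurable_fun setT (fun x => (g x)%:E * f x).
Proof. by move=> mg mf; apply: emeasurable_funM => //; exact/measurable_EFinP. Qed.

(** Otherwise [Phi] would exceed its [g]-average by [e] almost everywhere, since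
    the points to be avoided form a null set. *)
Lemma exists_point_le_average (g : T -> R) (Phi : T -> \bar R) (A : seq T) (e : R) :
  density g -> mass g = 1 -> measurable_fun setT Phi -> (forall x, 0 <= Phi x) ->
  (forall a, a \in A -> S a) -> (0 < e)%R ->
  exists x, [/\ S x, x \notin A & Phi x <= \int[sigma]_y ((g y)%:E * Phi y) + e%:E].
Proof.
move=> [mg g0 gS [B gB]] g1 mPhi Phi0 SA e0.
set v := \int[sigma]_y _.
have v0 : 0 <= v by apply: integral_ge0 => y _; rewrite mule_ge0// lee_fin.
have [Z [mZ Z0] ZA] := surface_measure_points SA.
apply: contrapT => H.
have big y : S y -> ~ Z y -> v + e%:E < Phi y.
  move=> Sy nZ; rewrite ltNge; apply/negP => le; apply: H; exists y; split => //.
  by apply/negP => /ZA.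
have vlty : v < +oo.
  rewrite ltey; apply/eqP => vy.
  suff : mass g = 0 by rewrite g1 => /eqP; rewrite onee_eq0.
  have mg' : measurable_fun setT (EFin \o g) by exact/measurable_EFinP.
  rewrite /mass (ge0_negligible_integral mZ measurableT mg' (fun y _ => g0 y) Z0).
  apply: integral0_eq => y [_ nZ].
  have [Sy|/gS gy] := pselect (S y); last by rewrite /= gy.
  by have := big y Sy nZ; rewrite vy addye// ltNge leey.
have vfin : v \is a fin_num by rewrite ge0_fin_numE.
have : v + e%:E <= v.
  rewrite -[leLHS]mule1 -g1 /mass -ge0_integralZl//; last 3 first.
  - exact/measurable_EFinP.
  - by move=> y _; rewrite lee_fin.
  - by rewrite adde_ge0// lee_fin ltW.
  rewrite /v (ge0_negligible_integral mZ measurableT _ _ Z0)//; last 2 first.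
  - by apply: measurable_funeM; exact/measurable_EFinP.
  - by move=> y _; rewrite mule_ge0 ?lee_fin// adde_ge0// lee_fin ltW.
  rewrite [leRHS](ge0_negligible_integral mZ measurableT _ _ Z0)//; last 2 first.
  - exact: measurable_cmul.
  - by move=> y _; rewrite mule_ge0 ?lee_fin.
  apply: ge0_le_integral => //.
  - exact: measurableD.
  - by move=> y _; rewrite mule_ge0 ?lee_fin// adde_ge0// lee_fin ltW.
  - apply: measurable_funeM; apply/measurable_EFinP; exact: measurable_funS mg.
  - by apply: (measurable_funS measurableT) => //; exact: measurable_cmul.
  - move=> y [_ nZ]; rewrite muleC; have [Sy|/gS ->] := pselect (S y).
      by rewrite lee_wpmul2l ?lee_fin// ltW// big.
    by rewrite !mul0e.
by rewrite -(fineK vfin) -EFinD lee_fin; lra.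
Qed.

Lemma sum_lt_recl n (f : 'I_n.+1 -> 'I_n.+1 -> \bar R) :
  \sum_(i < n.+1) \sum_(j < n.+1 | (i < j)%N) f i j =
  \sum_(j < n) f ord0 (lift ord0 j) +
  \sum_(i < n) \sum_(j < n | (i < j)%N) f (lift ord0 i) (lift ord0 j).
Proof.
rewrite big_ord_recl; congr (_ + _).
  by rewrite big_mkcond big_ord_recl/= add0e.
apply: eq_bigr => i _; rewrite big_mkcond big_ord_recl/= add0e [RHS]big_mkcond.
by apply: eq_bigr.
Qed.

Let combine (a b p q r u s t v w e : \bar R) :
  (b + p) + q <= (r + u) + s + t -> a + u <= v + w + e ->
  (a + b) + (p + q) <= (v + r) + (w + s) + (e + t).
Proof.
move=> h1 h2.
rewrite (AC (2*2) (1*((2*3)*4))); apply: le_trans (leeD2l _ h1) _.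
rewrite (AC (1*4) ((1*3)*(2*4*5))); apply: le_trans (leeD2r _ h2) _.
by rewrite (AC (3*3) ((1*4)*(2*5)*(3*6))).
Qed.

(** The method of conditional expectations: the points are fixed one after the
    other, each one at a place where the expected energy of the whole
    configuration is at most its mean. For the induction, [G i] collects the
    interaction of the [i]-th point with the points that are already fixed, and
    [A] contains these points, so that the new ones are distinct from them. *)
Lemma exists_points n : forall (A : seq T) (g : 'I_n -> T -> R) (G : 'I_n -> T -> \bar R)
  (e : R), (0 < e)%R -> (forall a, a \in A -> S a) -> (forall i, density (g i)) ->
  (forall i, mass (g i) = 1) -> (forall i, measurable_fun setT (G i)) ->
  (forall i x, 0 <= G i x) ->
  exists z : 'I_n -> T, [/\ injective z, forall i, S (z i), forall i, z i \notin A &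
    \sum_(i < n) G i (z i) + \sum_(i < n) \sum_(j < n | (i < j)%N) (k (dotp (z i) (z j)))%:E <=
    \sum_(i < n) \int[sigma]_x ((g i x)%:E * G i x) +
    \sum_(i < n) \sum_(j < n | (i < j)%N) mutual_energy (g i) (g j) + (n%:R * e)%:E].
Proof.
elim: n => [|n IH] A g G e e0 SA dg g1 mG G0.
  by exists (fun=> pole d); split; [case|case|case|rewrite !big_ord0 mul0r !adde0].
pose Phi x := G ord0 x + \sum_(j < n) potential_of (g (lift ord0 j)) x.
have U0 j x : 0 <= potential_of (g j) x.
  by apply: potential_of_ge0; case: (dg j).
have mU j : measurable_fun setT (potential_of (g j)) by exact: measurable_potential_of.
have mPhi : measurable_fun setT Phi.
  by apply: emeasurable_funD => //; exact: emeasurable_sum.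
have Phi0 x : 0 <= Phi x by rewrite adde_ge0// sume_ge0.
have [z0 [Sz0 z0A z0Phi]] := exists_point_le_average (dg ord0) (g1 ord0) mPhi Phi0 SA e0.
have SA' a : a \in z0 :: A -> S a by rewrite inE => /orP[/eqP ->|/SA].
have mkz : measurable_fun setT (fun y : T => (k (dotp z0 y))%:E : \bar R).
  by apply/measurable_EFinP; apply: (measurableT_comp mk); exact: measurable_dotp.
have [||z [zinj Sz zA zle]] := IH (z0 :: A) (fun j => g (lift ord0 j))
  (fun j y => G (lift ord0 j) y + (k (dotp z0 y))%:E) e e0 SA' (fun j => dg _) (fun j => g1 _).
- by move=> j; exact: emeasurable_funD.
- by move=> j y; rewrite adde_ge0// lee_fin.
pose zz (i : 'I_n.+1) := if unlift ord0 i is Some j then z j else z0.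
have zz0 : zz ord0 = z0 by rewrite /zz unlift_none.
have zzL j : zz (lift ord0 j) = z j by rewrite /zz liftK.
exists zz; split.
- move=> i1 i2; have [j1 ->|->] := unliftP ord0 i1; have [j2 ->|->] := unliftP ord0 i2;
    rewrite ?zz0 ?zzL //.
  + by move=> /zinj ->.
  + by move=> E; have := zA j1; rewrite E inE eqxx.
  + by move=> E; have := zA j2; rewrite -E inE eqxx.
- by move=> i; have [j ->|->] := unliftP ord0 i; rewrite ?zz0 ?zzL.
- move=> i; have [j ->|->] := unliftP ord0 i; rewrite ?zz0 ?zzL //.
  by have := zA j; rewrite inE negb_or => /andP[].
rewrite !sum_lt_recl !big_ord_recl zz0.
under [X in _ + X + _ <= _]eq_bigr do rewrite zzL.
under [X in _ + (X + _) <= _]eq_bigr do rewrite zzL.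
under [X in _ + (_ + X) <= _]eq_bigr do under eq_bigr do rewrite !zzL.
rewrite -natr1 mulrDl mul1r [(n%:R * e + e)%R]addrC EFinD.
apply: (combine (u := \sum_(j < n) potential_of (g (lift ord0 j)) z0)).
  rewrite -[X in X + _ <= _]big_split -[X in _ <= X + _ + _]big_split/=.
  apply: le_trans zle _.
  rewrite le_eqVlt; apply/orP; left; apply/eqP; congr (_ + _ + _).
  apply: eq_bigr => j _; have [mg gg0 _ _] := dg (lift ord0 j).
  rewrite -ge0_integralD//; last 4 first.
  - by move=> x _; rewrite mule_ge0// lee_fin.
  - exact: measurable_cmul.
  - by move=> x _; rewrite lee_fin mulr_ge0.
  - apply/measurable_EFinP; apply: measurable_funM => //; exact/measurable_EFinP.
  apply: eq_integral => x _; rewrite ge0_muleDr ?lee_fin//.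
  by rewrite [(k _ * _)%R]mulrC.
apply: le_trans z0Phi _; rewrite leeD2r// /Phi.
have [mg gg0 _ _] := dg ord0.
under eq_integral do rewrite ge0_muleDr ?sume_ge0//.
rewrite ge0_integralD//; last 4 first.
- by move=> x _; rewrite mule_ge0// lee_fin.
- exact: measurable_cmul.
- by move=> x _; rewrite mule_ge0 ?lee_fin// sume_ge0.
- by apply: measurable_cmul => //; exact: emeasurable_sum.
rewrite leeD2l//.
under eq_integral do rewrite ge0_sume_distrr//.
rewrite ge0_integral_sum//.
- by move=> j; exact: measurable_cmul.
- by move=> j x _; rewrite mule_ge0// lee_fin.
Qed.

End random_points.

Section random_configuration.
Context {R : realType} (d : nat).
Hypothesis d0 : (0 < d)%N.
Local Notation T := (d.+1.-tuple R).
Local Notation sigma := (@surface_measure R d).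
Local Notation S := (@sphere R d).
Variable k : R -> R.
Hypothesis mk : measurable_fun setT k.
Hypothesis k0 : forall t, 0 <= k t.
Variable a : R.
Hypothesis ka : (\int[sigma]_y (k (dotp (pole d) y))%:E = a%:E)%E.

Let a0 : 0 <= a.
Proof. by rewrite -lee_fin -ka; apply: integral_ge0 => y _; rewrite lee_fin. Qed.

Let mkx (x : T) : measurable_fun setT (fun y : T => k (dotp x y)).
Proof. exact: measurable_comp_dotp. Qed.

Let kax x : S x -> (\int[sigma]_y (k (dotp x y))%:E = a%:E)%E.
Proof. by move=> Sx; rewrite -ka; exact: integral_sphere_pole. Qed.

Lemma density_le_mass1 (g : T -> R) (f : T -> \bar R) (c : R) : density g -> mass g = 1%E ->
  measurable_fun setT f -> (forall x, 0 <= f x)%E -> 0 <= c ->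
  (forall x, S x -> f x <= c%:E)%E ->
  (\int[sigma]_x ((g x)%:E * f x) <= c%:E)%E.
Proof.
move=> [mg g0 gS _] g1 mf f0 c0 fc.
rewrite -[leRHS]mule1 -g1 /mass -ge0_integralZl//; last 2 first.
- exact/measurable_EFinP.
- by move=> x _; rewrite lee_fin.
apply: ge0_le_integral => //.
- by move=> x _; rewrite mule_ge0// lee_fin.
- exact: measurable_cmul.
- by apply: measurable_funeM; exact/measurable_EFinP.
move=> x _; rewrite muleC; have [Sx|/gS ->] := pselect (S x); last by rewrite !mule0.
by rewrite lee_wpmul2r ?lee_fin// fc.
Qed.

Section fixed_densities.
Variables (N : nat) (g : 'I_N -> T -> R).
Hypothesis dg : forall i, density (g i).
Hypothesis g1 : forall i, mass (g i) = 1%E.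
Hypothesis gN : forall x, \sum_(i < N) g i x <= N%:R.

Let sum_potential_le x : S x -> (\sum_(j < N) potential_of k (g j) x <= (N%:R * a)%:E)%E.
Proof.
move=> Sx; rewrite /potential_of -ge0_integral_sum//; last 2 first.
- move=> j; apply/measurable_EFinP; apply: measurable_funM => //.
  by case: (dg j).
- by move=> j y _; rewrite lee_fin mulr_ge0//; case: (dg j).
rewrite EFinM -(kax Sx) -ge0_integralZl//; last 2 first.
- exact/measurable_EFinP.
- by move=> y _; rewrite lee_fin.
apply: ge0_le_integral => //.
- by move=> y _; apply: sume_ge0 => j _; rewrite lee_fin mulr_ge0//; case: (dg j).
- apply: emeasurable_sum => j; apply/measurable_EFinP; apply: measurable_funM => //.
  by case: (dg j).
- by apply: measurable_funeM; exact/measurable_EFinP.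
move=> y _; rewrite sumEFin -EFinM lee_fin -mulr_sumr mulrC.
by rewrite ler_wpM2r.
Qed.

Let U0 j x : (0 <= potential_of k (g j) x)%E.
Proof. by apply: potential_of_ge0 => //; case: (dg j). Qed.

Let mU j : measurable_fun setT (potential_of k (g j)).
Proof. exact: measurable_potential_of. Qed.

Let sum_energy_le i : (\sum_(j < N) mutual_energy k (g i) (g j) <= (N%:R * a)%:E)%E.
Proof.
rewrite /mutual_energy -ge0_integral_sum//; last 2 first.
- by move=> j; apply: measurable_cmul => //; case: (dg i).
- by move=> j x _; rewrite mule_ge0// lee_fin; case: (dg i).
under eq_integral do rewrite -ge0_sume_distrr//.
apply: density_le_mass1 => //.
- exact: emeasurable_sum.
- by move=> x; apply: sume_ge0.
- by rewrite mulr_ge0.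
Qed.

Let J0 i j : (0 <= mutual_energy k (g i) (g j))%E.
Proof. by apply: integral_ge0 => x _; rewrite mule_ge0// lee_fin; case: (dg i). Qed.

Let Jfin i j : mutual_energy k (g i) (g j) \is a fin_num.
Proof.
rewrite ge0_fin_numE//; apply: le_lt_trans (ltry (N%:R * a)).
apply: le_trans (sum_energy_le i); rewrite (bigD1 j)//= leeDl//.
exact: sume_ge0.
Qed.

Let J i j : R := fine (mutual_energy k (g i) (g j)).

(** The expected energy of independent points is the sum of all mutual energies of
    the [g i] minus that of the self-energies. As the [g i] add up to at most [N],
    the potential of their sum is at most [N * a] everywhere on the sphere, and the
    sum of all mutual energies at most [N ^ 2 * a]. *)
Lemma random_configuration (e : R) : 0 < e -> exists2 z, configuration d N z &
  2 * (\sum_(p <- pairs N) k (dotp (z p.1) (z p.2))) +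
  \sum_(i < N) fine (mutual_energy k (g i) (g i)) <= N%:R ^+ 2 * a + e.
Proof.
move=> e0; pose e' := e / (2 * N.+1%:R).
have e'0 : 0 < e' by rewrite divr_gt0// mulr_gt0.
have [//|//|//|z [zinj Sz _ zle]] := @exists_points R d d0 k mk k0 N [::] g (fun _ _ => 0%E) e' e'0 _ dg g1 _.
exists z => //.
have sumJ : \sum_(i < N) \sum_(j < N) J i j <= N%:R ^+ 2 * a.
  apply: (@le_trans _ _ (\sum_(i < N) N%:R * a)).
    apply: ler_sum => i _; rewrite -lee_fin -sumEFin.
    by under eq_bigr do rewrite fineK//.
  by rewrite sumr_const card_ord -[leLHS]mulr_natl mulrA expr2.
rewrite sum_symmetric in sumJ; last by move=> i j; rewrite /J mutual_energyC.
have le : \sum_(p <- pairs N) k (dotp (z p.1) (z p.2)) <=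
    \sum_(p <- pairs N) J p.1 p.2 + N%:R * e'.
  rewrite -(sum_pairsE (fun i j => k (dotp (z i) (z j)))) -(sum_pairsE J) -lee_fin EFinD -!sumEFin.
  move: zle; rewrite big1// add0e [X in (_ <= X + _ + _)%E]big1 ?add0e; last first.
    by move=> i _; under eq_integral do rewrite mule0; exact: integral0.
  move=> zle; apply: le_trans (le_trans _ zle) _.
    by rewrite le_eqVlt; apply/orP; left; apply/eqP; apply: eq_bigr => i _; rewrite sumEFin.
  rewrite leeD2r//; apply: lee_sum => i _; rewrite -sumEFin; apply: lee_sum => j _.
  by rewrite fineK.
have eN : N%:R * e' * 2 <= e.
  have <- : e' * (2 * N.+1%:R) = e by rewrite /e' divfK// mulf_neq0// pnatr_eq0.
  by rewrite -natr1; lra.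
by rewrite /J in sumJ le *; lra.
Qed.

End fixed_densities.
End random_configuration.

(** * Coverings of the sphere by small sets *)

Section covering.
Context {R : realType} (d : nat).
Hypothesis d0 : (0 < d)%N.
Local Notation T := (d.+1.-tuple R).
Local Notation S := (@sphere R d).

(** The chord of an arc [r] has length [2 sin (r / 2)]. *)
Lemma arc_le_chord (x y : T) : S x -> S y ->
  arc (dotp x y) ^+ 2 <= 16 * dotp (addt x (oppt y)) (addt x (oppt y)).
Proof.
move=> Sx Sy; have := cos_half (arc (dotp x y)).
rewrite dotpBB ((sphereP x).1 Sx) ((sphereP y).1 Sy) (cos_arc (dotp_sphere Sx Sy)) => E.
have a0 := arc_ge0 (dotp x y); have api := arc_lepi (dotp x y).
have h : arc (dotp x y) / 2 / 4 <= sin (arc (dotp x y) / 2).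
  by apply: sin_ge_quarter; rewrite divr_ge0//= ler_pM2r// invr_gt0.
have : (arc (dotp x y) / 2 / 4) ^+ 2 <= sin (arc (dotp x y) / 2) ^+ 2.
  by rewrite lerXn2r ?nnegrE//; [lra|apply: le_trans h; lra].
lra.
Qed.

Definition cell_index m : finType := ('I_d.+1 * bool * {ffun 'I_d -> 'I_m.+1})%type.

(** A grid cell on one of the [2 (d + 1)] faces of the cube, seen from the
    sphere: one coordinate is bounded away from 0, and the other [d] coordinates
    are known up to [2 / m]. *)
Definition cell m (c : cell_index m) : set T :=
  [set y | 1 <= d.+1%:R * tnth y c.1.1 ^+ 2] `&`
  [set y | 0 <= (if c.1.2 then 1 else -1) * tnth y c.1.1] `&`
  \bigcap_(i in [set: 'I_d])
    ([set y | (c.2 i)%:R <= (tnth y (lift c.1.1 i) + 1) * m%:R / 2] `&`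
     [set y | (tnth y (lift c.1.1 i) + 1) * m%:R / 2 <= (c.2 i).+1%:R]).

Lemma measurable_cell m (c : cell_index m) : measurable (cell c).
Proof.
have mt i : measurable_fun setT (fun y : T => tnth y i) by exact: measurable_tnth.
have mv i : measurable_fun setT (fun y : T => (tnth y i + 1) * m%:R / 2).
  by apply: measurable_funM => //; apply: measurable_funM => //; exact: measurable_funD.
apply: measurableI; [apply: measurableI|].
- by apply: measurable_ge_set; apply: measurable_funM => //; exact: measurable_funX.
- by apply: measurable_ge_set; exact: measurable_funM.
apply: fin_bigcap_measurable => // i _; apply: measurableI.
  exact: measurable_ge_set.
exact: measurable_le_set.
Qed.

Lemma cell_cover m (y : T) : S y -> exists c : cell_index m, cell c y.
Proof.
move=> Sy; have y1 := (sphereP y).1 Sy.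
have [j yj] : exists j, 1 <= d.+1%:R * tnth y j ^+ 2.
  apply: contrapT => H.
  have lt j : tnth y j ^+ 2 < d.+1%:R^-1.
    rewrite -[ltRHS]mulr1 ltr_pdivlMl// ltNge; apply/negP => h; apply: H; exists j => //.
  have : dotp y y < \sum_(i < d.+1) d.+1%:R^-1.
    apply: ltr_sum => [|i _]; last by rewrite -expr2; exact: lt.
    by apply/hasP; exists ord0; rewrite ?mem_index_enum.
  by rewrite y1 sumr_const card_ord -[X in _ < X]mulr_natl divff ?ltxx// pnatr_eq0.
pose v i := (tnth y (lift j i) + 1) * m%:R / 2.
have yb i := tnth_sphere_le1 i Sy.
have v0 i : 0 <= v i.
  by have := yb (lift j i); rewrite ler_norml /v => ?; rewrite !mulr_ge0//; lra.
have vm i : v i <= m%:R.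
  have := yb (lift j i); rewrite ler_norml /v => ?.
  have : (tnth y (lift j i) + 1) * m%:R <= 2 * m%:R by rewrite ler_wpM2r//; lra.
  lra.
have tm i : (Num.truncn (v i) < m.+1)%N.
  rewrite ltnS -(ler_nat R); apply: le_trans (vm i).
  by rewrite truncn_le.
exists (j, 0 <= tnth y j, [ffun i => Ordinal (tm i)]); split; [split|] => //=.
  by case: ifPn => h; rewrite ?mul1r// mulN1r oppr_ge0; rewrite -ltNge in h; exact: ltW.
move=> i _; rewrite ffunE; split => /=.
  by rewrite truncn_le.
exact/ltW/truncnS_gt.
Qed.

End covering.

Section covering2.
Context {R : realType} (d : nat).
Hypothesis d0 : (0 < d)%N.
Local Notation T := (d.+1.-tuple R).
Local Notation S := (@sphere R d).

Let dotp_coord (x : T) j : dotp x x = tnth x j ^+ 2 + \sum_(i < d) tnth x (lift j i) ^+ 2.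
Proof.
by rewrite /dotp (bigD1_ord j)//= -expr2; congr (_ + _); apply: eq_bigr => i _; rewrite expr2.
Qed.

(** A bound for [m] times the diameter of a cell. *)
Definition grid_cst : R := 16 * (8 * d%:R ^+ 2 * d.+1%:R + 4 * d%:R) + 1.

(** The free coordinates of two points of a cell differ by at most [2 / m]. The
    squares of the distinguished coordinates [u], [v] then differ by order [1 / m],
    as the points have norm 1, and so do [u] and [v] themselves: they have the same
    sign and are bounded away from 0. *)
Lemma cell_diameter m (c : cell_index d m) (x y : T) : S x -> S y -> cell c x -> cell c y ->
  arc (dotp x y) * m%:R <= grid_cst.
Proof.
move=> Sx Sy [[/= xj xs] xb] [[/= yj ys] yb].
set j := c.1.1 in xj yj xs ys xb yb.
set u := tnth x j in xj xs; set v := tnth y j in yj ys.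
pose a i := tnth x (lift j i); pose b i := tnth y (lift j i).
have x1 : u ^+ 2 + \sum_(i < d) a i ^+ 2 = 1 by rewrite -dotp_coord; exact/sphereP.
have y1 : v ^+ 2 + \sum_(i < d) b i ^+ 2 = 1 by rewrite -dotp_coord; exact/sphereP.
have uv : 0 <= u * v by move: xs ys; case: c.1.2 => *; nra.
have bd (w : T) i : S w -> -1 <= tnth w i <= 1.
  by move=> Sw; rewrite -ler_norml tnth_sphere_le1.
have ab i : -2 <= m%:R * (a i - b i) <= 2.
  by have [/= ? ?] := xb i I; have [/= ? ?] := yb i I; rewrite -natr1 in xb yb *; rewrite /a /b; apply/andP; split; lra.
have ab4 i : (m%:R * (a i - b i)) ^+ 2 <= 4 by have /andP[? ?] := ab i; nra.
have tail : m%:R ^+ 2 * (\sum_(i < d) (a i - b i) ^+ 2) <= 4 * d%:R.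
  rewrite mulr_sumr; apply: (@le_trans _ _ (\sum_(i < d) 4)).
    by apply: ler_sum => i _; rewrite -exprMn; exact: ab4.
  by rewrite sumr_const card_ord -[4 *+ d]mulr_natr.
have s1 : `|m%:R * (u ^+ 2 - v ^+ 2)| <= 4 * d%:R.
  have -> : u ^+ 2 - v ^+ 2 = \sum_(i < d) (b i ^+ 2 - a i ^+ 2).
    by rewrite big_split/= sumrN; lra.
  rewrite mulr_sumr; apply: le_trans (ler_norm_sum _ _ _) _.
  apply: (@le_trans _ _ (\sum_(i < d) 4)).
    apply: ler_sum => i _; rewrite -opprB subr_sqr mulrN normrN mulrA normrM.
    have /andP[h1 h2] := bd x (lift j i) Sx; have /andP[h3 h4] := bd y (lift j i) Sy.
    apply: (@le_trans _ _ (2 * 2)); last lra.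
    by apply: ler_pM => //; rewrite ler_norml; [have := ab i; lra|rewrite /a /b; apply/andP; split; lra].
  by rewrite sumr_const card_ord -[4 *+ d]mulr_natr.
have sum2 : 2 <= d.+1%:R * (u + v) ^+ 2.
  by rewrite sqrrD; have := ler0n R d.+1; nra.
have head : m%:R ^+ 2 * (u - v) ^+ 2 <= 8 * d%:R ^+ 2 * d.+1%:R.
  have : (m%:R * (u ^+ 2 - v ^+ 2)) ^+ 2 <= (4 * d%:R) ^+ 2.
    rewrite -[leLHS]real_normK ?num_real// lerXn2r ?nnegrE ?mulr_ge0//.
  rewrite subr_sqr mulrA !exprMn => h.
  have h1 : m%:R ^+ 2 * (u - v) ^+ 2 * 2 <= m%:R ^+ 2 * (u - v) ^+ 2 * (d.+1%:R * (u + v) ^+ 2).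
    by rewrite ler_wpM2l// -exprMn sqr_ge0.
  have : m%:R ^+ 2 * (u - v) ^+ 2 * (u + v) ^+ 2 * d.+1%:R <= 4 ^+ 2 * d%:R ^+ 2 * d.+1%:R.
    by rewrite ler_wpM2r.
  lra.
have chord := arc_le_chord Sx Sy.
set w := addt x (oppt y) in chord.
have wi i : tnth w i = tnth x i - tnth y i by rewrite /w !tnth_mktuple.
have : dotp w w * m%:R ^+ 2 <= 8 * d%:R ^+ 2 * d.+1%:R + 4 * d%:R.
  rewrite (dotp_coord w j) wi -/u -/v mulrDl ![_ * m%:R ^+ 2]mulrC; apply: lerD => //.
  by under eq_bigr do rewrite wi.
set K := _ + _ => hK.
have K0 : 0 <= K by rewrite /K addr_ge0// ?mulr_ge0// exprn_ge0.
have h : (arc (dotp x y) * m%:R) ^+ 2 <= 16 * K.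
  rewrite exprMn; apply: (@le_trans _ _ (16 * dotp w w * m%:R ^+ 2)); last lra.
  by rewrite ler_wpM2r// exprn_ge0.
rewrite -(@ler_pXn2r _ 2)// ?nnegrE//.
- by apply: le_trans h _; rewrite /grid_cst -/K; nra.
- by rewrite mulr_ge0// arc_ge0.
- by rewrite /grid_cst -/K; lra.
Qed.

Lemma card_cell_index m : #|cell_index d m| = (d.+1 * 2 * m.+1 ^ d)%N.
Proof. by rewrite !card_prod card_bool card_ord card_ffun !card_ord. Qed.

Let root_le (A : R) (M : nat) : 0 <= A -> (0 < M)%N -> M%:R <= A ^+ d ->
  1 <= A * M%:R `^ (- d%:R^-1).
Proof.
move=> A0 M0 MA; have MR : 0 < M%:R :> R by rewrite ltr0n.
have dn : d%:R != 0 :> R by rewrite pnatr_eq0 -lt0n.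
rewrite powRN ler_pdivlMr ?powR_gt0// mul1r.
apply: (@le_trans _ _ ((A ^+ d) `^ d%:R^-1)).
  by apply: ge0_ler_powR; rewrite ?nnegrE ?invr_ge0 ?exprn_ge0// ltW.
by rewrite -powR_mulrn// -powRrM mulfV// powRr1.
Qed.

(** There are [2 (d + 1) (m + 1) ^ d] cells of diameter of order [1 / m]; take the
    largest [m] that this count allows. When it does not even allow [m = 1], the
    whole space is a good enough cell. *)
Lemma sphere_covering : exists2 C0 : R, 0 < C0 & forall M, (0 < M)%N ->
  exists (I : finType) (Q : I -> set T), [/\ (#|I| <= M)%N, forall i, measurable (Q i),
    forall x, S x -> exists i, Q i x &
    forall i x y, S x -> S y -> Q i x -> Q i y ->
      arc (dotp x y) <= C0 * M%:R `^ (- d%:R^-1)].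
Proof.
pose D : nat := d.+1.
have G0 : 0 <= grid_cst by rewrite /grid_cst !addr_ge0// ?mulr_ge0// ?addr_ge0// ?mulr_ge0// exprn_ge0.
have pi0 := pi_gt0 R.
have D0 : 0 < D%:R :> R by rewrite ltr0n.
exists ((grid_cst + pi) * (6 * D%:R)); first by rewrite !mulr_gt0//; lra.
move=> M M0; set p := _ `^ _; have p0 : 0 <= p by exact: powR_ge0.
have DD n : (0 < n)%N -> (n <= n ^ d)%N.
  by move=> n0; rewrite -{1}(expn1 n) leq_pexp2l.
have [small|big] := ltnP M (D * 2 * 2 ^ d).
  exists unit, (fun=> setT); split => //; first by rewrite card_unit.
  move=> _ x y _ _ _ _; apply: le_trans (arc_lepi _) _.
  have : 1 <= (4 * D%:R) * p.
    apply: root_le => //.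
    rewrite -(natrM _ 4) -natrX ler_nat; apply: leq_trans (ltnW small) _.
    have -> : (4 * D = (D * 2) * 2)%N by rewrite -mulnA mulnC.
    by rewrite expnMn leq_mul2r (DD (D * 2)%N)// orbT.
  have : 0 <= D%:R * p by rewrite mulr_ge0// ltW.
  move=> h1 h2; rewrite -subr_ge0.
  have -> : (grid_cst + pi) * (6 * D%:R) * p - pi =
    pi * (4 * D%:R * p - 1) + 2 * pi * (D%:R * p) + 6 * grid_cst * (D%:R * p) :> R by lra.
  rewrite !addr_ge0//; [apply: mulr_ge0|apply: mulr_ge0|apply: mulr_ge0] => //; lra.
pose P m := (D * 2 * m.+1 ^ d <= M)%N.
have exP : exists m, P m by exists 1%N.
have bP m : P m -> (m <= M)%N.
  move=> Pm; apply: leq_trans Pm; apply: leq_trans (leqnSn m) _.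
  by apply: leq_trans (DD _ _) _ => //; rewrite leq_pmull.
case: (ex_maxnP exP bP) => m Pm mmax.
have m1 : (0 < m)%N by apply: (mmax 1%N).
have mR : 0 < m%:R :> R by rewrite ltr0n.
exists (cell_index d m), (@cell R d m); split.
- by rewrite card_cell_index.
- exact: measurable_cell.
- exact: cell_cover.
move=> c x y Sx Sy cx cy; have := cell_diameter Sx Sy cx cy.
have Mlt : (M <= D * 2 * m.+2 ^ d)%N.
  by rewrite leqNgt; apply/negP => h; have := mmax m.+1 (ltnW h); rewrite ltnn.
have : 1 <= (6 * D%:R * m%:R) * p.
  apply: root_le => //.
  rewrite -(natrM _ 6) -natrM -natrX ler_nat; apply: leq_trans Mlt _.
  have -> : (6 * D * m = (D * 2) * (3 * m))%N by rewrite mulnA -[(D * 2 * 3)%N]mulnA [(D * _)%N]mulnC.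
  by rewrite expnMn leq_mul ?DD// leq_exp2r// (mulSn 2) -addn2 leq_add2l leq_pmulr.
move=> h1 h2.
rewrite -(ler_pM2r mR); apply: le_trans h2 _.
rewrite -[leLHS]mulr1.
apply: (@le_trans _ _ (grid_cst * (6 * D%:R * m%:R * p))); first by rewrite ler_wpM2l.
rewrite -subr_ge0.
have -> : (grid_cst + pi) * (6 * D%:R) * p * m%:R - grid_cst * (6 * D%:R * m%:R * p) =
  pi * (6 * D%:R) * p * m%:R :> R by lra.
by rewrite !mulr_ge0// ltW.
Qed.

End covering2.

(** * Partitions with small self-energy *)

Section partition.
Context {R : realType} (d : nat).
Hypothesis d0 : (0 < d)%N.
Local Notation T := (d.+1.-tuple R).
Local Notation sigma := (@surface_measure R d).
Local Notation S := (@sphere R d).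

Lemma density_le (g h : T -> R) : measurable_fun setT g -> (forall x, 0 <= g x <= h x) ->
  density h -> density g.
Proof.
move=> mg gh [mh h0 hS [B hB]]; split => //.
- by move=> x; case/andP: (gh x).
- move=> x nS; apply/eqP; rewrite eq_le -{1}(hS x nS) -[X in _ && (X <= _)]/(0 : R).
  by have /andP[-> ->] := gh x.
- by exists B => x; have /andP[_ h1] := gh x; exact: le_trans (hB x).
Qed.

Lemma density_scale (g : T -> R) (c : R) : 0 <= c -> density g -> density (fun x => c * g x).
Proof.
move=> c0 [mg g0 gS [B gB]]; split.
- exact: measurable_funM.
- by move=> x; rewrite mulr_ge0.
- by move=> x /gS ->; rewrite mulr0.
- by exists (c * B) => x; rewrite ler_wpM2l.
Qed.

Lemma mass_scale (g : T -> R) (c : R) : 0 <= c -> density g ->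
  mass (fun x => c * g x) = (c%:E * mass g)%E.
Proof.
by move=> c0 [mg g0 _ _]; exact: integral_EFinZ.
Qed.

Lemma density_sum (I : Type) (r : seq I) (g : I -> T -> R) : (forall i, density (g i)) ->
  density (fun x => \sum_(i <- r) g i x).
Proof.
move=> dg; elim: r => [|i r [m p s [B b]]].
  rewrite (_ : (fun _ => _) = fun=> 0); last by apply/funext => x; rewrite big_nil.
  by split => //; exists 0.
rewrite (_ : (fun _ => _) = fun x => g i x + \sum_(j <- r) g j x); last first.
  by apply/funext => x; rewrite big_cons.
have [mi pi si [Bi bi]] := dg i.
split.
- exact: measurable_funD.
- by move=> x; rewrite addr_ge0.
- by move=> x nS; rewrite si// s// addr0.
- by exists (Bi + B) => x; exact: lerD.
Qed.

Lemma mass_sum (I : Type) (r : seq I) (g : I -> T -> R) : (forall i, density (g i)) ->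
  mass (fun x => \sum_(i <- r) g i x) = (\sum_(i <- r) mass (g i))%E.
Proof.
move=> dg; rewrite /mass -ge0_integral_sum//.
- by apply: eq_integral => x _; rewrite sumEFin.
- by move=> i; apply/measurable_EFinP; case: (dg i).
- by move=> i x _; rewrite lee_fin; case: (dg i).
Qed.

Lemma mass_ge0 (g : T -> R) : density g -> (0 <= mass g)%E.
Proof. by move=> [_ g0 _ _]; apply: integral_ge0 => x _; rewrite lee_fin. Qed.

Lemma mass_fin (g : T -> R) : density g -> mass g \is a fin_num.
Proof.
move=> dg; have [mg g0 _ [B gB]] := dg; rewrite ge0_fin_numE ?mass_ge0//.
apply: (@le_lt_trans _ _ (\int[sigma]_x B%:E)%E); last by rewrite integral_surface_cst ltry.
exact: le_integral_EFin.
Qed.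

(** The potential of [g] is at most [D] on [Q], as it averages distances to points
    of [Q]. *)
Lemma self_energy_le_diameter (g : T -> R) (Q : set T) (D : R) : density g -> mass g = 1%E ->
  0 <= D -> (forall x, ~ Q x -> g x = 0) ->
  (forall x y, S x -> S y -> Q x -> Q y -> arc (dotp x y) <= D) ->
  fine (mutual_energy arc g g) <= D.
Proof.
move=> dg g1 D0 gQ QD; have [mg g0 gS _] := dg.
have mg' : measurable_fun setT (EFin \o g) by exact/measurable_EFinP.
have U x : S x -> Q x -> (potential_of arc g x <= D%:E)%E.
  move=> Sx Qx; rewrite -[leRHS]mule1 -g1 -(mass_scale D0 dg).
  apply: le_integral_EFin => [||y|y].
  - by apply: measurable_funM => //; exact: measurable_arc_dotp.
  - exact: measurable_funM.
  - by rewrite mulr_ge0// arc_ge0.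
  have [Sy|/gS ->] := pselect (S y); last by rewrite !mulr0.
  have [Qy|/gQ ->] := pselect (Q y); last by rewrite !mulr0.
  by rewrite ler_wpM2r// QD.
have U0 x : (0 <= potential_of arc g x)%E by apply: potential_of_ge0 => // t; exact: arc_ge0.
have le : (mutual_energy arc g g <= D%:E)%E.
  rewrite -[leRHS]mule1 -g1 /mass.
  rewrite -(@ge0_integralZl _ _ _ sigma _ measurableT _ mg' D%:E (fun y _ => g0 y) D0).
  apply: ge0_le_integral => //.
  - by move=> y _; rewrite mule_ge0// lee_fin.
  - apply: measurable_cmul => //; apply: measurable_potential_of => //; first exact: measurable_arc.
    by move=> t; exact: arc_ge0.
  - by apply: measurable_funeM; exact/measurable_EFinP.
  move=> x _; rewrite muleC /=.
  have [Sx|/gS ->] := pselect (S x); last by rewrite !mule0.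
  have [Qx|/gQ ->] := pselect (Q x); last by rewrite !mule0.
  by rewrite lee_wpmul2r ?lee_fin// U.
have J0 : (0 <= mutual_energy arc g g)%E.
  by apply: integral_ge0 => x _; rewrite mule_ge0// lee_fin.
rewrite -lee_fin fineK// ge0_fin_numE//; exact: le_lt_trans le (ltry _).
Qed.

End partition.

Section partition.
Context {R : realType} (d : nat).
Hypothesis d0 : (0 < d)%N.
Local Notation T := (d.+1.-tuple R).
Local Notation sigma := (@surface_measure R d).
Local Notation S := (@sphere R d).

Section split.
Variables (I : finType) (Q : I -> set T) (D : R).
Hypothesis mQ : forall i, measurable (Q i).
Hypothesis QS : forall x, S x -> exists i, Q i x.
Hypothesis D0 : 0 <= D.
Hypothesis QD : forall i x y, S x -> S y -> Q i x -> Q i y -> arc (dotp x y) <= D.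

(* The cells may overlap: a point divides its mass equally between the cells that
   contain it. The power -1 is used as an inverse that is known to be measurable. *)
Let overlap (x : T) : R := \sum_i \1_(Q i) x.

Let overlap_ge1 x : S x -> 1 <= overlap x.
Proof.
move=> /QS[i Qi]; rewrite /overlap (bigD1 i)//= indicE mem_set// lerDl.
by apply: sumr_ge0 => j _; rewrite indicE.
Qed.

Let overlap_ge0 x : 0 <= overlap x.
Proof. by apply: sumr_ge0 => j _; rewrite indicE. Qed.

Variable h : T -> R.
Hypothesis dh : density h.

Let share i (x : T) : R := h x * (\1_(Q i) x * overlap x `^ (-1)).

Let sum_share x : \sum_i share i x = h x.
Proof.
rewrite -mulr_sumr -mulr_suml -/(overlap x).
have [Sx|nS] := pselect (S x).
  by rewrite powR_inv1// mulfV ?mulr1// gt_eqF// (lt_le_trans ltr01)// overlap_ge1.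
by case: dh => _ _ -> //; rewrite mul0r.
Qed.

Let share_ge0 i x : 0 <= share i x.
Proof. by case: dh => _ h0 _ _; rewrite mulr_ge0// mulr_ge0// ?powR_ge0// indicE. Qed.

Let density_share i : density (share i).
Proof.
apply: density_le dh.
  have mo : measurable_fun setT overlap by apply: measurable_sum => j; exact: measurable_indic.
  apply: measurable_funM; first by case: dh.
  apply: measurable_funM; first exact: measurable_indic.
  exact: (measurableT_comp (measurable_powR _)).
move=> x; rewrite share_ge0/= -(sum_share x) (bigD1 i)//= lerDl.
exact: sumr_ge0.
Qed.

Let m i : R := fine (mass (share i)).

Let mE i : mass (share i) = (m i)%:E.
Proof. by rewrite fineK// mass_fin. Qed.

Let m0 i : 0 <= m i.
Proof. by rewrite fine_ge0// mass_ge0. Qed.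

Let n i := Num.truncn (m i).

Let nm i : (n i)%:R <= m i.
Proof. by rewrite truncn_le. Qed.

Let mn i : m i < (n i)%:R + 1.
Proof. by rewrite natr1; exact: truncnS_gt. Qed.

(** Each cell of a cover gives up its mass in units, spread proportionally over
    the cell; the leftovers amount to less than one unit per cell. *)
Lemma split_along_cover L : mass h = (L%:R)%:E -> exists (gs : seq (T -> R)) (h' : T -> R) (L' : nat),
  [/\ (size gs + L' = L)%N /\ (L' <= #|I|)%N, density h' /\ mass h' = (L'%:R)%:E,
      forall g, g \in gs -> density g /\ mass g = 1%E,
      forall x, \sum_(g <- gs) g x + h' x = h x &
      forall g, g \in gs -> fine (mutual_energy arc g g) <= D].
Proof.
move=> hL.
have sum_m : \sum_i m i = L%:R.
  apply: EFin_inj; rewrite -hL -sumEFin; under eq_bigr do rewrite -mE.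
  rewrite -mass_sum//; apply: eq_integral => x _; congr EFin; exact: sum_share.
pose phi i x := (m i)^-1 * share i x.
pose r i : R := 1 - (n i)%:R / m i.
have r0 i : 0 <= r i.
  rewrite subr_ge0; have [->|mi] := eqVneq (m i) 0; first by rewrite invr0 mulr0.
  by rewrite ler_pdivrMr ?mul1r// lt_neqAle eq_sym mi/=.
have rm i : r i * m i = m i - (n i)%:R.
  have [mi|mi] := eqVneq (m i) 0; last by rewrite mulrBl mul1r divfK.
  by rewrite mi mulr0; have := nm i; rewrite mi lern0 => /eqP ->; rewrite subr0.
pose h' x := \sum_i (r i * share i x).
have dh' : density h' by apply: density_sum => i; exact: density_scale.
have mh' : mass h' = (L%:R - (\sum_i n i)%:R)%:E.
  have -> : mass h' = (\sum_i (m i - (n i)%:R)%:E)%E.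
    rewrite /h' mass_sum; last by move=> i; exact: density_scale.
    by apply: eq_bigr => i _; rewrite -rm EFinM -mE; exact: mass_scale.
  by rewrite sumEFin big_split/= sumrN sum_m natr_sum.
have nL : (\sum_i n i <= L)%N.
  by rewrite -(ler_nat R) -subr_ge0 -lee_fin -mh' mass_ge0.
(* n i copies of the normalized share of the cell i *)
pose gs := flatten [seq nseq (n i) (phi i) | i <- enum I].
have sgs : size gs = (\sum_i n i)%N.
  rewrite size_flatten /shape -map_comp sumnE big_map big_enum/=.
  by apply: eq_bigr => i _; rewrite size_nseq.
have gsP g : g \in gs -> exists i, g = phi i /\ 1 <= m i.
  move=> /flattenP[s /mapP[i _ ->]]; rewrite mem_nseq => /andP[ni /eqP ->].
  by exists i; split => //; apply: le_trans (nm i); rewrite ler1n.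
have dphi i : density (phi i) by apply: density_scale => //; rewrite invr_ge0.
have phi1 i : 1 <= m i -> mass (phi i) = 1%E.
  move=> mi; rewrite mass_scale ?invr_ge0// mE -EFinM mulVf// gt_eqF//.
  exact: lt_le_trans mi.
exists gs, h', (L - \sum_i n i)%N; split.
- rewrite sgs subnKC//; split => //; rewrite -(ler_nat R) natrB// natr_sum -sum_m -sumrB.
  rewrite -sum1_card natr_sum; apply: ler_sum => i _; rewrite lerBlDl; exact: ltW.
- by rewrite mh' natrB.
- by move=> g /gsP[i [-> mi]]; split => //; exact: phi1.
- move=> x; rewrite /gs big_flatten big_map big_enum/= -[RHS]sum_share -big_split/=.
  apply: eq_bigr => i _; rewrite big_nseq iter_addr_0 /phi -mulrnAl -mulrDl.
  have [mi|mi] := eqVneq (m i) 0; last by rewrite -mulr_natl /r addrC subrK mul1r.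
  have ni : n i = 0%N by apply/eqP; rewrite -(@lern0 R) -[X in _ <= X]mi.
  by rewrite /r ni mulr0n mul0r subr0 add0r mul1r.
- move=> g /gsP[i [-> mi]]; apply: (self_energy_le_diameter (Q := Q i)) => //.
  + exact: phi1.
  + by move=> x nQ; rewrite /phi /share indicE memNset// mul0r !mulr0.
  + exact: QD.
Qed.

End split.

End partition.

Section partition.
Context {R : realType} (d : nat).
Hypothesis d2 : (2 <= d)%N.
Local Notation T := (d.+1.-tuple R).
Local Notation sigma := (@surface_measure R d).
Local Notation S := (@sphere R d).

Let d0 : (0 < d)%N. Proof. exact: ltnW. Qed.

(** The unit pieces cut off with [L / 2] cells have diameter of order
    [L^(-1/d)]; the leftover has at most half of the mass and is cut up in the
    same way, which yields a geometric series because [1/d < 1]. *)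
Lemma low_energy_partition : exists2 C : R, 0 < C & forall L (h : T -> R), (0 < L)%N ->
  density h -> mass h = (L%:R)%:E ->
  exists gs : seq (T -> R), [/\ size gs = L,
    forall g, g \in gs -> density g /\ mass g = 1%E,
    forall x, \sum_(g <- gs) g x <= h x &
    \sum_(g <- gs) fine (mutual_energy arc g g) <= C * L%:R `^ (1 - d%:R^-1)].
Proof.
have [C0 C00 cover] := @sphere_covering R d d0.
have dR : 1 < d%:R :> R by rewrite ltr1n.
have dR0 : 0 < d%:R :> R by rewrite ltr0n.
pose s : R := d%:R^-1.
have s0 : 0 < s by rewrite invr_gt0.
have s1 : s < 1 by rewrite invf_lt1.
pose q : R := 2 `^ (- (1 - s)).
(* the leftover L' <= L / 2 contributes C * L' ^ (1 - s) <= C * q * L ^ (1 - s), and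
   the constant C below is such that C * q + 3 * C0 <= C *)
have q0 : 0 < q by apply: powR_gt0.
have q1 : q < 1.
  rewrite /q powRN invf_lt1 ?powR_gt0// //.
  rewrite [ltLHS](_ : 1 = 1 `^ (1 - s)); last by rewrite powR1.
  by apply: gt0_ltr_powR; rewrite ?subr_gt0 ?nnegrE//; lra.
pose C := (pi + 3 * C0) / (1 - q).
have pi0 := pi_gt0 R.
have CE : C * (1 - q) = pi + 3 * C0 by rewrite /C divfK// subr_eq0 gt_eqF.
have Cq : C * q + 3 * C0 <= C by lra.
have C0' : 0 < C by rewrite divr_gt0 ?subr_gt0//; lra.
have Cq0 : 0 <= C * q by rewrite mulr_ge0// ltW.
have Cpi : pi <= C by lra.
exists C => //; elim/ltn_ind => L IH h L0 dh hL.
have [L1|L2] := leqP L 1.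
  have E : L = 1%N by apply/eqP; rewrite eqn_leq L1.
  exists [:: h]; split.
  - by rewrite E.
  - by move=> g; rewrite inE => /eqP ->; rewrite hL E.
  - by move=> x; rewrite big_seq1.
  rewrite big_seq1 E powR1/= mulr1; apply: le_trans Cpi.
  apply: (self_energy_le_diameter (Q := setT)) => //.
  - by rewrite hL E.
  - exact: ltW.
  - by move=> x nt; case: nt.
  - by move=> *; exact: arc_lepi.
have M0 : (0 < L./2)%N by rewrite half_gt0.
have [I [Q [IM mQ QS QD]]] := cover _ M0.
set D := _ * _ `^ _ in QD.
have D0 : 0 <= D by rewrite mulr_ge0 ?powR_ge0// ltW.
have [gs [h' [L' [[sz L'I] [dh' h'L] gsP sumh gsD]]]] := split_along_cover mQ QS D0 QD dh hL.
(* L <= 3 * (L / 2) also with the quotient rounded down *)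
have LM : L%:R * D <= 3 * C0 * L%:R `^ (1 - s).
  have LR : 0 < L%:R :> R by rewrite ltr0n.
  have MR : 0 < L./2%:R :> R by rewrite ltr0n.
  have L3M : (L <= 3 * L./2)%N.
    by rewrite -[X in (X <= _)%N]odd_double_half -addnn (mulSn 2) mul2n -addnn leq_add2r; case: (odd L).
  have : L%:R `^ s <= 3 * L./2%:R `^ s.
    apply: (@le_trans _ _ ((3 * L./2%:R) `^ s)).
      by apply: ge0_ler_powR; rewrite ?nnegrE ?mulr_ge0 ?(ltW s0)// -natrM ler_nat.
    rewrite powRM// ler_wpM2r ?powR_ge0// -[leRHS](powRr1 (a := 3))// ler_powR//; lra.
  rewrite -ler_pdivrMr ?powR_gt0// => hq.
  rewrite /D (powRN _ s) powRD ?powRr1 ?powRN ?(ltW LR)//; last by rewrite (gt_eqF LR) implybT.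
  have P1 := powR_gt0 s LR; have P2 := powR_gt0 s MR.
  have hB : (L./2%:R `^ s)^-1 <= 3 * (L%:R `^ s)^-1.
    by rewrite ler_pdivlMr// mulrC.
  have := ler_wpM2l (mulr_ge0 (ltW LR) (ltW C00)) hB; lra.
have gsE : \sum_(g <- gs) fine (mutual_energy arc g g) <= 3 * C0 * L%:R `^ (1 - s).
  apply: le_trans LM; apply: (@le_trans _ _ (\sum_(g <- gs) D)).
    by rewrite big_seq [leRHS]big_seq; apply: ler_sum => g /gsD.
  rewrite big_const_seq count_predT iter_addr_0 -[leLHS]mulr_natl ler_wpM2r// ler_nat -sz.
  exact: leq_addr.
have h'0 x : 0 <= h' x by case: dh'.
have L'M : (L' <= L./2)%N by exact: leq_trans IM.
have [L'0|L'0] := posnP L'.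
  exists gs; split => //.
  - by rewrite -sz L'0 addn0.
  - by move=> x; rewrite -sumh lerDl.
  apply: le_trans gsE _; rewrite ler_wpM2r ?powR_ge0//.
  lra.
have L'L : (L' < L)%N by apply: leq_ltn_trans L'M _; rewrite ltn_half_double -addnn -ltn_subLR ?subnn.
have [gs' [sz' gs'P sumh' gs'E]] := IH _ L'L _ L'0 dh' h'L.
exists (gs ++ gs'); split.
- by rewrite size_cat sz'.
- by move=> g; rewrite mem_cat => /orP[/gsP|/gs'P].
- by move=> x; rewrite big_cat/= -sumh lerD2l.
rewrite big_cat/=.
apply: (@le_trans _ _ ((C * q + 3 * C0) * L%:R `^ (1 - s))); last by rewrite ler_wpM2r// powR_ge0.
rewrite mulrDl addrC lerD//; apply: le_trans gs'E _; rewrite -mulrA ler_wpM2l ?(ltW C0')//.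
rewrite /q powRN ler_pdivlMl ?powR_gt0// -powRM//.
apply: ge0_ler_powR; rewrite ?nnegrE ?subr_ge0 ?mulr_ge0 ?(ltW s1)// -natrM ler_nat.
by apply: leq_trans (leq_mul (leqnn 2) L'M) _; rewrite mul2n -[X in (_ <= X)%N]odd_double_half leq_addl.
Qed.

End partition.

(** * Configurations from tangent lines *)

Section tangent.
Context {R : realType} (d : nat).
Hypothesis d2 : (2 <= d)%N.
Local Notation T := (d.+1.-tuple R).
Local Notation sigma := (@surface_measure R d).
Local Notation S := (@sphere R d).

Let d0 : (0 < d)%N. Proof. exact: ltnW. Qed.

Lemma density_sphere (c : R) : 0 <= c -> density (fun x => c * \1_S x) /\
  mass (fun x => c * \1_S x) = c%:E.
Proof.
move=> c0.
have d1 : density (\1_S : T -> R).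
  split.
  - by apply: measurable_indic; exact: measurable_sphere.
  - by move=> x; rewrite indicE.
  - by move=> x nS; rewrite indicE memNset.
  - by exists 1 => x; rewrite indicE lern1 leq_b1.
split; first exact: density_scale.
rewrite (mass_scale c0 d1) /mass integral_indic//; last exact: measurable_sphere.
rewrite setIT [X in (_ * X)%E](_ : _ = 1%E) ?mule1//; exact: surface_measure_sphere.
Qed.

Section kernel.
Variable k : R -> R.
Hypothesis mk : measurable_fun setT k.
Hypothesis k0 : forall t, 0 <= k t.
Variable a : R.
Hypothesis ka : (\int[sigma]_y (k (dotp (pole d) y))%:E = a%:E)%E.

Let mkx (x : T) : measurable_fun setT (fun y : T => k (dotp x y)).
Proof. exact: measurable_comp_dotp. Qed.

Let marcx (x : T) : measurable_fun setT (fun y : T => arc (dotp x y)).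
Proof. exact: measurable_arc_dotp. Qed.

Let kax x : S x -> (\int[sigma]_y (k (dotp x y))%:E = a%:E)%E.
Proof. by move=> Sx; rewrite -ka; exact: integral_sphere_pole. Qed.

Variable g : T -> R.
Hypothesis dg : density g.
Hypothesis g1 : mass g = 1%E.

Let mg : measurable_fun setT g. Proof. by case: dg. Qed.
Let g0 x : 0 <= g x. Proof. by case: dg. Qed.

Let U0 x : (0 <= potential_of k g x)%E.
Proof. exact: potential_of_ge0. Qed.

Let Uarc0 x : (0 <= potential_of arc g x)%E.
Proof. by apply: potential_of_ge0 => // t; exact: arc_ge0. Qed.

Let mU : measurable_fun setT (potential_of k g).
Proof. exact: measurable_potential_of. Qed.

Let mUarc : measurable_fun setT (potential_of arc g).
Proof.
apply: measurable_potential_of => //; first exact: measurable_arc.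
by move=> t; exact: arc_ge0.
Qed.

Let potential_bound (f : R -> R) (A : R) x : measurable_fun setT (fun y : T => f (dotp x y)) ->
  (forall t, 0 <= f t) -> S x -> (\int[sigma]_y (f (dotp x y))%:E <= A%:E)%E ->
  forall B, 0 <= B -> (forall y, g y <= B) -> (potential_of f g x <= (B * A)%:E)%E.
Proof.
move=> mf f0 Sx fA B B0 gB.
apply: (@le_trans _ _ (\int[sigma]_y (B * f (dotp x y))%:E)%E); last first.
  by rewrite integral_EFinZ// EFinM lee_wpmul2l.
apply: le_integral_EFin => [||y|y].
- exact: measurable_funM.
- exact: measurable_funM.
- by rewrite mulr_ge0.
by rewrite mulrC ler_wpM2r.
Qed.

Let energy_fin (f : R -> R) (A : R) : measurable_fun setT f ->
  (forall t, 0 <= f t) -> 0 <= A -> (forall x, S x -> \int[sigma]_y (f (dotp x y))%:E <= A%:E)%E ->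
  mutual_energy f g g \is a fin_num.
Proof.
move=> mf f0 A0 fA; have [_ _ _ [B gB]] := dg.
have B0 : 0 <= B by apply: le_trans (gB (pole d)).
rewrite ge0_fin_numE; last first.
  by apply: integral_ge0 => x _; rewrite mule_ge0 ?lee_fin//; exact: potential_of_ge0.
apply: (@le_lt_trans _ _ (B * A)%:E); last exact: ltry.
apply: density_le_mass1 => //; last 2 first.
- by rewrite mulr_ge0.
- move=> x Sx; apply: potential_bound => //; last exact: fA.
  exact: measurable_comp_dotp.
- exact: measurable_potential_of.
- by move=> x; exact: potential_of_ge0.
Qed.

(** Averaging a linear lower bound of the kernel. It may fail for coinciding
    points, which form a null set. *)
Lemma self_energy_ge_tangent (alpha beta : R) : 0 <= beta ->
  (forall t, 0 < arc t -> alpha - beta * arc t <= k t) ->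
  alpha <= fine (mutual_energy k g g) + beta * fine (mutual_energy arc g g).
Proof.
move=> b0 kab.
have J0 f : (forall t : R, 0 <= f t) -> 0 <= fine (mutual_energy f g g).
  by move=> f0; apply: fine_ge0; apply: integral_ge0 => x _; rewrite mule_ge0 ?lee_fin//; exact: potential_of_ge0.
have [an|ap] := ltP alpha 0.
  apply: le_trans (ltW an) _; rewrite addr_ge0 ?mulr_ge0//; [exact: J0|].
  by apply: J0 => t; exact: arc_ge0.
have fk : mutual_energy k g g \is a fin_num.
  by apply: (energy_fin (A := a)) => //; [rewrite -lee_fin -ka; apply: integral_ge0 => y _; rewrite lee_fin|move=> x /kax ->].
have farc : mutual_energy arc g g \is a fin_num.
  apply: (energy_fin (A := pi)) => //.
  - exact: measurable_arc.
  - by move=> t; exact: arc_ge0.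
  - exact: pi_ge0.
  move=> x Sx; rewrite -(integral_surface_cst d pi).
  by apply: le_integral_EFin => // y; rewrite ?arc_ge0 ?arc_lepi.
have U x : S x -> (alpha%:E <= potential_of k g x + beta%:E * potential_of arc g x)%E.
  move=> Sx; have Z0 := surface_measure_point d0 Sx.
  set Z := [set y | _] in Z0.
  have mZ : measurable Z by exact: (measurable_le_set _ (measurable_arc_dotp _)).
  have marcg : measurable_fun setT (fun y => arc (dotp x y) * g y) by exact: measurable_funM.
  have mkg : measurable_fun setT (fun y => k (dotp x y) * g y) by exact: measurable_funM.
  have mbg : measurable_fun setT (fun y => beta * (arc (dotp x y) * g y)) by exact: measurable_funM.
  have arcg0 y : 0 <= arc (dotp x y) * g y by rewrite mulr_ge0// arc_ge0.
  have kg0 y : 0 <= k (dotp x y) * g y by rewrite mulr_ge0.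
  have bg0 y : 0 <= beta * (arc (dotp x y) * g y) by rewrite mulr_ge0.
  rewrite -[leLHS]mule1 -g1 -(mass_scale ap dg) /mass /potential_of.
  rewrite -(integral_EFinZ _ marcg arcg0 b0) -(integral_EFinD _ mkg mbg kg0 bg0).
  have mag : measurable_fun setT (fun y => (alpha * g y)%:E : \bar R).
    by apply/measurable_EFinP; exact: measurable_funM.
  have msum : measurable_fun setT (fun y => (k (dotp x y) * g y +
      beta * (arc (dotp x y) * g y))%:E : \bar R).
    by apply/measurable_EFinP; exact: measurable_funD.
  rewrite (ge0_negligible_integral mZ measurableT mag _ Z0); last first.
    by move=> y _; rewrite lee_fin mulr_ge0.
  rewrite [leRHS](ge0_negligible_integral mZ measurableT msum _ Z0); last first.
    by move=> y _; rewrite lee_fin addr_ge0.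
  apply: ge0_le_integral => //.
  - exact: measurableD.
  - by move=> y _; rewrite lee_fin mulr_ge0.
  - exact: measurable_funS mag.
  - exact: measurable_funS msum.
  move=> y [_ nZ]; rewrite lee_fin mulrA -mulrDl ler_wpM2r// -lerBlDr.
  by apply: kab; rewrite ltNge; apply/negP.
rewrite -lee_fin EFinD EFinM (fineK fk) (fineK farc).
have mgU : measurable_fun setT (fun x => (g x)%:E * potential_of k g x)%E by exact: measurable_cmul.
have mgUa : measurable_fun setT (fun x => (g x)%:E * potential_of arc g x)%E by exact: measurable_cmul.
have gU0 x : (0 <= (g x)%:E * potential_of k g x)%E by rewrite mule_ge0 ?lee_fin.
have gUa0 x : (0 <= (g x)%:E * potential_of arc g x)%E by rewrite mule_ge0 ?lee_fin.
have mg' : measurable_fun setT (EFin \o g) by exact/measurable_EFinP.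
have mbgUa : measurable_fun setT (fun x => beta%:E * ((g x)%:E * potential_of arc g x))%E by exact: measurable_funeM.
have bgUa0 x : (0 <= beta%:E * ((g x)%:E * potential_of arc g x))%E by rewrite mule_ge0 ?lee_fin.
rewrite /mutual_energy -(@ge0_integralZl _ _ _ sigma _ measurableT _ mgUa beta%:E (fun y _ => gUa0 y) b0).
rewrite -(@ge0_integralD _ _ _ sigma _ measurableT _ _ (fun y _ => gU0 y) mgU (fun y _ => bgUa0 y) mbgUa).
rewrite -[leLHS]mule1 -g1 /mass.
rewrite -(@ge0_integralZl _ _ _ sigma _ measurableT _ mg' alpha%:E (fun y _ => g0 y) ap).
apply: ge0_le_integral => //.
- by move=> y _; rewrite mule_ge0 ?lee_fin.
- exact: measurable_funeM.
- exact: emeasurable_funD.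
move=> x _ /=; rewrite muleCA -ge0_muleDr ?mule_ge0 ?lee_fin// muleC.
have [Sx|nS] := pselect (S x); first by rewrite lee_wpmul2l ?lee_fin// U.
by case: dg => _ _ -> // _; rewrite !mul0e.
Qed.

End kernel.
End tangent.

Section configurations.
Context {R : realType} (d : nat).
Hypothesis d2 : (2 <= d)%N.
Local Notation T := (d.+1.-tuple R).
Local Notation sigma := (@surface_measure R d).
Local Notation S := (@sphere R d).

Let d0 : (0 < d)%N. Proof. exact: ltnW. Qed.

Let tangent_le (n v w c b A A' B : R) :
  n * (v + b * (c * w)) <= B + b * A' -> A' = A -> b * A <= b * (c * (n * w)) -> n * v <= B.
Proof. by move=> h1 E h2; rewrite E in h1; lra. Qed.

(** The hypothesis on [k] says that [v] is the value at [C * N ^ (- 1 / d)] of a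
    linear lower bound of [k] as a function of the distance. The sum of the
    self-energies is then at least [N] times the value of this line at the average
    of the mean distances, which the partition of [N] times the uniform measure
    keeps below [C * N ^ (- 1 / d)]. *)
Lemma tangent_configuration : exists2 C : R, 0 < C & forall N (k : R -> R) (a beta v e : R),
  (0 < N)%N -> measurable_fun setT k -> (forall t, 0 <= k t) ->
  (\int[sigma]_y (k (dotp (pole d) y))%:E = a%:E)%E -> 0 <= beta -> 0 < e ->
  (forall t, 0 < arc t -> v - beta * (arc t - C * N%:R `^ (- d%:R^-1)) <= k t) ->
  exists2 z : 'I_N -> T, configuration d N z &
    2 * (\sum_(p <- pairs N) k (dotp (z p.1) (z p.2))) + N%:R * v <= N%:R ^+ 2 * a + e.
Proof.
have [C C0 part] := @low_energy_partition R d d2; exists C => // N k a beta v e N0 mk k0 ka b0 e0 kv.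
have [dh hN] := @density_sphere R d N%:R (ler0n _ _).
have [gs [sz gsP gsN gsE]] := part N _ N0 dh hN.
pose g (i : 'I_N) := nth (fun=> 0) gs i.
have sumE (F : (T -> R) -> R) : \sum_(i < N) F (g i) = \sum_(x <- gs) F x.
  by rewrite (big_nth (fun=> 0)) big_mkord sz.
have gP i : g i \in gs by rewrite mem_nth// sz.
have dg i : density (g i) by case: (gsP _ (gP i)).
have g1 i : mass (g i) = 1%E by case: (gsP _ (gP i)).
have gN x : \sum_(i < N) g i x <= N%:R.
  rewrite (sumE (fun f => f x)); apply: le_trans (gsN x) _.
  by rewrite indicE -[leRHS]mulr1 ler_wpM2l// lern1 leq_b1.
have [z cz zle] := random_configuration d0 mk k0 ka dg g1 gN e0.
exists z => //; apply: le_trans zle; rewrite lerD2l.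
have selfE i : v + beta * (C * N%:R `^ (- d%:R^-1)) <=
    fine (mutual_energy k (g i) (g i)) + beta * fine (mutual_energy arc (g i) (g i)).
  apply: (self_energy_ge_tangent d2 mk k0 ka (dg i) (g1 i) b0) => t t0.
  by apply: le_trans (kv t t0); lra.
have : \sum_(i < N) (v + beta * (C * N%:R `^ (- d%:R^-1))) <=
  \sum_(i < N) (fine (mutual_energy k (g i) (g i)) + beta * fine (mutual_energy arc (g i) (g i))).
  by apply: ler_sum => i _.
rewrite sumr_const card_ord -[leLHS]mulr_natl big_split/= -mulr_sumr.
have /= E := sumE (fun f => fine (mutual_energy arc f f)).
have NR : 0 < N%:R :> R by rewrite ltr0n.
have : beta * \sum_(x <- gs) fine (mutual_energy arc x x) <= beta * (C * (N%:R * N%:R `^ (- d%:R^-1))).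
  rewrite ler_wpM2l//; apply: le_trans gsE _.
  rewrite powRD ?powRr1 ?(ltW NR)//; by rewrite (gt_eqF NR) implybT.
by move=> h2 h1; exact: (tangent_le h1 E h2).
Qed.

Lemma ge0_eq_integral_sphere (f f' : T -> \bar R) : measurable_fun setT f ->
  measurable_fun setT f' -> (forall x, 0 <= f x)%E -> (forall x, 0 <= f' x)%E ->
  (forall x, S x -> f x = f' x) -> (\int[sigma]_x f x = \int[sigma]_x f' x)%E.
Proof.
move=> mf mf' f0 f0' ff'; have mC := measurableC (@measurable_sphere R d).
have Z := @surface_measure_sphereC R d.
rewrite (ge0_negligible_integral mC measurableT mf (fun x _ => f0 x) Z).
rewrite [RHS](ge0_negligible_integral mC measurableT mf' (fun x _ => f0' x) Z).
apply: eq_integral => x; rewrite inE => -[_ nSx]; apply: ff'.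
exact: contrapT.
Qed.

(** All points are drawn from the uniform measure, whose self-energy is [a]. *)
Lemma uniform_configuration N (k : R -> R) (a e : R) :
  measurable_fun setT k -> (forall t, 0 <= k t) ->
  (\int[sigma]_y (k (dotp (pole d) y))%:E = a%:E)%E -> 0 < e ->
  exists2 z : 'I_N -> T, configuration d N z &
    2 * (\sum_(p <- pairs N) k (dotp (z p.1) (z p.2))) + N%:R * a <= N%:R ^+ 2 * a + e.
Proof.
move=> mk k0 ka e0; have [d1 m1] := @density_sphere R d 1 ler01.
set g := fun x => _ in d1 m1.
have gN x : \sum_(i < N) g x <= N%:R.
  by rewrite sumr_const card_ord -[leLHS]mulr_natl -[leRHS]mulr1 ler_wpM2l// /g mul1r indicE lern1 leq_b1.
have [z cz zle] := random_configuration d0 mk k0 ka (fun=> d1) (fun=> m1) gN e0.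
exists z => //; apply: le_trans zle; rewrite lerD2l sumr_const card_ord -[leRHS]mulr_natl.
rewrite ler_wpM2l//.
suff -> : mutual_energy k g g = a%:E by [].
have g1 x : S x -> g x = 1 by move=> Sx; rewrite /g indicE mem_set// mulr1.
have [mg g0 _ _] := d1.
have mkx (x : T) := measurable_comp_dotp x mk.
have U x : S x -> potential_of k g x = a%:E.
  move=> Sx; rewrite -ka -(integral_sphere_pole mk Sx).
  apply: ge0_eq_integral_sphere.
  - by apply/measurable_EFinP; exact: measurable_funM.
  - exact/measurable_EFinP.
  - by move=> y; rewrite lee_fin mulr_ge0.
  - by move=> y; rewrite lee_fin.
  by move=> y /g1 ->; rewrite mulr1.
have a0 : (0 <= a%:E)%E by rewrite -ka; apply: integral_ge0 => y _; rewrite lee_fin.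
transitivity (\int[sigma]_x ((g x)%:E * a%:E))%E.
  apply: ge0_eq_integral_sphere.
  - by apply: measurable_cmul => //; exact: measurable_potential_of.
  - exact: measurable_cmul.
  - by move=> x; rewrite mule_ge0 ?lee_fin//; exact: potential_of_ge0.
  - by move=> x; rewrite mule_ge0 ?lee_fin.
  by move=> x Sx; rewrite U.
under eq_integral do rewrite muleC.
have mg' : measurable_fun setT (EFin \o g) by exact/measurable_EFinP.
rewrite (@ge0_integralZl _ _ _ sigma _ measurableT _ mg' a%:E (fun y _ => g0 y) a0).
by rewrite -[X in (_ * X)%E]/(mass g) m1 mule1.
Qed.


End configurations.

(** * Convexity of the potentials *)

Section tangent_lines.
Context {R : realType}.
Implicit Types (delta rho a y : R).

Lemma ln_le_sub1 y : 0 < y -> ln y <= y - 1.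
Proof. by move=> y0; have := @le_ln1Dx R (y - 1); rewrite subrKC; apply; lra. Qed.

Lemma powR_expR_ln y delta : 0 < y -> y `^ delta = expR (delta * ln y).
Proof. by move=> y0; rewrite /powR gt_eqF. Qed.

Lemma bernoulli_neg delta y : delta <= 0 -> 0 < y -> 1 + delta * (y - 1) <= y `^ delta.
Proof.
move=> d0 y0; rewrite powR_expR_ln//; apply: le_trans (expR_ge1Dx _).
by rewrite lerD2l ler_wnM2l// ln_le_sub1.
Qed.

Lemma bernoulli_pos delta y : 0 <= delta <= 1 -> 0 < y -> y `^ delta <= 1 + delta * (y - 1).
Proof.
move=> /andP[d0 d1] y0; rewrite powR_expR_ln//; set L := ln y.
have e1 := expR_ge1Dx (- (delta * L)); have e2 := expR_ge1Dx ((1 - delta) * L).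
have eL : expR ((1 - delta) * L) * expR (delta * L) = y.
  by rewrite -expRD -mulrDl subrK mul1r /L lnK.
have e3 : expR (- (delta * L)) * expR (delta * L) = 1 by rewrite -expRD addNr expR0.
have E0 := expR_gt0 (delta * L).
(* after division by y ^ delta, the claim is a weighted mean of two instances of
   1 + x <= exp x in which the linear terms cancel *)
have h : 1 <= (1 - delta) * expR (- (delta * L)) + delta * expR ((1 - delta) * L).
  apply: (@le_trans _ _ ((1 - delta) * (1 + - (delta * L)) + delta * (1 + (1 - delta) * L))).
    lra.
  by apply: lerD; rewrite ler_wpM2l// subr_ge0.
have : 1 * expR (delta * L) <= ((1 - delta) * expR (- (delta * L)) + delta * expR ((1 - delta) * L)) * expR (delta * L).
  by rewrite ler_wpM2r// ltW.
rewrite mul1r mulrDl -!mulrA e3 eL; lra.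
Qed.

Lemma powR_tangent delta rho a : 0 < a -> 0 < rho ->
  rho `^ delta = a `^ delta * (rho / a) `^ delta.
Proof.
move=> a0 r0; rewrite -powRM ?ltW ?divr_gt0//.
by rewrite mulrC divfK// gt_eqF.
Qed.

Lemma tangent_neg delta rho a : delta <= 0 -> 0 < a -> 0 < rho ->
  a `^ delta - (- delta * a `^ delta / a) * (rho - a) <= rho `^ delta.
Proof.
move=> d0 a0 r0; rewrite (powR_tangent delta a0 r0).
apply: (@le_trans _ _ (a `^ delta * (1 + delta * (rho / a - 1)))); last first.
  by rewrite ler_wpM2l ?powR_ge0// bernoulli_neg// divr_gt0.
have aa : a / a = 1 by rewrite divff// gt_eqF.
have -> : - delta * a `^ delta / a * (rho - a) = - delta * a `^ delta * (rho / a - a / a) by lra.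
by rewrite aa; lra.
Qed.

Lemma tangent_pos delta rho a : 0 <= delta <= 1 -> 0 < a -> 0 < rho ->
  rho `^ delta <= a `^ delta + (delta * a `^ delta / a) * (rho - a).
Proof.
move=> d0 a0 r0; rewrite (powR_tangent delta a0 r0).
apply: (@le_trans _ _ (a `^ delta * (1 + delta * (rho / a - 1)))).
  by rewrite ler_wpM2l ?powR_ge0// bernoulli_pos// divr_gt0.
have aa : a / a = 1 by rewrite divff// gt_eqF.
have -> : delta * a `^ delta / a * (rho - a) = delta * a `^ delta * (rho / a - a / a) by lra.
by rewrite aa; lra.
Qed.

Lemma tangent_log rho a : 0 < a -> 0 < rho ->
  ln (pi / a) - a^-1 * (rho - a) <= ln (pi / rho).
Proof.
move=> a0 r0; have p0 := pi_gt0 R.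
rewrite !ln_div ?posrE//.
have := @ln_le_sub1 (rho / a) (divr_gt0 r0 a0); rewrite ln_div ?posrE//.
have aa : a^-1 * a = 1 by rewrite mulVf// gt_eqF.
by rewrite mulrBr aa; lra.
Qed.

End tangent_lines.

(** * The order of the energy gap *)

Section gaps.
Context {R : realType} (d : nat).
Local Notation T := (d.+1.-tuple R).

Lemma scale_pair_sum (x : R) (N : nat) : (0 < N)%N ->
  N%:R ^+ 2 * (2 / N%:R ^+ 2 * x) = 2 * x.
Proof. by move=> N0; rewrite mulrA mulrCA divff ?mulr1// expf_neq0// pnatr_eq0 -lt0n. Qed.

(** Optimal energies being infima or suprema, near-optimal configurations up to an
    arbitrary [e] determine them. *)
Lemma gap_inf delta (N : nat) (m lo up : R) : delta <= 0 -> (0 < N)%N ->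
  mean_potential d delta = m%:E ->
  (forall z : 'I_N -> T, configuration d N z ->
    m <= 2 / N%:R ^+ 2 * discrete_energy delta z + up) ->
  (forall e, 0 < e -> exists2 z : 'I_N -> T, configuration d N z &
    2 * discrete_energy delta z + N%:R ^+ 2 * lo <= N%:R ^+ 2 * m + e) ->
  (lo%:E <= energy_gap d delta N <= up%:E)%E.
Proof.
move=> dle N0 mE hup hlo; rewrite /energy_gap energy_integralE mE /optimal_energy dle.
set A := [set _ | _ in _].
have NR : 0 < N%:R ^+ 2 :> R by rewrite exprn_gt0// ltr0n.
have scale x := scale_pair_sum x N0.
have lb : (((N%:R ^+ 2 * (m - up)) / 2)%:E <= ereal_inf A)%E.
  apply: le_ereal_inf_tmp => _ [z cz <-]; rewrite lee_fin ler_pdivrMr//.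
  have := hup z cz; rewrite -lerBlDr -(ler_pM2l NR) scale; lra.
have ub : forall e, 0 < e -> (ereal_inf A <= ((N%:R ^+ 2 * (m - lo) + e) / 2)%:E)%E.
  move=> e /hlo[z cz ze]; apply: (@le_trans _ _ (discrete_energy delta z)%:E).
    by apply: ereal_inf_lbound; exists z.
  by rewrite lee_fin ler_pdivlMr//; lra.
have fin : ereal_inf A \is a fin_num.
  rewrite fin_numE; apply/andP; split; apply/eqP => h.
    by move: lb; rewrite h leeNy_eq.
  by have := ub 1 ltr01; rewrite h leye_eq.
rewrite -(fineK fin) -EFinM -EFinB !lee_fin.
rewrite -(fineK fin) lee_fin ler_pdivrMr// in lb.
set v := fine _ in lb *.
have ub' : 2 * v <= N%:R ^+ 2 * (m - lo).
  apply/ler_addgt0Pr => e /ub; rewrite -(fineK fin) lee_fin ler_pdivlMr// -/v; lra.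
apply/andP; split; rewrite -(ler_pM2l NR) mulrBr scale; lra.
Qed.

Lemma gap_sup delta (N : nat) (m lo up : R) : 0 < delta -> (0 < N)%N ->
  mean_potential d delta = m%:E ->
  (forall z : 'I_N -> T, configuration d N z ->
    2 / N%:R ^+ 2 * discrete_energy delta z + lo <= m) ->
  (forall e, 0 < e -> exists2 z : 'I_N -> T, configuration d N z &
    N%:R ^+ 2 * m <= 2 * discrete_energy delta z + N%:R ^+ 2 * up + e) ->
  (lo%:E <= energy_gap d delta N <= up%:E)%E.
Proof.
move=> dgt N0 mE hlo hup; rewrite /energy_gap energy_integralE mE /optimal_energy (lt_geF dgt).
set A := [set _ | _ in _].
have NR : 0 < N%:R ^+ 2 :> R by rewrite exprn_gt0// ltr0n.
have scale x := scale_pair_sum x N0.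
have ub : (ereal_sup A <= ((N%:R ^+ 2 * (m - lo)) / 2)%:E)%E.
  apply: ge_ereal_sup => _ [z cz <-]; rewrite lee_fin ler_pdivlMr//.
  have := hlo z cz; rewrite -lerBrDr -(ler_pM2l NR) scale; lra.
have lb : forall e, 0 < e -> (((N%:R ^+ 2 * (m - up) - e) / 2)%:E <= ereal_sup A)%E.
  move=> e /hup[z cz ze]; apply: (@le_trans _ _ (discrete_energy delta z)%:E).
    by rewrite lee_fin ler_pdivrMr//; lra.
  by apply: ereal_sup_ubound; exists z.
have fin : ereal_sup A \is a fin_num.
  rewrite fin_numE; apply/andP; split; apply/eqP => h.
    by have := lb 1 ltr01; rewrite h leeNy_eq.
  by move: ub; rewrite h leye_eq.
rewrite -(fineK fin) -EFinM -EFinB !lee_fin.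
rewrite -(fineK fin) lee_fin ler_pdivlMr// in ub.
set v := fine _ in ub *.
have lb' : N%:R ^+ 2 * (m - up) <= 2 * v.
  apply/ler_addgt0Pr => e /lb; rewrite -(fineK fin) lee_fin ler_pdivrMr// -/v; lra.
apply/andP; split; rewrite -(ler_pM2l NR) mulrBr scale; lra.
Qed.

End gaps.

Section order.
Context {R : realType} (d : nat).
Hypothesis d2 : (2 <= d)%N.
Local Notation T := (d.+1.-tuple R).
Local Notation sigma := (@surface_measure R d).

Let d0 : (0 < d)%N. Proof. exact: ltnW. Qed.

Let configuration1 : configuration d 1 (fun=> @pole R d).
Proof. by split=> [i j _|_]; [rewrite !ord1|exact: sphere_pole]. Qed.

Let mean_fin (delta x : R) : (mean_potential d delta <= x%:E)%E ->
  mean_potential d delta = (fine (mean_potential d delta))%:E.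
Proof.
move=> h; have m0 : (0 <= mean_potential d delta)%E.
  by apply: integral_ge0 => y _; rewrite lee_fin rpot_ge0.
by rewrite fineK// ge0_fin_numE//; exact: le_lt_trans h (ltry _).
Qed.

Let tangent_value (N : nat) (C delta : R) : 0 < C -> (0 < N)%N ->
  N%:R * (C * N%:R `^ (- d%:R^-1)) `^ delta =
  N%:R ^+ 2 * (C `^ delta * N%:R `^ (- 1 - delta / d%:R)).
Proof.
move=> C0 N0; have NR : 0 < N%:R :> R by rewrite ltr0n.
rewrite powRM ?powR_ge0 ?(ltW C0)// -powRrM.
have -> : - d%:R^-1 * delta = 1 + (-1 - delta / d%:R) by lra.
rewrite powRD; last by rewrite (gt_eqF NR) implybT.
by rewrite powRr1 ?(ltW NR)//; lra.
Qed.

Lemma order_neg (delta : R) : - d%:R < delta -> delta < 0 ->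
  same_order (energy_gap d delta) (fun N : nat => N%:R `^ (- 1 - delta / d%:R)).
Proof.
move=> dd dn; have [K K0 hK] := energy_ge_neg d0 dd dn.
have [C C0 tan] := @tangent_configuration R d d2.
have mE := mean_fin (hK 1%N _ isT configuration1).
set m := fine _ in mE.
exists (C `^ delta), K; split => //; first exact: powR_gt0.
move=> N N2; have N0 : (0 < N)%N by exact: ltnW.
apply: (gap_inf (ltW dn) N0 mE) => [z cz|e e0].
  by have := hK N z N0 cz; rewrite mE lee_fin.
set a := C * N%:R `^ (- d%:R^-1).
have a0 : 0 < a by rewrite mulr_gt0// powR_gt0// ltr0n.
have b0 : 0 <= - delta * a `^ delta / a.
  by rewrite divr_ge0 ?(ltW a0)// mulr_ge0 ?powR_ge0// oppr_ge0 ltW.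
have [t t0|z cz zle] := tan N (rpot delta) m _ (a `^ delta) e N0 (measurable_rpot delta) (rpot_ge0 delta) mE b0 e0.
  by rewrite /rpot /radial (lt_eqF dn); exact: (tangent_neg (ltW dn)).
exists z => //; case: cz => _ Sz.
by rewrite discrete_energyE// -tangent_value.
Qed.

(** The supremum problem for [rho ^ delta] is the infimum problem for the convex
    nonnegative kernel [pi ^ delta - rho ^ delta]. *)
Lemma order_pos (delta : R) : 0 < delta < 1 ->
  same_order (energy_gap d delta) (fun N : nat => N%:R `^ (- 1 - delta / d%:R)).
Proof.
move=> d01; have /andP[dp d1] := d01; have [K K0 hK] := energy_le_pos d0 d01.
have dn0 : (delta == 0) = false by rewrite gt_eqF.
have [C C0 tan] := @tangent_configuration R d d2.
have p0 := pi_ge0 R; set P := pi `^ delta.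
have P0 : 0 <= P by exact: powR_ge0.
have rP t : rpot delta t <= P.
  rewrite /rpot /radial dn0; apply: ge0_ler_powR; rewrite ?nnegrE ?arc_ge0 ?arc_lepi//.
  exact: ltW.
pose k t := P - rpot delta t.
have mk : measurable_fun setT k by apply: measurable_funB => //; exact: measurable_rpot.
have k0 t : 0 <= k t by rewrite subr_ge0.
have meanE : (mean_potential d delta + \int[sigma]_y (k (dotp (pole d) y))%:E = P%:E)%E.
  rewrite /mean_potential -ge0_integralD//.
  - under eq_integral do rewrite -EFinD addrC subrK.
    exact: integral_surface_cst.
  - by move=> y _; rewrite lee_fin rpot_ge0.
  - exact: measurable_rpot_dotp.
  - by move=> y _; rewrite lee_fin.
  - by apply/measurable_EFinP; apply: (measurableT_comp mk); exact: measurable_dotp.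
have ik0 : (0 <= \int[sigma]_y (k (dotp (pole d) y))%:E)%E.
  by apply: integral_ge0 => y _; rewrite lee_fin.
have mE : mean_potential d delta = (fine (mean_potential d delta))%:E.
  by apply: (@mean_fin _ P); rewrite -meanE leeDl.
set m := fine _ in mE.
have kE : (\int[sigma]_y (k (dotp (pole d) y))%:E = (P - m)%:E)%E.
  by rewrite EFinB -meanE -mE addeAC subee ?add0e// mE.
exists K, (C `^ delta); split => //; first exact: powR_gt0.
move=> N N2; have N0 : (0 < N)%N by exact: ltnW.
apply: (gap_sup dp N0 mE) => [z cz|e e0].
  by have := hK N z N0 cz; rewrite mE lee_fin.
set a := C * N%:R `^ (- d%:R^-1).
have a0 : 0 < a by rewrite mulr_gt0// powR_gt0// ltr0n.
have b0 : 0 <= delta * a `^ delta / a.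
  by rewrite divr_ge0 ?(ltW a0)// mulr_ge0 ?powR_ge0// ltW.
have [t t0|z cz zle] := tan N k (P - m) _ (P - a `^ delta) e N0 mk k0 kE b0 e0.
  rewrite /k /rpot /radial dn0.
  have := @tangent_pos R delta (arc t) a; rewrite (ltW dp) (ltW d1) => /(_ isT a0 t0).
  by rewrite -/a; lra.
exists z => //; case: cz => _ Sz.
have cst : N%:R ^+ 2 * (2 / N%:R ^+ 2 * (\sum_(p <- pairs N) P)) = N%:R ^+ 2 * P - N%:R * P.
  rewrite scale_pair_sum//.
  have -> : \sum_(p <- pairs N) P = (\sum_(p <- pairs N) 1) * P.
    by rewrite mulr_suml; apply: eq_bigr => p _; rewrite mul1r.
  by rewrite (@card_pairs R N); lra.
rewrite discrete_energyE// -tangent_value// -/a.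
move: zle; rewrite big_split/= sumrN; rewrite scale_pair_sum// in cst; lra.
Qed.

(** The tangent line at [C N ^ (- 1 / d)] has value [v N = ln (pi / C) + ln N / d]
    there, which is of order [ln N] once [N] is large. Uniformly distributed points
    take care of the finitely many other [N]: they give a gap of at least [m / N],
    where [m] is the mean potential. *)
Lemma order_zero : same_order (energy_gap d (0 : R)) (fun N : nat => N%:R^-1 * ln N%:R).
Proof.
have [K K0 hK] := @energy_ge_zero R d d0.
have [C C0 tan] := @tangent_configuration R d d2.
have mE := mean_fin (hK 1%N _ isT configuration1).
set m := fine _ in mE.
have p0 := pi_gt0 R.
have dR : 0 < d%:R :> R by rewrite ltr0n.
pose v (N : nat) : R := ln (pi / C) + ln N%:R / d%:R.
have tanN N e : (0 < N)%N -> 0 < e -> exists2 z : 'I_N -> T, configuration d N z &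
    2 * discrete_energy 0 z + N%:R * v N <= N%:R ^+ 2 * m + e.
  move=> N0 e0; have NR : 0 < N%:R :> R by rewrite ltr0n.
  set a := C * N%:R `^ (- d%:R^-1).
  have a0 : 0 < a by rewrite mulr_gt0// powR_gt0// ltr0n.
  have b0 : 0 <= a^-1 by rewrite invr_ge0 ltW.
  have va : v N = ln (pi / a).
    rewrite /v !ln_div ?posrE// lnM ?posrE ?powR_gt0// ln_powR; lra.
  have [t t0|z cz zle] := tan N (rpot 0) m _ (v N) e N0 (measurable_rpot 0) (rpot_ge0 0) mE b0 e0.
    by rewrite /rpot /radial eqxx va; exact: tangent_log.
  by exists z => //; case: cz => _ Sz; rewrite discrete_energyE.
have uniN N e : 0 < e -> exists2 z : 'I_N -> T, configuration d N z &
    2 * discrete_energy 0 z + N%:R * m <= N%:R ^+ 2 * m + e.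
  move=> e0.
  have [z cz zle] := uniform_configuration d2 N (measurable_rpot 0) (rpot_ge0 0) mE e0.
  by exists z => //; case: cz => _ Sz; rewrite discrete_energyE.
pose K1 : R := `|ln (pi / C)| + 1.
have K10 : 0 < K1 by rewrite ltr_wpDl.
have K1C : - ln (pi / C) <= K1 by have := ler_norm (- ln (pi / C)); rewrite normrN /K1; lra.
have vN N : 2 * d%:R * K1 <= ln N%:R -> (2 * d%:R)^-1 * ln N%:R <= v N.
  rewrite -ler_pdivlMl ?mulr_gt0// => h.
  rewrite /v.
  have E : ln N%:R / d%:R = 2 * ((2 * d%:R)^-1 * ln N%:R) :> R.
    have := @invfM R 2 d%:R. lra.
  by rewrite E; lra.
(* since discrete energies are nonnegative, m is at least the lower bound v N / N
   for the gap, which is positive for large N *)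
have m0 : 0 < m.
  pose N := (Num.truncn (expR (2 * d%:R * K1))).+1.
  have NR : 0 < N%:R :> R by rewrite ltr0n.
  have lnN : 2 * d%:R * K1 <= ln N%:R.
    by rewrite -ler_expR lnK ?posrE//; exact/ltW/truncnS_gt.
  have vpos : 0 < N%:R * v N.
    rewrite mulr_gt0//; apply: lt_le_trans (vN _ lnN); rewrite mulr_gt0 ?invr_gt0 ?mulr_gt0//.
    by apply: lt_le_trans lnN; rewrite !mulr_gt0.
  have [z [_ Sz] zle] := tanN N (N%:R * v N / 2) isT (divr_gt0 vpos (ltr0Sn _ _)).
  have E0 : 0 <= discrete_energy 0 z.
    by rewrite discrete_energyE//; apply: sumr_ge0 => p _; exact: rpot_ge0.
  have : 0 < N%:R ^+ 2 * m by lra.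
  by rewrite pmulr_rgt0// exprn_gt0.
have ln20 : 0 < ln 2 :> R by rewrite ln_gt0// ltr1n.
pose c : R := Num.min (2 * d%:R)^-1 (m / (2 * d%:R * K1)).
exists c, (K * (1 + (ln 2)^-1)); split.
- by rewrite /c lt_min invr_gt0 divr_gt0 ?mulr_gt0.
- by rewrite mulr_gt0// addr_gt0// invr_gt0.
move=> N N2; have N0 : (0 < N)%N by exact: ltnW.
have NR : 0 < N%:R :> R by rewrite ltr0n.
have lnN : ln 2 <= ln N%:R :> R by rewrite ler_ln ?posrE// ler_nat.
apply: (gap_inf (lexx _) N0 mE) => [z cz|e e0].
  have := hK N z N0 cz; rewrite mE lee_fin => h; apply: le_trans h _; rewrite lerD2l -mulrA ler_wpM2l ?(ltW K0)//.
  rewrite mulrCA ler_wpM2l ?invr_ge0 ?(ltW NR)// mulrDl mul1r addrC lerD2l.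
  by rewrite ler_pdivlMl// mulr1.
have NN : N%:R ^+ 2 * (c * (N%:R^-1 * ln N%:R)) = N%:R * (c * ln N%:R).
  by rewrite expr2 -!mulrA; congr (_ * _); rewrite mulrCA mulVKf// gt_eqF.
have lnN0 : 0 <= ln N%:R :> R by exact: le_trans (ltW ln20) lnN.
have [big|small] := lerP (2 * d%:R * K1) (ln N%:R).
  have [z cz zle] := tanN N e N0 e0; exists z => //; apply: le_trans zle.
  rewrite NN lerD2l ler_pM2l//; apply: le_trans (vN _ big).
  by rewrite ler_wpM2r// /c ge_min lexx.
have [z cz zle] := uniN N e e0; exists z => //; apply: le_trans zle.
rewrite NN lerD2l ler_pM2l//.
apply: (@le_trans _ _ (m / (2 * d%:R * K1) * ln N%:R)).
  by rewrite ler_wpM2r// /c ge_min lexx orbT.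
rewrite -mulrA -[leRHS]mulr1 ler_wpM2l ?(ltW m0)// mulrC ler_pdivrMr ?mulr_gt0// mul1r.
exact: ltW.
Qed.

End order.

Theorem theorem5p2 (R : realType) (d : nat) (d_ge2 : (2 <= d)%N) :
  (forall delta : R, - d%:R < delta -> delta < 1 -> delta <> 0 ->
     same_order (energy_gap d delta)
                (fun N : nat => N%:R `^ (- 1 - delta / d%:R)))
  /\
  same_order (energy_gap d (0 : R)) (fun N : nat => N%:R^-1 * ln N%:R).
Proof.
split; last exact: order_zero.
move=> delta dlow dlt1 /eqP dn0; have [dn|dp|d0] := ltgtP delta 0.
- exact: order_neg.
- by apply: order_pos; rewrite // dp.
- by rewrite d0 eqxx in dn0.
Qed.
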